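(* Let $H$, $G$ be Hilbert spaces and let $A:D(A)\subset H\to H$ be a positive self-adjoint operator with compact resolvent such that, for some $\omega>0$, $|Au|\ge \omega|u|$ for all $u\in D(A)$. Let $\mathbf B^{*}\in\mathcal L(H_2\times H;G)$ be such that for all $T>0$ there is $C>0$ such that for all $(w^0,w^1)\in H_1\times H$ and all $f\in L^2([0,T];H)$ the solution $w$ of $w''+Aw=f$, $(w,w')(0)=(w^0,w^1)$ satisfies, with $W=(w,w')$, $$\int_0^T\|\mathbf B^{*}(w,w')\|_G^2dt\le C\Big(e_1(W)(0)+e_1(W)(T)+\int_0^Te_1(W)(t)dt+\int_0^T|f|^2dt\Big).$$ Let $C_{21}$ be a bounded operator on $H$ such that $C_{21}^{*}\in\mathcal L(H_k)$ for $k\in\{0,1\}$, $\|C_{21}\|=\beta$ and $|C_{21}w|^2\le\beta\langle C_{21}w,w\rangle$ for all $w\in H$. Then the following two assertions are equivalent. (I) There exists $T_3>0$ such that for all $T>T_3$ there exists $C>0$ such that for all $U^0=(u_1^0,u_2^0,u_1^1,u_2^1)\in \mathcal H=H_1^2\times H^2$ the solution of $$u_1''+Au_1=0,\qquad u_2''+Au_2+C_{21}u_1=0,\qquad (u_i,u_i')(0)=(u_i^0,u_i^1)\ (i=1,2)$$ satisfies $C\big(e_0(U_1)(0)+e_1(U_2)(0)\big)\le\int_0^T\|\mathbf B^{*}U_2\|_G^2\,dt$. (II) There is $T_0>0$ such that for all $T>T_0$ there are $C_1(T),C_2(T)>0$ such that for all $(w^0,w^1)\in H_1\times H$ the solution of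 $w''+Aw=0$, $(w,w')(0)=(w^0,w^1)$ satisfies both $\int_0^T|C_{21}w'|^2dt\ge C_2(T)\,e_1(W)(0)$ and $\int_0^T\|\mathbf B^{*}(w,w')\|_G^2dt\ge C_1(T)\,e_1(W)(0)$.
   Context: $H$ has norm $|\cdot|$ and scalar product $\langle\cdot,\cdot\rangle$; $G$ has norm $\|\cdot\|_G$ and is identified with its dual. For $k\in\mathbb N$, $H_k=D(A^{k/2})$ (with $H_0=H$) has norm $|A^{k/2}u|$; $H_{-k}$ is the dual of $H_k$ with pivot space $H$, with norm $|A^{-k/2}u|$. For $k\in\mathbb Z$ and a function $V=(v_1,v_2)$ of time with values in $H_k\times H_{k-1}$, $e_k(V)(t)=\frac12\big(|A^{k/2}v_1(t)|^2+|A^{(k-1)/2}v_2(t)|^2\big)$. $W=(w,w')$ and, for a solution $(u_1,u_2)$ of the coupled system, $U_i=(u_i,u_i')$; the prime is the time derivative. For finite-energy solutions, $\mathbf B^{*}(w,w')\in L^2([0,T];G)$ is understood as the extension by continuity from regular data permitted by the admissibility inequality. *)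

(* Defs.v *)
From HB Require Import structures.
From mathcomp Require Import all_boot all_order all_algebra.
From mathcomp Require Import all_classical all_reals all_analysis.

Set Implicit Arguments.
Unset Strict Implicit.
Unset Printing Implicit Defensive.
Import Order.TTheory GRing.Theory Num.Theory.
Import numFieldNormedType.Exports.

Local Open Scope classical_set_scope.
Local Open Scope ring_scope.

(* Hilbert spaces are real. A complex Hilbert space is covered by taking its
   underlying real space with the real part of its scalar product. *)
HB.mixin Record CompleteNormedModule_isHilbert (R : realType) H
    of CompleteNormedModule R H := {
  inner : H -> H -> R;
  innerC : forall x y, inner x y = inner y x;
  innerDl : forall x y z, inner (x + y) z = inner x z + inner y z;
  innerZl : forall (a : R) x y, inner (a *: x) y = a * inner x y;
  inner_norm : forall x, inner x x = `|x| ^+ 2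
}.

#[short(type="hilbertType")]
HB.structure Definition Hilbert (R : realType) :=
  { H of CompleteNormedModule R H & CompleteNormedModule_isHilbert R H }.

(* Unbounded operators: the values of [opfun] outside [dom] are irrelevant. *)
Record operator (R : realType) (H : hilbertType R) := Operator {
  dom : set H;
  opfun :> H -> H
}.

Section Operators.
Context {R : realType} {H : hilbertType R}.
Implicit Types A S : operator H.

Definition linear_operator A :=
  dom A 0 /\
  forall (a : R) x y, dom A x -> dom A y ->
    dom A (a *: x + y) /\ A (a *: x + y) = a *: A x + A y.

(* (y, z) belongs to the graph of the adjoint of A *)
Definition adjoint_graph A (y z : H) :=
  forall x, dom A x -> inner (A x) y = inner x z.

Definition self_adjoint A :=
  [/\ linear_operator A, closure (dom A) = setT &
      forall y z, adjoint_graph A y z <-> dom A y /\ A y = z].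

Definition positive_operator A := forall x, dom A x -> 0 <= inner (A x) x.

Definition compact_map (K : H -> H) :=
  precompact (K @` [set x | `|x| <= 1]).

Definition compact_resolvent A :=
  exists (lambda : R) (K : {linear H -> H}),
    [/\ forall x, dom A x -> K (A x - lambda *: x) = x,
        forall y, dom A (K y) /\ A (K y) - lambda *: K y = y &
        compact_map K].

Definition is_sqrt A S :=
  [/\ self_adjoint S, positive_operator S,
      dom A = [set x | dom S x /\ dom S (S x)] &
      forall x, dom A x -> A x = S (S x)].

(* A^(1/2); a positive self-adjoint operator has exactly one positive
   self-adjoint square root. *)
Definition sqrt_operator A : operator H :=
  if pselect (exists S, is_sqrt A S) is left ex then projT1 (cid ex) else A.

Definition inv_operator S (x : H) : H :=
  xget 0 [set y | dom S y /\ S y = x].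

(* A^(k/2) *)
Definition half_power A (k : int) : H -> H :=
  match k with
  | Posz n => iter n (sqrt_operator A)
  | Negz n => iter n.+1 (inv_operator (sqrt_operator A))
  end.

(* H_k = D(A^(k/2)) for k >= 0 *)
Definition Hspace A (k : nat) : set H :=
  [set x | forall i, (i < k)%N ->
             dom (sqrt_operator A) (iter i (sqrt_operator A) x)].

Definition bounded_on_Hspace A (k : nat) (L : H -> H) :=
  [/\ forall x, Hspace A k x -> Hspace A k (L x),
      forall (a : R) x y, Hspace A k x -> Hspace A k y ->
        L (a *: x + y) = a *: L x + L y &
      exists M : R, forall x, Hspace A k x ->
        `|half_power A k (L x)| <= M * `|half_power A k x|].

Definition bounded_op (L : {linear H -> H}) :=
  exists M : R, forall x, `|L x| <= M * `|x|.

Definition opnorm (L : {linear H -> H}) : R :=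
  sup [set `|L x| | x in [set x : H | `|x| <= 1]].

Definition adjoint (L : {linear H -> H}) (y : H) : H :=
  xget 0 [set z | forall x, inner (L x) y = inner x z].

Definition energy A (k : int) (V : R -> H * H) (t : R) : R :=
  2^-1 * (`|half_power A k (V t).1| ^+ 2
          + `|half_power A (k - 1) (V t).2| ^+ 2).

End Operators.

(* B in L(H_2 x H; G); the values of B outside H_2 x H are irrelevant. *)
Definition observation_op (R : realType) (H G : hilbertType R)
    (A : operator H) (B : H * H -> G) :=
  (forall (a : R) (x y : H * H), Hspace A 2 x.1 -> Hspace A 2 y.1 ->
     B (a *: x + y) = a *: B x + B y) /\
  (exists M : R, forall x : H * H, Hspace A 2 x.1 ->
     `|B x| <= M * (`|half_power A 2 x.1| + `|x.2|)).

Section TimeFunctions.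
Context {R : realType}.

Definition integral0T (T : R) (g : R -> R) : \bar R :=
  (\int[lebesgue_measure]_(t in `[0%R, T]) (g t)%:E)%E.

(* A class in L^2([0,T];V) is given by a representative which is on [0,T] the
   pointwise limit of simple functions; every class has one. *)
Definition strongly_measurable (V : normedModType R) (T : R) (f : R -> V) :=
  exists s : nat -> R -> V,
    (forall n, finite_set (range (s n)) /\
               forall v, measurable (s n @^-1` [set v])) /\
    (forall t, t \in `[0, T] -> s n t @[n --> \oo] --> f t).

Definition L2 (V : normedModType R) (T : R) (f : R -> V) :=
  strongly_measurable T f /\
  (integral0T T (fun t => (`|f t| ^+ 2)%R) < +oo)%E.

Context {H : hilbertType R}.
Implicit Types A : operator H.

(* w in C([0,T];H_k) *)
Definition C0_Hspace A (k : nat) (T : R) (w : R -> H) :=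
  (forall t, t \in `[0, T] -> Hspace A k (w t)) /\
  {within `[0, T], continuous (half_power A k \o w)}.

(* w in C^1([0,T];H_k) with derivative dw: continuity of w and dw up to the end
   points makes dw the one-sided derivative there. *)
Definition C1_Hspace A (k : nat) (T : R) (w dw : R -> H) :=
  [/\ C0_Hspace A k T w, C0_Hspace A k T dw &
      forall t : R, 0 < t < T ->
        is_derive t 1 (half_power A k \o w) (half_power A k (dw t))].

(* W = (w, w') where w in C([0,T];H_1) /\ C^1([0,T];H) is the finite energy
   solution of w'' + A w = f, (w, w')(0) = (w0, w1). The equation holds in
   H_(-1), the dual of H_1: it is tested against v in H_1 and integrated over
   [0,t], with <A w, v> = <A^(1/2) w, A^(1/2) v>. *)
Definition wave_solution A (T : R) (f : R -> H) (w0 w1 : H)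
    (W : R -> H * H) :=
  [/\ C0_Hspace A 1 T (fun t => (W t).1),
      C1_Hspace A 0 T (fun t => (W t).1) (fun t => (W t).2),
      W 0 = (w0, w1) &
      forall v, Hspace A 1 v -> forall t, t \in `[0, T] ->
        inner (W t).2 v = inner w1 v +
          \int[lebesgue_measure]_(s in `[0, t])
             (inner (f s) v
              - inner (half_power A 1 (W s).1) (half_power A 1 v))].

(* W = (w, w') with w in C([0,T];H_2) /\ C^1([0,T];H_1) /\ C^2([0,T];H) and
   w'' + A w = f; f is then in C([0,T];H). *)
Definition regular_solution A (T : R) (f : R -> H) (W : R -> H * H) :=
  [/\ C0_Hspace A 2 T (fun t => (W t).1),
      C1_Hspace A 1 T (fun t => (W t).1) (fun t => (W t).2) &
      exists ddw : R -> H,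
        C1_Hspace A 0 T (fun t => (W t).2) ddw /\
        forall t, t \in `[0, T] -> ddw t + A (W t).1 = f t].

(* y is B(w, w') in L^2([0,T];G), where W = (w, w') is the finite energy
   solution with source f: y is the limit of B(w_n, w_n') for regular solutions
   w_n whose data (w_n, w_n')(0) and f_n converge to those of w in
   H_1 x H and L^2([0,T];H). Under the admissibility inequality such a y exists
   and does not depend, as a class, on the approximating sequence. *)
Definition is_observation (G : hilbertType R) A (B : H * H -> G) (T : R)
    (f : R -> H) (W : R -> H * H) (y : R -> G) :=
  L2 T y /\
  exists (f_ : nat -> R -> H) (W_ : nat -> R -> H * H),
    [/\ forall n, regular_solution A T (f_ n) (W_ n),
        energy A 1 (fun t => W_ n t - W t) 0 @[n --> \oo] --> (0 : R),
        integral0T T (fun t => `|f_ n t - f t| ^+ 2) @[n --> \oo] --> 0%E &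
        integral0T T (fun t => `|B (W_ n t) - y t| ^+ 2) @[n --> \oo] --> 0%E].

Definition admissible (G : hilbertType R) A (B : H * H -> G) :=
  forall T : R, 0 < T -> exists2 C : R, 0 < C &
    forall (w0 w1 : H) (f : R -> H) (W : R -> H * H) (y : R -> G),
      Hspace A 1 w0 -> L2 T f ->
      wave_solution A T f w0 w1 W -> is_observation A B T f W y ->
      (integral0T T (fun t => (`|y t| ^+ 2)%R) <=
       C%:E * ((energy A 1 W 0)%:E + (energy A 1 W T)%:E
               + integral0T T (energy A 1 W)
               + integral0T T (fun t => (`|f t| ^+ 2)%R)))%E.

(* u1'' + A u1 = 0, u2'' + A u2 + C21 u1 = 0, with U_i = (u_i, u_i') *)
Definition cascade_solution A (C21 : {linear H -> H}) (T : R)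
    (u10 u20 u11 u21 : H) (U1 U2 : R -> H * H) :=
  wave_solution A T (fun=> 0) u10 u11 U1 /\
  wave_solution A T (fun t => - C21 (U1 t).1) u20 u21 U2.

Definition cascade_observability (G : hilbertType R) A (B : H * H -> G)
    (C21 : {linear H -> H}) :=
  exists2 T3 : R, 0 < T3 & forall T, T3 < T -> exists2 C : R, 0 < C &
    forall (u10 u20 u11 u21 : H) (U1 U2 : R -> H * H) (y : R -> G),
      Hspace A 1 u10 -> Hspace A 1 u20 ->
      cascade_solution A C21 T u10 u20 u11 u21 U1 U2 ->
      is_observation A B T (fun t => - C21 (U1 t).1) U2 y ->
      ((C * (energy A 0 U1 0 + energy A 1 U2 0))%:E <=
       integral0T T (fun t => (`|y t| ^+ 2)%R))%E.

Definition wave_observability (G : hilbertType R) A (B : H * H -> G)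
    (C21 : {linear H -> H}) :=
  exists2 T0 : R, 0 < T0 & forall T, T0 < T ->
    exists C1 C2 : R, [/\ 0 < C1, 0 < C2 &
    forall (w0 w1 : H) (W : R -> H * H),
      Hspace A 1 w0 ->
      wave_solution A T (fun=> 0) w0 w1 W ->
      ((C2 * energy A 1 W 0)%:E <=
         integral0T T (fun t => (`|C21 (W t).2| ^+ 2)%R))%E /\
      (forall y : R -> G, is_observation A B T (fun=> 0) W y ->
         ((C1 * energy A 1 W 0)%:E <=
            integral0T T (fun t => (`|y t| ^+ 2)%R))%E)].

End TimeFunctions.

(* Main.v *)
(** In an orthonormal basis of eigenvectors of [A] the wave equation splits into
scalar oscillators: free waves are given by cosines and sines, forced ones by
Duhamel's formula, and energy estimates hold coordinatewise.

(II) implies (I). Let [T*] be an observation time in (II) and let [D] be the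
integral of [|C21 u1|^2] over [[0, N T*]]. Since the derivative of
[<u1', u2> - <u1, u2'>] is [<C21 u1, u1>], the square of [D] is at most a
constant times [e_0(U1) S], where [S] is the sum of the energies [e_1(U2)] at
[0] and [N T*]. The free wave [- A^(-1) u1'] has velocity [u1], so observing it
on the [N] windows of length [T*] gives [D >= N c2 e_0(U1)]; hence [D <= c S / N].
On the first and the last window, subtracting from [u2] the free wave with the
same initial data leaves a forced wave with zero data, to which admissibility
applies: [S] is bounded by the observation plus a multiple of [D] that does not
depend on [N]. For [N] large the latter is absorbed.

(I) implies (II). With [u1 = 0], (I) is the observability of free waves through
[B]. With zero initial data for [u2], admissibility bounds the observation in (I)
by the integral of [|C21 u1|^2]; this is done for finitely many modes, where [u2]
is regular, and then extended by density. *)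

(* The observation of a finite energy solution exists only as a limit, so each estimate involving
   [B] is proved for regular solutions, where [B (w, w')] is continuous in time, and then carried to
   the limit together with its data. The two energies in (I) differ by one level because the product
   of [u1'] and [u2] pairs H_(-1) with H_1. Passing between a free wave and its velocity shifts the
   level by one, and this links [e_0(U1)] to the energy [e_1] of (II) in both directions. Absorption
   succeeds because [e_0(U1)] is conserved: the lower bound for [D] grows linearly with the number
   of windows, while the constant in the upper bound for its square stays fixed. The energy
   [e_1(U2)] is not conserved; working only on the two extreme windows confines its growth to a
   factor independent of [N]. In the converse direction [C21] gives no smoothness in space beyond
   [H]. A source that is differentiable in time also produces regular solutions, and finitely many
   modes supply such a source. *)
Require Import Defs.
From mathcomp Require Import all_boot all_order all_algebra.
From mathcomp Require Import all_classical all_reals all_analysis.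
From mathcomp Require Import measurable_realfun ring lra.

Set Implicit Arguments.
Unset Strict Implicit.
Unset Printing Implicit Defensive.
Import Order.TTheory GRing.Theory Num.Theory.
Import numFieldNormedType.Exports.

Local Open Scope classical_set_scope.
Local Open Scope ring_scope.

(** * Coordinates in an orthonormal basis *)

Section InnerProduct.
Context {R : realType} {H : hilbertType R}.
Implicit Types (x y z : H) (a : R).

Lemma inner0l y : inner 0 y = 0 :> R.
Proof. by rewrite -(scale0r (0 : H)) innerZl mul0r. Qed.

Lemma inner0r y : inner y 0 = 0 :> R.
Proof. by rewrite innerC inner0l. Qed.

Lemma innerDr x y z : inner x (y + z) = inner x y + inner x z.
Proof. by rewrite innerC innerDl !(innerC x). Qed.

Lemma innerZr a x y : inner x (a *: y) = a * inner x y.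
Proof. by rewrite innerC innerZl innerC. Qed.

Lemma innerNl x y : inner (- x) y = - inner x y.
Proof. by rewrite -scaleN1r innerZl mulN1r. Qed.

Lemma innerNr x y : inner x (- y) = - inner x y.
Proof. by rewrite innerC innerNl innerC. Qed.

Lemma innerBl x y z : inner (x - y) z = inner x z - inner y z.
Proof. by rewrite innerDl innerNl. Qed.

Lemma innerBr x y z : inner x (y - z) = inner x y - inner x z.
Proof. by rewrite innerDr innerNr. Qed.

Lemma inner_suml (I : Type) (r : seq I) (P : pred I) (F : I -> H) y :
  inner (\sum_(i <- r | P i) F i) y = \sum_(i <- r | P i) inner (F i) y :> R.
Proof.
by apply: (big_morph (fun x => inner x y)) => [a b|]; [exact: innerDl|exact: inner0l].
Qed.

Lemma inner_sumr (I : Type) (r : seq I) (P : pred I) (F : I -> H) y :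
  inner y (\sum_(i <- r | P i) F i) = \sum_(i <- r | P i) inner y (F i) :> R.
Proof. by rewrite innerC inner_suml; apply: eq_bigr => i _; rewrite innerC. Qed.

Lemma normD2 x y : `|x + y| ^+ 2 = `|x| ^+ 2 + 2 * inner x y + `|y| ^+ 2 :> R.
Proof. by rewrite -!inner_norm !innerDl !innerDr (innerC y x); ring. Qed.

Lemma normB2 x y : `|x - y| ^+ 2 = `|x| ^+ 2 - 2 * inner x y + `|y| ^+ 2 :> R.
Proof. by rewrite normD2 innerNr normrN; ring. Qed.

Lemma inner_le x y : `|inner x y| <= `|x| * `|y| :> R.
Proof.
have [->|y0] := eqVneq y 0; first by rewrite inner0r !normr0 mulr0.
have yp : 0 < `|y| ^+ 2 :> R by rewrite exprn_gt0 ?normr_gt0.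
have := normB2 (`|y| ^+ 2 *: x) (inner x y *: y).
rewrite innerZl innerZr !normrZ !exprMn !real_normK ?num_real// => E.
have : 0 <= `|(`|y| ^+ 2 *: x) - inner x y *: y| ^+ 2 :> R by apply: sqr_ge0.
rewrite E => {}E.
have h : 0 <= `|y| ^+ 2 * (`|x| ^+ 2 * `|y| ^+ 2 - inner x y ^+ 2) :> R.
  by apply: le_trans E _; rewrite le_eqVlt; apply/orP; left; apply/eqP; ring.
rewrite pmulr_rge0// subr_ge0 in h.
rewrite -(@ler_pXn2r _ 2)// ?nnegrE ?mulr_ge0//.
by rewrite real_normK ?num_real// exprMn.
Qed.

Lemma inner_ler x y : inner x y <= `|x| * `|y| :> R.
Proof. exact: le_trans (ler_norm _) (inner_le x y). Qed.

End InnerProduct.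

Section Basis.
Context {R : realType} {H : hilbertType R}.

Definition ortho_family (e : nat -> H) :=
  (forall i j, i != j -> inner (e i) (e j) = 0 :> R) /\
  (forall i, e i = 0 \/ `|e i| = 1 :> R).

Definition complete_family (e : nat -> H) :=
  forall x, (forall k, inner x (e k) = 0 :> R) -> x = 0.

Variable e : nat -> H.
Hypothesis eO : ortho_family e.
Implicit Types x y z : H.

(** A coordinate along a zero vector vanishes, and otherwise [e k] is a unit vector. This spares
    computations with [psum] a case distinction on the zero vectors. *)
Lemma coord_idem x k : inner x (e k) * `|e k| ^+ 2 = inner x (e k) :> R.
Proof.
by case: eO => _ /(_ k)[->|->]; rewrite ?inner0r ?mul0r// expr1n mulr1.
Qed.

Definition psum (a : nat -> R) n : H := \sum_(k < n) a k *: e k.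

Lemma coord_psum a n k :
  inner (psum a n) (e k) = (k < n)%:R * (a k * `|e k| ^+ 2) :> R.
Proof.
rewrite inner_suml; have [kn|nk] := ltnP k n.
  rewrite (bigD1 (Ordinal kn))//= innerZl inner_norm big1 ?addr0 ?mul1r// => i.
  by rewrite -val_eqE/= => ik; rewrite innerZl (proj1 eO) ?mulr0.
rewrite mul0r big1// => i _; rewrite innerZl (proj1 eO) ?mulr0//.
by rewrite neq_ltn (leq_trans (ltn_ord i)).
Qed.

Lemma coord_psum_mul (m : nat -> R) x n k :
  inner (psum (fun k => m k * inner x (e k)) n) (e k) =
  (k < n)%:R * m k * inner x (e k) :> R.
Proof. by rewrite coord_psum -mulrA coord_idem mulrA. Qed.

Lemma inner_psum a n x :
  inner x (psum a n) = \sum_(k < n) a k * inner x (e k) :> R.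
Proof. by rewrite inner_sumr; apply: eq_bigr => i _; rewrite innerZr. Qed.

Lemma norm_psum_mul (m : nat -> R) x n :
  `|psum (fun k => m k * inner x (e k)) n| ^+ 2 =
  \sum_(k < n) (m k * inner x (e k)) ^+ 2 :> R.
Proof.
rewrite -inner_norm inner_psum; apply: eq_bigr => i _.
by rewrite coord_psum_mul ltn_ord mul1r expr2.
Qed.

Lemma bessel x n : \sum_(k < n) inner x (e k) ^+ 2 <= `|x| ^+ 2 :> R.
Proof.
set p := psum (fun k => 1 * inner x (e k)) n.
have E1 : `|p| ^+ 2 = \sum_(k < n) inner x (e k) ^+ 2 :> R.
  by rewrite norm_psum_mul; apply: eq_bigr => i _; rewrite mul1r.
have E2 : inner x p = \sum_(k < n) inner x (e k) ^+ 2 :> R.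
  by rewrite inner_psum; apply: eq_bigr => i _; rewrite mul1r expr2.
have : 0 <= `|x - p| ^+ 2 :> R by exact: sqr_ge0.
by rewrite normB2 E1 E2; lra.
Qed.

Lemma psumB a p q : (p <= q)%N ->
  psum a q - psum a p = psum (fun k => (p <= k)%:R * a k) q.
Proof.
move=> pq; rewrite /psum -!(big_mkord xpredT (fun k => a k *: e k)).
rewrite -(big_mkord xpredT (fun k => ((p <= k)%:R * a k) *: e k)).
rewrite !(@big_cat_nat _ _ _ p 0 q)//= addrAC subrr add0r.
rewrite [X in _ = X + _]big1_seq ?add0r => [|k].
  by apply: eq_big_nat => k /andP[-> _]; rewrite mul1r.
by rewrite mem_index_iota => /= kp; rewrite leqNgt kp mul0r scale0r.
Qed.

(** By Bessel's inequality the squared coordinates are summable, and a bounded multiplier enlarges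
    their tails by at most the square of its bound; the partial sums are therefore Cauchy. *)
Lemma cvg_psum_mul (m : nat -> R) (M : R) x : (forall k, `|m k| <= M) ->
  cvgn (psum (fun k => m k * inner x (e k))).
Proof.
move=> mM; have M0 : 0 <= M by apply: le_trans (mM 0%N).
have cvS : cvgn (series (fun k => inner x (e k) ^+ 2 : R)).
  apply: nondecreasing_is_cvgn.
    by apply: nondecreasing_series => // k _ _; exact: sqr_ge0.
  exists (`|x| ^+ 2) => _ [n _ <-].
  by rewrite /series/= big_mkord; exact: bessel.
apply/cauchy_cvgP/cauchy_ballP => eps eps0.
move/cauchy_cvgP/cauchy_seriesP : cvS => cvS.
(* The [+ 1] keeps the divisor positive when [M] is zero. *)
have [|[A B] [/= [N _ AN] [N' _ BN]] AB] := cvS ((eps / (M + 1)) ^+ 2).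
  by rewrite exprn_gt0// divr_gt0// ltr_wpDl.
have main p q : (N + N' <= p)%N -> (p <= q)%N ->
    `|psum (fun k => m k * inner x (e k)) q - psum (fun k => m k * inner x (e k)) p| < eps.
  move=> Np pq.
  rewrite psumB// (_ : (fun k => _) =
      (fun k => ((p <= k)%:R * m k) * inner x (e k))); last first.
    by apply/funext => k; rewrite mulrA.
  have := AB (p, q); rewrite /= => /(_ _)/wrap[].
    split; [apply: AN => /=; exact: leq_trans (leq_addr _ _) Np|].
    by apply: BN => /=; apply: leq_trans pq; exact: leq_trans (leq_addl _ _) Np.
  rewrite ger0_norm ?sumr_ge0// => [|k _]; last exact: sqr_ge0.
  move=> lt; rewrite -(@ltr_pXn2r _ 2)// ?nnegrE ?(ltW eps0)//; rewrite norm_psum_mul.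
  have : \sum_(k < q) ((p <= k)%:R * m k * inner x (e k)) ^+ 2 <=
     (M + 1) ^+ 2 * \sum_(p <= k < q) inner x (e k) ^+ 2 :> R.
    rewrite -(big_mkord xpredT (fun k => ((p <= k)%:R * m k * inner x (e k)) ^+ 2)).
    rewrite (@big_cat_nat _ _ _ p 0 q)//=.
    rewrite [X in X + _]big1_seq ?add0r => [|k]; last first.
      by rewrite mem_index_iota => /= kp; rewrite leqNgt kp mul0r mul0r expr0n.
    rewrite mulr_sumr; apply: ler_sum_nat => k /andP[pk _].
    rewrite pk mul1r exprMn ler_wpM2r ?sqr_ge0//.
    rewrite -real_normK ?num_real// ler_pXn2r ?nnegrE ?addr_ge0//.
    by apply: le_trans (mM k) _; rewrite lerDl.
  move/le_lt_trans; apply.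
  by rewrite mulrC -ltr_pdivlMr ?exprn_gt0 ?ltr_wpDl// -expr_div_n.
set P := psum _.
exists ([set P n | n in [set n | (N + N' <= n)%N]],
        [set P n | n in [set n | (N + N' <= n)%N]]).
  by split; exists (N + N')%N => // n /= Nn; exists n.
move=> [_ _] /= [[p Np <-] [q Nq <-]]; rewrite -ball_normE/=.
by have [pq|/ltnW qp] := leqP p q; [rewrite distrC|]; exact: main.
Qed.

(* Meaningful for bounded [m] only: [limn] of a divergent sequence is junk. *)
Definition diag_mul (m : nat -> R) x : H :=
  limn (psum (fun k => m k * inner x (e k))).

Lemma cvg_inner (u : nat -> H) x y :
  u n @[n --> \oo] --> x -> inner (u n) y @[n --> \oo] --> (inner x y : R).
Proof.
move=> ux; apply/cvgrPdist_le => eps eps0.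
have y0 : 0 < `|y| + 1 :> R by rewrite ltr_wpDl.
move/cvgrPdist_le : ux => /(_ _ (divr_gt0 eps0 y0)); apply: filterS => n xun.
rewrite -innerBl (le_trans (inner_le _ _))//.
have : `|x - u n| * (`|y| + 1) <= eps :> R by rewrite -ler_pdivlMr.
by apply: le_trans; rewrite ler_wpM2l// lerDl.
Qed.

Lemma coord_diag_mul (m : nat -> R) (M : R) x k : (forall k, `|m k| <= M) ->
  inner (diag_mul m x) (e k) = m k * inner x (e k) :> R.
Proof.
move=> mM; have := @cvg_inner _ _ (e k) (@cvg_psum_mul m M x mM).
move/cvg_lim => <-//; apply: lim_near_cst => //.
by exists k.+1 => // n /= kn; rewrite coord_psum_mul kn mul1r.
Qed.

Hypothesis eC : complete_family e.

Lemma coord_inj x y : (forall k, inner x (e k) = inner y (e k) :> R) -> x = y.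
Proof.
by move=> xy; apply/subr0_eq/eC => k; rewrite innerBl xy subrr.
Qed.

Definition coord_trunc n x : H := psum (fun k => inner x (e k)) n.

Lemma coord_truncE n x k :
  inner (coord_trunc n x) (e k) = (k < n)%:R * inner x (e k) :> R.
Proof. by rewrite /coord_trunc coord_psum coord_idem. Qed.

Lemma cvg_coord_trunc x : coord_trunc n x @[n --> \oo] --> x.
Proof.
have m1 : forall k : nat, `|1 : R| <= 1 by rewrite normr1.
have E : coord_trunc^~ x = psum (fun k => 1 * inner x (e k)).
  by apply/funext => n; rewrite /coord_trunc; congr psum; apply/funext => k; rewrite mul1r.
rewrite E; have {2}-> : x = diag_mul (fun=> 1) x.
  by apply: coord_inj => k; rewrite (coord_diag_mul _ _ m1) mul1r.
exact: cvg_psum_mul m1.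
Qed.

(** Parseval's identity: pairing [y] with a truncation of [x] gives the finite sum. Identities and
    bounds in [H] are reduced to coordinates through this limit. *)
Lemma cvg_coord_inner x y :
  \sum_(k < n) inner x (e k) * inner y (e k) @[n --> \oo] --> (inner x y : R).
Proof.
have := @cvg_inner _ _ y (@cvg_coord_trunc x).
apply: cvg_trans; apply: near_eq_cvg; apply: nearW => n.
by rewrite /= innerC inner_psum.
Qed.

Lemma inner_coord x y x' y' :
  (forall k, inner x (e k) * inner y (e k) =
             inner x' (e k) * inner y' (e k) :> R) ->
  inner x y = inner x' y' :> R.
Proof.
move=> E; apply: (@cvg_unique _ _ _ _ _ _ (@cvg_coord_inner x y) _) => //.
apply: cvg_trans (@cvg_coord_inner x' y'); apply: near_eq_cvg.
by apply: nearW => n /=; apply: eq_bigr => k _; rewrite E.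
Qed.

Lemma inner_coord_ge0 x y :
  (forall k, 0 <= inner x (e k) * inner y (e k) :> R) -> 0 <= inner x y :> R.
Proof.
move=> xy; have cv := @cvg_coord_inner x y; rewrite -(cvg_lim _ cv)//.
apply: limr_ge; first by apply/cvg_ex; exists (inner x y).
by apply: nearW => n /=; exact: sumr_ge0.
Qed.

Lemma norm2_le_coord x (M : R) :
  (forall n, \sum_(k < n) inner x (e k) ^+ 2 <= M) -> `|x| ^+ 2 <= M.
Proof.
move=> xM; rewrite -inner_norm.
have cv := @cvg_coord_inner x x; rewrite -(cvg_lim _ cv)//.
apply: limr_le; first by apply/cvg_ex; exists (inner x x).
apply: nearW => n /=; apply: le_trans (xM n).
by apply: ler_sum => k _; rewrite expr2.
Qed.

Lemma norm_le_coord x y (M : R) : 0 <= M ->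
  (forall k, inner x (e k) ^+ 2 <= M ^+ 2 * inner y (e k) ^+ 2 :> R) ->
  `|x| <= M * `|y|.
Proof.
move=> M0 xy; rewrite -(@ler_pXn2r _ 2)// ?nnegrE ?mulr_ge0// exprMn.
apply: norm2_le_coord => n.
apply: (@le_trans _ _ (M ^+ 2 * \sum_(k < n) inner y (e k) ^+ 2)).
  by rewrite mulr_sumr ler_sum.
by rewrite ler_wpM2l ?sqr_ge0// bessel.
Qed.

Lemma norm_diag_mul_le (m : nat -> R) (M : R) x : (forall k, `|m k| <= M) ->
  `|diag_mul m x| <= M * `|x|.
Proof.
move=> mM; have M0 : 0 <= M by apply: le_trans (mM 0%N).
apply: norm_le_coord => // k; rewrite (coord_diag_mul _ _ mM) exprMn.
rewrite ler_wpM2r ?sqr_ge0// -real_normK ?num_real//.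
by rewrite ler_pXn2r ?nnegrE.
Qed.

(** An energy has two components that exchange mass in time, so estimates hold for the sum of their
    squared coordinates and not for each norm separately. *)
Lemma cvg_coord_norm2D x y :
  \sum_(k < n) (inner x (e k) ^+ 2 + inner y (e k) ^+ 2) @[n --> \oo] -->
  (`|x| ^+ 2 + `|y| ^+ 2 : R).
Proof.
have cv : (\sum_(k < n) inner x (e k) * inner x (e k)
    + \sum_(k < n) inner y (e k) * inner y (e k)) @[n --> \oo] -->
    (inner x x + inner y y : R) by apply: cvgD; exact: cvg_coord_inner.
rewrite -!inner_norm; apply: cvg_trans cv; apply: near_eq_cvg.
by apply: nearW => n /=; rewrite -big_split.
Qed.

Lemma norm2D_le_coord x y (M : R) :
  (forall n, \sum_(k < n) (inner x (e k) ^+ 2 + inner y (e k) ^+ 2) <= M) ->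
  `|x| ^+ 2 + `|y| ^+ 2 <= M.
Proof.
move=> xyM; have cv := @cvg_coord_norm2D x y; rewrite -(cvg_lim _ cv)//.
apply: limr_le; first by apply/cvg_ex; exists (`|x| ^+ 2 + `|y| ^+ 2).
by apply: nearW => n; exact: xyM.
Qed.

Lemma norm2D_coord x y x' y' :
  (forall k, inner x (e k) ^+ 2 + inner y (e k) ^+ 2 =
             inner x' (e k) ^+ 2 + inner y' (e k) ^+ 2 :> R) ->
  `|x| ^+ 2 + `|y| ^+ 2 = `|x'| ^+ 2 + `|y'| ^+ 2 :> R.
Proof.
move=> E; rewrite -(cvg_lim _ (@cvg_coord_norm2D x y))//; apply: cvg_lim => //.
apply: cvg_trans (@cvg_coord_norm2D x' y'); apply: near_eq_cvg.
by apply: nearW => n /=; apply: eq_bigr => k _; rewrite E.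
Qed.

End Basis.

(** * Spectral theorem for a compact symmetric operator *)

Lemma norm_small_eq0 (R : realType) (V : normedModType R) (C : R) (x : V) :
  (forall d : R, 0 < d -> `|x| <= C * d) -> x = 0.
Proof.
move=> xC; apply/eqP; rewrite -normr_le0; apply/ler_addgt0Pl => d d0.
rewrite addr0; have C0 : 0 < `|C| + 1 by rewrite ltr_wpDl.
apply: le_trans (xC (d / (`|C| + 1)) _) _; first by rewrite divr_gt0.
rewrite mulrCA ler_piMr ?(ltW d0)// ler_pdivrMr// mul1r.
by apply: le_trans (ler_norm _) _; rewrite lerDl.
Qed.

Section Spectral.
Context {R : realType} {H : hilbertType R}.
Variable K : {linear H -> H}.
Hypothesis Ksym : forall x y, inner (K x) y = inner x (K y) :> R.
Hypothesis Kinj : forall x, K x = 0 -> x = 0.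
Hypothesis Kcpt : compact_map K.
Implicit Types x y z : H.

(** A cluster point, approached at arbitrarily late indices, replaces a convergent subsequence. *)
Lemma compact_map_cluster (u : nat -> H) : (forall i, `|u i| <= 1) ->
  exists y, forall (eps : R) N, 0 < eps ->
    exists2 i, (N <= i)%N & `|K (u i) - y| < eps.
Proof.
move=> u1; move: Kcpt; rewrite /compact_map precompactE => Kc.
have FK : (K (u n) @[n --> \oo]) (closure (K @` [set x | `|x| <= 1])).
  by exists 0%N => // n _; apply: subset_closure; exists (u n) => //; exact: u1.
have [y [_ yc]] := Kc _ _ FK.
exists y => eps N eps0.
have [||_ [[i /= Ni <-] yi]] := yc [set K (u i) | i in [set i | (N <= i)%N]] (ball y eps).
- by exists N => // i /= Ni; exists i.
- exact: nbhsx_ballx.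
by exists i => //; rewrite distrC; move: yi; rewrite -ball_normE.
Qed.

Lemma compact_map_bounded : exists M : R, forall x, `|K x| <= M * `|x|.
Proof.
move: Kcpt; rewrite /compact_map precompactE => /compact_bounded[M [_ Mb]].
exists (`|M| + 1) => x; have [->|x0] := eqVneq x 0.
  by rewrite linear0 !normr0 mulr0.
have := Mb (`|M| + 1); rewrite ltr_pwDr ?ler_norm// => /(_ isT) /(_ (K (`|x|^-1 *: x))).
have nx : 0 < `|x| by rewrite normr_gt0.
rewrite linearZ/= normrZ normfV normr_id => /(_ _)/wrap[].
  apply: subset_closure; exists (`|x|^-1 *: x); last by rewrite linearZ.
  by rewrite /= normrZ normfV normr_id mulVf ?gt_eqF.
by rewrite ler_pdivrMl// mulrC.
Qed.

Definition perp (s : seq H) := [set x | forall v, v \in s -> inner x v = 0 :> R].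

Definition eigen_list (s : seq H) :=
  forall v, v \in s -> exists k : R, K v = k *: v.

Lemma perp_invariant s x : eigen_list s -> perp s x -> perp s (K x).
Proof.
by move=> es xs v vs; have [k Kv] := es _ vs; rewrite Ksym Kv innerZr xs ?mulr0.
Qed.

(** Let [S] be the supremum of [|K x|] over the unit ball of the complement. Along a maximizing
    sequence, [K (K u) - S^2 u] tends to zero; compactness turns this into an eigenvector [z0] of
    the square of [K] for [S^2]. Since [(K + S)(K - S) z0 = 0], either [z0] itself or [K z0 - S z0]
    is an eigenvector of [K], for [S] or [- S]. *)
Lemma exists_max_eigen s : eigen_list s -> (exists2 x, perp s x & x != 0) ->
  exists z (k : R), [/\ perp s z, `|z| = 1, K z = k *: z &
    forall x, perp s x -> `|K x| <= `|k| * `|x|].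
Proof.
move=> es [x0 sx0 x0n]; have [M KM] := compact_map_bounded.
have perpD x y : perp s x -> perp s y -> perp s (x + y).
  by move=> sx sy v vs; rewrite innerDl sx ?sy ?addr0.
have perpZ (a : R) x : perp s x -> perp s (a *: x).
  by move=> sx v vs; rewrite innerZl sx ?mulr0.
pose E := [set `|K x| | x in perp s `&` [set x | `|x| <= 1]].
have Esup : has_sup E.
  split; first by exists `|K 0|, 0 => //; split=> /= [v _|]; rewrite ?inner0l// normr0.
  exists `|M| => _ [x [_ /= x1] <-]; apply: le_trans (KM x) _.
  apply: le_trans (_ : `|M| * `|x| <= _); last by rewrite ler_piMr.
  by rewrite ler_wpM2r// ler_norm.
pose S := sup E.
have KS x : perp s x -> `|K x| <= S * `|x|.
  move=> sx; have [->|xn] := eqVneq x 0; first by rewrite linear0 !normr0 mulr0.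
  have nx : 0 < `|x| by rewrite normr_gt0.
  have : `|K (`|x|^-1 *: x)| <= S.
    apply: sup_upper_bound => //; exists (`|x|^-1 *: x) => //; split; first exact: perpZ.
    by rewrite /= normrZ normfV normr_id mulVf ?gt_eqF.
  by rewrite linearZ/= normrZ normfV normr_id ler_pdivrMl// mulrC.
have S0 : 0 < S.
  have nx0 : 0 < `|x0| by rewrite normr_gt0.
  rewrite -(pmulr_lgt0 S nx0); apply: lt_le_trans (KS _ sx0).
  by rewrite normr_gt0; apply/eqP => /Kinj xe; rewrite xe eqxx in x0n.
have /choice[u uP] (i : nat) : exists x, [/\ perp s x, `|x| <= 1 &
    S - i.+1%:R^-1 < `|K x|].
  have [|_ [x [sx x1] <-] lt] := @sup_adherent _ E (i.+1%:R^-1) _ Esup.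
    by rewrite invr_gt0.
  by exists x.
have [y yP] := compact_map_cluster (fun i => let: And3 _ h _ := uP i in h).
(* Expanding the square and using [|K (K u)| <= S |K u|] leaves at most [S^2 (S^2 - |K u|^2)], which
   is small because [|K u|] is within [1 / (i + 1)] of [S]. *)
have KKu i : `|K (K (u i)) - S ^+ 2 *: u i| ^+ 2 <= 2 * S ^+ 3 * i.+1%:R^-1.
  have [su u1] := uP i; move: (i.+1%:R^-1 : R) => q ult.
  rewrite normB2 innerZr Ksym inner_norm normrZ exprMn.
  rewrite [`|S ^+ 2|]ger0_norm ?sqr_ge0//.
  have h1 : `|K (K (u i))| ^+ 2 <= S ^+ 2 * `|K (u i)| ^+ 2.
    rewrite -exprMn ler_pXn2r ?nnegrE ?mulr_ge0 ?(ltW S0)//.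
    by apply: KS; exact: perp_invariant.
  have h2 : S ^+ 2 ^+ 2 * `|u i| ^+ 2 <= S ^+ 2 ^+ 2.
    by rewrite ler_piMr ?sqr_ge0// expr_le1.
  have h3 : S ^+ 2 - 2 * S * q <= `|K (u i)| ^+ 2.
    have [Si|iS] := leP S (q).
      apply: le_trans (sqr_ge0 _).
      have : 0 <= S * (q - S) by rewrite mulr_ge0 ?subr_ge0 ?(ltW S0).
      have : 0 <= S * S by rewrite mulr_ge0 ?(ltW S0).
      by nra.
    have : (S - q) ^+ 2 <= `|K (u i)| ^+ 2.
      by rewrite ler_pXn2r ?nnegrE ?subr_ge0 ?(ltW iS)// ltW.
    apply: le_trans; have : 0 <= q ^+ 2 by exact: sqr_ge0.
    by nra.
  have S2 : 0 <= S ^+ 2 by exact: sqr_ge0.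
  have : 0 <= S ^+ 2 * (`|K (u i)| ^+ 2 - (S ^+ 2 - 2 * S * q)).
    by rewrite mulr_ge0// subr_ge0.
  by nra.
have approx (d : R) : 0 < d -> exists i, [/\ `|K (u i) - y| < d,
    `|K (K (u i)) - S ^+ 2 *: u i| < d & S - d < `|K (u i)|].
  (* Any index beyond [q] makes both [2 S^3 / (i + 1)] smaller than [d^2] and [1 / (i + 1)] at most
     [d]. *)
  move=> d0; pose q := 2 * S ^+ 3 / d ^+ 2 + d^-1.
  have q0 : 0 < q by rewrite ltr_wpDl ?invr_gt0 ?divr_ge0 ?mulr_ge0 ?exprn_ge0 ?(ltW S0) ?(ltW d0).
  have [N Nq] : exists N : nat, q < N%:R.
    by exists (Num.truncn q).+1; exact: truncnS_gt.
  have [i Ni yi] := yP d N d0; exists i; split => //.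
    rewrite -(@ltr_pXn2r _ 2)// ?nnegrE ?(ltW d0)//; apply: le_lt_trans (KKu i) _.
    rewrite ltr_pdivrMr ?ltr0n// -ltr_pdivrMl ?exprn_gt0// mulrC.
    apply: le_lt_trans (_ : q < _); first by rewrite lerDl invr_ge0 ltW.
    by apply: lt_le_trans Nq _; rewrite ler_nat leqW.
  have [_ _] := uP i; apply: le_lt_trans; rewrite lerD2l lerN2.
  rewrite invf_ple ?posrE// ?ltr0n//; apply: le_trans (_ : q <= _).
    by rewrite lerDr divr_ge0 ?mulr_ge0 ?exprn_ge0 ?(ltW S0) ?(ltW d0).
  by apply: le_trans (ltW Nq) _; rewrite ler_nat leqW.
(* Since [u i] is close to [S^-2 K (K (u i))] and [K (u i)] to [y], this is the limit that the [u i]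
   must have. *)
pose z0 := (S ^+ 2)^-1 *: K y.
have S2 : 0 < S ^+ 2 by rewrite exprn_gt0.
have M0 : 0 <= `|M| by [].
have KM' x : `|K x| <= `|M| * `|x|.
  by apply: le_trans (KM x) _; rewrite ler_wpM2r// ler_norm.
pose L := (S ^+ 2)^-1 * (`|M| + 1).
have zu i (d : R) : `|K (u i) - y| < d -> `|K (K (u i)) - S ^+ 2 *: u i| < d ->
    `|z0 - u i| <= L * d.
  move=> h1 h2; have -> : z0 - u i =
     (S ^+ 2)^-1 *: (- K (K (u i) - y) + (K (K (u i)) - S ^+ 2 *: u i)).
    rewrite linearB/= opprB addrA subrK scalerBr scalerA mulVf ?gt_eqF//.
    by rewrite scale1r.
  rewrite normrZ ger0_norm ?invr_ge0 ?(ltW S2)// /L -mulrA ler_pM2l ?invr_gt0//.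
  apply: le_trans (ler_normD _ _) _; rewrite normrN mulrDl mul1r lerD ?(ltW h2)//.
  by apply: le_trans (KM' _) _; rewrite ler_wpM2l// ltW.
have L0 : 0 <= L by rewrite mulr_ge0 ?addr_ge0 ?invr_ge0 ?(ltW S2).
have sz0 : perp s z0.
  move=> v vs; apply: (@norm_small_eq0 _ _ (L * `|v|)) => d d0.
  have [i [h1 h2 _]] := approx d d0; have [su _ _] := uP i.
  rewrite -[inner z0 v]subr0 -(su v vs) -innerBl.
  apply: le_trans (inner_le _ _) _; rewrite mulrAC ler_wpM2r//.
  exact: zu h1 h2.
have KKz : K (K z0) = S ^+ 2 *: z0.
  apply/subr0_eq/(@norm_small_eq0 _ _ ((`|M| ^+ 2 + S ^+ 2) * L + 1)) => d d0.
  have [i [h1 h2 _]] := approx d d0.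
  have -> : K (K z0) - S ^+ 2 *: z0 = K (K (z0 - u i)) - S ^+ 2 *: (z0 - u i) +
      (K (K (u i)) - S ^+ 2 *: u i).
    rewrite (linearB K) (linearB K) scalerBr opprB -addrA.
    by rewrite [_ - S ^+ 2 *: z0 + _]addrC !subrKA.
  apply: le_trans (ler_normD _ _) _; rewrite mulrDl mul1r lerD ?(ltW h2)//.
  apply: le_trans (ler_normB _ _) _; rewrite -mulrA mulrDl lerD//.
    apply: le_trans (KM' _) _; rewrite expr2 -mulrA ler_wpM2l//.
    apply: le_trans (KM' _) _; rewrite ler_wpM2l//; exact: zu h1 h2.
  rewrite normrZ ger0_norm ?(ltW S2)// ler_wpM2l ?(ltW S2)//; exact: zu h1 h2.
have z00 : z0 != 0.
  apply/eqP => z0e; have C0 : 0 < `|M| * L + 1.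
    by rewrite ltr_wpDl// mulr_ge0.
  (* With this [d], [z0 = 0] would give [|K (u i)| <= |M| L d = S - d], against the third bound of
     [approx]. *)
  have d0 := divr_gt0 S0 C0.
  have [i [h1 h2]] := approx _ d0; apply/negP; rewrite -leNgt.
  have := zu i _ h1 h2; rewrite z0e sub0r normrN => ui.
  apply: le_trans (KM' _) _.
  have -> : S - S / (`|M| * L + 1) = `|M| * (L * (S / (`|M| * L + 1))).
    by field; rewrite gt_eqF.
  by rewrite ler_wpM2l.
have normed (z : H) (k : R) : z != 0 -> perp s z -> K z = k *: z -> `|k| = S ->
    exists z (k : R), [/\ perp s z, `|z| = 1, K z = k *: z &
    forall x, perp s x -> `|K x| <= `|k| * `|x|].
  move=> zn sz Kz kS; exists (`|z|^-1 *: z), k; split.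
  - exact: perpZ.
  - by rewrite normrZ normfV normr_id mulVf ?normr_eq0.
  - by rewrite linearZ/= Kz !scalerA mulrC.
  - by move=> x sx; rewrite kS; exact: KS.
clearbody z0.
have [w0|wn] := eqVneq (K z0 - S *: z0) 0.
  apply: (normed z0 S) => //; first exact: subr0_eq.
  by rewrite ger0_norm// ltW.
apply: (normed (K z0 - S *: z0) (- S)) => //.
- apply: perpD; first exact: perp_invariant.
  by rewrite -scaleNr; exact: perpZ.
- rewrite (linearB K) KKz linearZ/= scalerBr scaleNr scaleNr scalerA -expr2 opprK.
  by rewrite addrC.
- by rewrite normrN ger0_norm// ltW.
Qed.

(** Maximal eigenvectors are split off one by one; once the complement is trivial the family
    continues with zeros. If some nonzero [x] were orthogonal to all of them, maximality would give
    [|k n| >= |K x| / |x|] for every [n], so the images [K (e n)] of orthonormal vectors would stay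
    a fixed distance apart, contradicting compactness. *)
Lemma exists_eigenbasis : exists (e : nat -> H) (k : nat -> R),
  [/\ ortho_family e, complete_family e & forall n, K (e n) = k n *: e n].
Proof.
(* The premise [eigen_list s] sits under the existential, so that choice gives a function on all
   lists and the recursion carries no proofs. *)
have next s : exists p : H * R, eigen_list s ->
    [/\ perp s p.1, p.1 = 0 \/ `|p.1| = 1, K p.1 = p.2 *: p.1,
        forall x, perp s x -> `|K x| <= `|p.2| * `|x| &
        p.1 = 0 -> forall x, perp s x -> x = 0].
  have [es|] := pselect (eigen_list s); last by exists (0, 0).
  have [nz|z] := pselect (exists2 x, perp s x & x != 0).
    have [z [k [sz z1 Kz zk]]] := exists_max_eigen es nz.
    exists (z, k) => _; split => //=; first by right.
    by move=> z0; move: z1 => /eqP; rewrite z0 normr0 eq_sym oner_eq0.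
  have s0 x : perp s x -> x = 0.
    by move=> sx; apply/eqP; apply: contra_notT z => xn; exists x.
  exists (0, 0) => _; split => //=; first by move=> v _; exact: inner0l.
  - by left.
  - by rewrite linear0 scaler0.
  - by move=> x /s0 ->; rewrite linear0 !normr0 mulr0.
have [f fP] := choice next.
pose l := fix l n := if n is n'.+1 then (f (l n')).1 :: l n' else [::] : seq H.
pose e n := (f (l n)).1; pose k n := (f (l n)).2.
have le n : eigen_list (l n).
  elim: n => [v|n IH v]; rewrite /= ?in_nil// in_cons => /orP[/eqP->|/IH//].
  by have [_ _ ? _ _] := fP _ IH; exists (f (l n)).2.
have eP n := fP _ (le n).
have mem_l n v : v \in l n -> exists2 i, (i < n)%N & v = e i.
  elim: n => [|n IH] /=; rewrite ?in_nil// in_cons => /orP[/eqP->|/IH[i lin ->]].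
    by exists n.
  by exists i => //; exact: ltnW.
have l_mem i n : (i < n)%N -> e i \in l n.
  elim: n => // n IH; rewrite ltnS leq_eqVlt => /orP[/eqP->|/IH].
    exact: mem_head.
  by rewrite [l n.+1]/= in_cons => ->; rewrite orbT.
have eO : ortho_family e.
  split=> [i j|i]; last by have [_ ? _ _ _] := eP i.
  wlog: i j / (j < i)%N => [hw|ji _].
    by rewrite neq_ltn => /orP[|] lt; [rewrite innerC|]; apply: hw; rewrite // gtn_eqF.
  by have [+ _ _ _ _] := eP i => /(_ _ (l_mem _ _ ji)).
exists e, k; split => //; last by move=> n; have [_ _ ? _ _] := eP n.
move=> x xe; apply/Kinj/eqP/negPn/negP => Kx0.
have lx n : perp (l n) x by move=> v /mem_l[i _ ->]; exact: xe.
have xn0 : x != 0 by apply: contra_neq Kx0 => ->; rewrite linear0.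
have nx : 0 < `|x| by rewrite normr_gt0.
pose d := `|K x| / `|x|.
have d0 : 0 < d by rewrite divr_gt0// normr_gt0.
have kd n : d <= `|k n|.
  by rewrite ler_pdivrMr//; have [_ _ _ + _] := eP n => /(_ _ (lx n)).
have e1 n : `|e n| = 1.
  have [_ [e0|//] _ _ h] := eP n.
  by have := h e0 _ (lx n) => /eqP; rewrite (negbTE xn0).
have e1_le n : `|e n| <= 1 by rewrite e1.
have [y yP] := compact_map_cluster e1_le.
have d2 : 0 < d / 2 by rewrite divr_gt0.
have [i _ yi] := yP _ 0%N d2; have [j ij yj] := yP _ i.+1 d2.
have : `|K (e i) - K (e j)| < d.
  rewrite [d]splitr (_ : _ - _ = (K (e i) - y) - (K (e j) - y)); last first.
    by rewrite opprB subrKA.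
  by apply: le_lt_trans (ler_normB _ _) _; exact: ltrD.
rewrite -(@ltr_pXn2r _ 2)// ?nnegrE ?(ltW d0)// normB2.
have -> : K (e i) = k i *: e i by have [_ _ ? _ _] := eP i.
have -> : K (e j) = k j *: e j by have [_ _ ? _ _] := eP j.
rewrite innerZl innerZr (proj1 eO) ?ltn_eqF// !mulr0 subr0.
rewrite !normrZ !e1 !mulr1 ltNge => /negP; apply.
apply: le_trans (_ : `|k i| ^+ 2 <= _); last by rewrite lerDl sqr_ge0.
by rewrite ler_pXn2r ?nnegrE ?(ltW d0).
Qed.

End Spectral.

(** * Diagonal operators and the square root of A *)

Section Diagonal.
Context {R : realType} {H : hilbertType R}.
Implicit Types (A S T : operator H) (x y z : H).

(** A relation, since [m] may be unbounded: the existence of [z] expresses that the scaled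
    coordinates are square summable, which is the natural domain of a diagonal operator. *)
Definition coord_scaled (e : nat -> H) (m : nat -> R) x z :=
  forall k, inner z (e k) = m k * inner x (e k).

Definition diagonal_in (e : nat -> H) (m : nat -> R) T :=
  (forall x, dom T x <-> exists z, coord_scaled e m x z) /\
  (forall x, dom T x -> coord_scaled e m x (T x)).

Lemma self_adjoint_sym T x y : self_adjoint T -> dom T x -> dom T y ->
  inner (T x) y = inner x (T y).
Proof. by move=> [_ _ aT] Tx Ty; have [_ ->] := aT y (T y). Qed.

Lemma linear_operator0 T : linear_operator T -> T 0 = 0.
Proof.
move=> [T0 lT]; have [_] := lT 0 0 0 T0 T0; rewrite scaler0 addr0 => ->.
by rewrite scale0r add0r; have [_] := lT (-1) 0 0 T0 T0; rewrite scaler0 addr0 => {1}->; rewrite scaleN1r addNr.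
Qed.

Lemma linear_operatorB T x y : linear_operator T -> dom T x -> dom T y ->
  dom T (x - y) /\ T (x - y) = T x - T y.
Proof.
move=> [_ lT] Tx Ty; have [] := lT (-1) y x Ty Tx.
by rewrite !scaleN1r !(addrC (- _)).
Qed.

Lemma linear_operatorZ T a x : linear_operator T -> dom T x ->
  dom T (a *: x) /\ T (a *: x) = a *: T x.
Proof.
move=> lT Tx; have [] := (proj2 lT) a x 0 Tx (proj1 lT).
by rewrite !addr0 (linear_operator0 lT) addr0.
Qed.

Variable e : nat -> H.
Hypothesis eO : ortho_family e.
Hypothesis eC : complete_family e.

(** A self-adjoint operator has no proper symmetric extension: any pair related by [coord_scaled]
    satisfies the adjoint relation, hence belongs to the graph of [T]. *)
Lemma self_adjoint_diagonal T (m : nat -> R) : self_adjoint T ->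
  (forall k, dom T (e k) /\ T (e k) = m k *: e k) -> diagonal_in e m T.
Proof.
move=> aT Te; have coordT x : dom T x -> coord_scaled e m x (T x).
  move=> Tx k; have [Tek Tke] := Te k.
  by rewrite (self_adjoint_sym aT)// Tke innerZr.
split=> // x; split=> [Tx|[z zP]]; first by exists (T x); exact: coordT.
suff /(proj1 (let: And3 _ _ h := aT in h x z))[] : adjoint_graph T x z by [].
move=> v Tv; apply: (inner_coord eO eC) => k; rewrite zP coordT//.
by ring.
Qed.

Definition diagonal_operator (m : nat -> R) : operator H :=
  Operator [set x | exists z, coord_scaled e m x z]
           (fun x => xget 0 (coord_scaled e m x)).

Lemma diagonal_operatorE m x z : coord_scaled e m x z ->
  diagonal_operator m x = z.
Proof.
move=> xz; apply: (coord_inj eC) => k; rewrite xz /=.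
by case: xgetP => [y _ -> //|/(_ z)]; case.
Qed.

Lemma diagonal_operator_dom m x : dom (diagonal_operator m) x ->
  coord_scaled e m x (diagonal_operator m x).
Proof. by move=> [z zP]; rewrite (diagonal_operatorE zP). Qed.

Lemma coord_scaled_trunc m x n : coord_scaled e m (coord_trunc e n x)
  (psum e (fun k => m k * inner x (e k)) n).
Proof. by move=> k; rewrite coord_psum_mul// coord_truncE// mulrCA mulrA. Qed.

(** The domain is dense because it contains all truncations. Testing the adjoint relation on each
    [e k] determines the coordinates of the adjoint. *)
Lemma diagonal_self_adjoint m : self_adjoint (diagonal_operator m).
Proof.
have lin (a : R) x y z w : coord_scaled e m x z -> coord_scaled e m y w ->
    coord_scaled e m (a *: x + y) (a *: z + w).
  by move=> xz yw k; rewrite !innerDl !innerZl xz yw; ring.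
split.
- split; first by exists 0 => k; rewrite inner0l mulr0.
  move=> a x y [z xz] [w yw]; split; first by exists (a *: z + w); exact: lin.
  by rewrite (diagonal_operatorE xz) (diagonal_operatorE yw); apply: diagonal_operatorE; exact: lin.
- apply/seteqP; split => // x _.
  move=> B /(cvg_coord_trunc eO eC)[N _ /(_ N (leqnn N)) /= BN].
  exists (coord_trunc e N x); split => //.
  by exists (psum e (fun k => m k * inner x (e k)) N); exact: coord_scaled_trunc.
- move=> y z; split=> [yz|[Dy Dyz] x Dx].
    have h : coord_scaled e m y z.
      move=> k; have ek : coord_scaled e m (e k) (m k *: e k).
        move=> j; rewrite innerZl; have [->//|kj] := eqVneq k j.
        by rewrite (proj1 eO)// !mulr0.
      rewrite innerC -yz; last by exists (m k *: e k).
      by rewrite (diagonal_operatorE ek) innerZl innerC.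
    by split; [exists z|exact: diagonal_operatorE].
  apply: (inner_coord eO eC) => k; rewrite -Dyz !diagonal_operator_dom//.
  by ring.
Qed.

End Diagonal.

(** * Eigenbasis of A and of its square root *)

Section Eigenbasis.
Context {R : realType} {H : hilbertType R}.
Implicit Types x y z : H.

(** The [mu k] are the frequencies, square roots of the eigenvalues of [A]. Their lower bound [m0]
    makes the inverse powers bounded multipliers; at a zero vector [e k] the value of [mu k] only
    has to respect it. *)
Record eigenbasis (A : operator H) (e : nat -> H) (mu : nat -> R) (m0 : R) : Prop :=
  Eigenbasis {
  eigen_ortho : ortho_family e;
  eigen_complete : complete_family e;
  eigen_gt0 : 0 < m0;
  eigen_ge : forall k, m0 <= mu k;
  eigen_A : diagonal_in e (fun k => mu k ^+ 2) A;
  eigen_sqrt : diagonal_in e mu (sqrt_operator A) }.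

(** The resolvent [K] at [lam] is symmetric and injective; an eigenvalue [k n] of [K] corresponds to
    the eigenvalue [1 / k n + lam] of [A]. *)
Lemma compact_resolvent_eigen (A : operator H) (omega : R) :
  self_adjoint A -> positive_operator A -> compact_resolvent A ->
  0 < omega -> (forall u, dom A u -> omega * `|u| <= `|A u|) ->
  exists (e : nat -> H) (l : nat -> R), [/\ ortho_family e, complete_family e,
    forall k, omega <= l k & forall k, dom A (e k) /\ A (e k) = l k *: e k].
Proof.
move=> aA pA [lam [K [KA AK Kc]]] om0 Aom; have [lA _ _] := aA.
have AKE x : x = A (K x) - lam *: K x by have [] := AK x.
have Ksym x y : inner (K x) y = inner x (K y) :> R.
  rewrite {1}[y]AKE {2}[x]AKE innerBl innerBr innerZl innerZr.
  by rewrite (self_adjoint_sym aA)//; have [] := AK x; have [] := AK y.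
have Kinj x : K x = 0 -> x = 0.
  by move=> Kx; rewrite [x]AKE Kx (linear_operator0 lA) scaler0 subr0.
have [e [k [eO eC Ke]]] := exists_eigenbasis Ksym Kinj Kc.
have eig n : exists l : R, omega <= l /\ dom A (e n) /\ A (e n) = l *: e n.
  (* A zero vector is an eigenvector for every number; [omega] is assigned so that the lower bound
     holds at all indices. *)
  have [e0|e1] := proj2 eO n.
    exists omega; rewrite e0 (linear_operator0 lA) scaler0.
    by split => //; split => //; exact: (proj1 lA).
  have en0 : e n != 0 by rewrite -normr_eq0 e1 oner_eq0.
  have k0 : k n != 0.
    by apply: contra_neq en0 => k0; apply: Kinj; rewrite Ke k0 scale0r.
  have Kk : K ((k n)^-1 *: e n) = e n by rewrite linearZ/= Ke scalerA mulVf// scale1r.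
  have [dA] := AK ((k n)^-1 *: e n); rewrite Kk in dA *.
  move/eqP; rewrite subr_eq => /eqP Ae.
  have {}Ae : A (e n) = ((k n)^-1 + lam) *: e n by rewrite Ae scalerDl.
  exists ((k n)^-1 + lam); split => //.
  (* Positivity of [A] fixes the sign of the eigenvalue, so the lower bound on [|A u|] bounds the
     eigenvalue itself. *)
  have := Aom _ dA; have := pA _ dA; rewrite Ae innerZl inner_norm normrZ e1.
  by rewrite expr1n !mulr1 => h; rewrite ger0_norm.
have [l lP] := choice eig.
by exists e, l; split => // n; have [] := lP n.
Qed.

(** Without an existing root [sqrt_operator] takes the default value [A]. The intermediate vector
    [A^(1/2) x] is obtained from [A x] through the bounded multiplier [1 / mu]. *)
Lemma exists_is_sqrt (A : operator H) e (mu : nat -> R) (m0 : R) :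
  self_adjoint A -> ortho_family e -> complete_family e ->
  0 < m0 -> (forall k, m0 <= mu k) ->
  diagonal_in e (fun k => mu k ^+ 2) A ->
  is_sqrt A (diagonal_operator e mu).
Proof.
move=> aA eO eC m00 mu0 [dA AE].
have mup k : 0 < mu k by apply: lt_le_trans (mu0 k).
have imu k : `|(mu k)^-1| <= m0^-1.
  by rewrite normfV gtr0_norm// lef_pV2 ?posrE.
have root x : dom A x -> exists2 y, coord_scaled e mu x y & coord_scaled e mu y (A x).
  move=> Ax; exists (diag_mul e (fun k => (mu k)^-1) (A x)) => k.
    by rewrite (coord_diag_mul eO _ _ imu) AE// expr2 -mulrA mulKf ?gt_eqF.
  by rewrite (coord_diag_mul eO _ _ imu) mulVKf ?gt_eqF.
split.
- exact: diagonal_self_adjoint.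
- move=> x [z xz]; rewrite (diagonal_operatorE eC xz).
  apply: (inner_coord_ge0 eO eC) => k; rewrite xz -mulrA -expr2.
  by rewrite mulr_ge0 ?sqr_ge0// ltW.
- apply/seteqP; split=> [x /root[y xy yA]|x [[y xy]]].
    split; first by exists y.
    by rewrite (diagonal_operatorE eC xy); exists (A x).
  rewrite (diagonal_operatorE eC xy) => -[z yz]; apply/dA.
  by exists z => k; rewrite yz xy expr2 mulrA.
- move=> x /root[y xy yA].
  by rewrite (diagonal_operatorE eC xy) (diagonal_operatorE eC yA).
Qed.

Lemma sqrt_operatorP (A S : operator H) :
  is_sqrt A S -> is_sqrt A (sqrt_operator A).
Proof.
move=> AS; rewrite /sqrt_operator; case: pselect => [ex|]; last by case; exists S.
by case: cid.
Qed.

(* [(S + mu)(S - mu) v = 0] and [S + mu] is injective, [S] being positive. *)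
Lemma sqrt_eigenvector (A S : operator H) (mu : R) v : 0 < mu -> is_sqrt A S ->
  dom A v -> A v = mu ^+ 2 *: v -> dom S v /\ S v = mu *: v.
Proof.
move=> mu0 [[lS _ _] pS dA AE] Av; rewrite AE// => SSv.
have [Sv SSv'] : dom S v /\ dom S (S v) by move: Av; rewrite dA.
split => //; apply/eqP; rewrite -subr_eq0 -normr_eq0 -sqrf_eq0.
have [Sm SmE] := linear_operatorZ mu lS Sv.
have [Sw SwE] := linear_operatorB lS SSv' Sm.
set w := S v - mu *: v in Sw SwE *.
have Sww : S w = - mu *: w.
  by rewrite SwE SSv SmE /w scalerBr !scaleNr scalerA opprK expr2 addrC.
have := pS _ Sw; rewrite Sww innerZl inner_norm mulNr oppr_ge0.
by rewrite pmulr_rle0// => w0; rewrite eq_le w0 sqr_ge0.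
Qed.

(** The root picked by choice need not be the diagonal one by construction. It is identified by
    [sqrt_eigenvector]: any positive root acts on the eigenvectors as [mu], and self-adjointness
    then fixes it. *)
Lemma exists_eigenbasis_operator (A : operator H) (omega : R) :
  self_adjoint A -> positive_operator A -> compact_resolvent A ->
  0 < omega -> (forall u, dom A u -> omega * `|u| <= `|A u|) ->
  exists e mu m0, eigenbasis A e mu m0.
Proof.
move=> aA pA cA om0 Aom.
have [e [l [eO eC lom Ae]]] := compact_resolvent_eigen aA pA cA om0 Aom.
have l0 k : 0 <= l k by apply: le_trans (lom k); exact: ltW.
have sl k : Num.sqrt (l k) ^+ 2 = l k by rewrite sqr_sqrtr.
have m00 : 0 < Num.sqrt omega by rewrite sqrtr_gt0.
have mul0 k : Num.sqrt omega <= Num.sqrt (l k) by rewrite ler_sqrt.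
have dA : diagonal_in e (fun k => Num.sqrt (l k) ^+ 2) A.
  by apply: self_adjoint_diagonal => // k; rewrite sl.
have sA := sqrt_operatorP (exists_is_sqrt aA eO eC m00 mul0 dA).
exists e, (fun k => Num.sqrt (l k)), (Num.sqrt omega); split => //.
apply: self_adjoint_diagonal => // [|k]; first by case: sA.
apply: (sqrt_eigenvector _ sA); first by apply: lt_le_trans (mul0 k).
  by have [] := Ae k.
by rewrite sl; have [] := Ae k.
Qed.

End Eigenbasis.

(** * Half powers of A in coordinates *)

Section HalfPowers.
Context {R : realType} {H : hilbertType R}.
Variables (A : operator H) (e : nat -> H) (mu : nat -> R) (m0 : R).
Hypothesis eb : eigenbasis A e mu m0.
Implicit Types x y z : H.

Let eO := eigen_ortho eb.
Let eC := eigen_complete eb.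

Lemma mu_gt0 k : 0 < mu k.
Proof. exact: lt_le_trans (eigen_gt0 eb) (eigen_ge eb k). Qed.

Lemma invmu_le k : `|(mu k)^-1| <= m0^-1.
Proof.
rewrite normfV gtr0_norm ?mu_gt0// lef_pV2 ?posrE ?mu_gt0//.
  exact: eigen_ge eb k.
exact: eigen_gt0 eb.
Qed.

Lemma Hspace1_dom x : Hspace A 1 x <-> dom (sqrt_operator A) x.
Proof. by split=> [/(_ 0%N isT)//|Sx [|]//]. Qed.

Lemma Hspace1P x : Hspace A 1 x <-> exists z, coord_scaled e mu x z.
Proof. by rewrite Hspace1_dom; exact: (proj1 (eigen_sqrt eb) x). Qed.

Lemma coord_half1 x : Hspace A 1 x -> coord_scaled e mu x (half_power A 1 x).
Proof. by move=> /Hspace1_dom/(proj2 (eigen_sqrt eb)). Qed.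

Lemma half1E x z : coord_scaled e mu x z -> half_power A 1 x = z.
Proof.
move=> xz; apply: (coord_inj eC) => k; rewrite xz coord_half1//.
by apply/Hspace1P; exists z.
Qed.

Lemma Hspace2_dom x :
  Hspace A 2 x <-> Hspace A 1 x /\ Hspace A 1 (half_power A 1 x).
Proof.
rewrite !Hspace1_dom; split=> [h|[h0 h1] [|[|]]//].
by split; [exact: (h 0%N)|exact: (h 1%N)].
Qed.

Lemma Hspace21 x : Hspace A 2 x -> Hspace A 1 x.
Proof. by move/Hspace2_dom => []. Qed.

Lemma coord_half2 x : Hspace A 2 x ->
  coord_scaled e (fun k => mu k ^+ 2) x (half_power A 2 x).
Proof.
move=> /Hspace2_dom[x1 x2] k.
by rewrite (coord_half1 x2) (coord_half1 x1) mulrA expr2.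
Qed.

(** Dividing the coordinates of [z] by [mu] produces a vector of [H], so the intermediate condition
    in the iterated domain is automatic. *)
Lemma Hspace2P x : Hspace A 2 x <->
  exists z, coord_scaled e (fun k => mu k ^+ 2) x z.
Proof.
split=> [x2|[z xz]]; first by exists (half_power A 2 x); exact: coord_half2.
have xy : coord_scaled e mu x (diag_mul e (fun k => (mu k)^-1) z).
  move=> k; rewrite (coord_diag_mul eO _ _ invmu_le) xz expr2 -mulrA mulKf//.
  by rewrite gt_eqF// mu_gt0.
apply/Hspace2_dom; split; apply/Hspace1P.
  by exists (diag_mul e (fun k => (mu k)^-1) z).
rewrite (half1E xy); exists z => k.
by rewrite (coord_diag_mul eO _ _ invmu_le) mulVKf// gt_eqF// mu_gt0.
Qed.

Lemma half2E x z : coord_scaled e (fun k => mu k ^+ 2) x z ->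
  half_power A 2 x = z.
Proof.
move=> xz; apply: (coord_inj eC) => k; rewrite xz coord_half2//.
by apply/Hspace2P; exists z.
Qed.

Lemma half2_operator x : Hspace A 2 x -> half_power A 2 x = A x.
Proof.
move=> x2; apply: half2E; apply: (proj2 (eigen_A eb)).
by apply/(proj1 (eigen_A eb) x)/Hspace2P.
Qed.

Lemma coord_scaled_lin (m : nat -> R) (a : R) x y z w :
  coord_scaled e m x z -> coord_scaled e m y w ->
  coord_scaled e m (a *: x + y) (a *: z + w).
Proof. by move=> xz yw k; rewrite !innerDl !innerZl xz yw; ring. Qed.

Lemma Hspace_lin (n : nat) (a : R) x y : (n <= 2)%N ->
  Hspace A n x -> Hspace A n y ->
  Hspace A n (a *: x + y) /\
  half_power A n (a *: x + y) = a *: half_power A n x + half_power A n y.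
Proof.
case: n => [|[|[|//]]] _ => [//|x1 y1|x2 y2].
  have h := coord_scaled_lin a (coord_half1 x1) (coord_half1 y1).
  by split; [apply/Hspace1P; eexists; exact: h|exact: half1E].
have h := coord_scaled_lin a (coord_half2 x2) (coord_half2 y2).
by split; [apply/Hspace2P; eexists; exact: h|exact: half2E].
Qed.

Lemma Hspace_0 (n : nat) : (n <= 2)%N -> Hspace A n 0 /\ half_power A n 0 = 0.
Proof.
have h (m : nat -> R) : coord_scaled e m 0 0 by move=> k; rewrite inner0l mulr0.
case: n => [|[|[|//]]] _ => [//||].
  by split; [apply/Hspace1P; eexists; exact: h|exact: half1E].
by split; [apply/Hspace2P; eexists; exact: h|exact: half2E].
Qed.

Lemma Hspace_B (n : nat) x y : (n <= 2)%N -> Hspace A n x -> Hspace A n y ->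
  Hspace A n (x - y) /\ half_power A n (x - y) = half_power A n x - half_power A n y.
Proof.
move=> n2 xn yn; have := Hspace_lin (-1) n2 yn xn.
by rewrite !scaleN1r !(addrC (- _)).
Qed.

Lemma inv_sqrtE x z : coord_scaled e (fun k => (mu k)^-1) x z ->
  half_power A (- 1) x = z.
Proof.
move=> xz; have zx : coord_scaled e mu z x.
  by move=> k; rewrite xz mulVKf// gt_eqF// mu_gt0.
apply: (coord_inj eC) => k; rewrite xz /= /inv_operator.
case: xgetP => [y _ [Sy Sx]|/(_ z)]; last first.
  by case; split; [apply/Hspace1_dom/Hspace1P; exists x|exact: half1E].
move/Hspace1_dom/coord_half1 : Sy => /(_ k); rewrite /= Sx => ->.
by rewrite mulKf// gt_eqF// mu_gt0.
Qed.

Lemma coord_inv_sqrt x k :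
  inner (half_power A (- 1) x) (e k) = (mu k)^-1 * inner x (e k).
Proof.
rewrite (inv_sqrtE (z := diag_mul e (fun k => (mu k)^-1) x)).
  exact: (coord_diag_mul eO _ _ invmu_le).
by move=> j; exact: (coord_diag_mul eO _ _ invmu_le).
Qed.

Lemma half_power1_inj x : Hspace A 1 x -> half_power A 1 x = 0 -> x = 0.
Proof.
move=> x1 x0; apply: eC => k; have := coord_half1 x1 k; rewrite x0 inner0l.
by move/esym/eqP; rewrite mulf_eq0 gt_eqF ?mu_gt0//= => /eqP.
Qed.

Lemma energy1E (V : R -> H * H) t :
  energy A 1 V t = 2^-1 * (`|half_power A 1 (V t).1| ^+ 2 + `|(V t).2| ^+ 2).
Proof. by []. Qed.

Lemma energy0E (V : R -> H * H) t : energy A 0 V t =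
  2^-1 * (`|(V t).1| ^+ 2 + `|half_power A (- 1) (V t).2| ^+ 2).
Proof. by []. Qed.

Lemma energy1_ge0 (V : R -> H * H) t : 0 <= energy A 1 V t.
Proof. by rewrite energy1E mulr_ge0 ?invr_ge0 ?addr_ge0 ?sqr_ge0. Qed.

End HalfPowers.

(** * Calculus on a time interval *)

Section WithinContinuity.
Context {R : realType}.

Lemma withinD (V : normedModType R) (A : set R) (f g : R -> V) :
  {within A, continuous f} -> {within A, continuous g} ->
  {within A, continuous (fun x => f x + g x)}.
Proof. by move=> cf cg x; apply: cvgD; [exact: cf|exact: cg]. Qed.

Lemma withinN (V : normedModType R) (A : set R) (f : R -> V) :
  {within A, continuous f} -> {within A, continuous (fun x => - f x)}.
Proof. by move=> cf x; apply: cvgN; exact: cf. Qed.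

Lemma withinB (V : normedModType R) (A : set R) (f g : R -> V) :
  {within A, continuous f} -> {within A, continuous g} ->
  {within A, continuous (fun x => f x - g x)}.
Proof. by move=> cf cg x; apply: cvgB; [exact: cf|exact: cg]. Qed.

Lemma withinZ (V : normedModType R) (A : set R) (a : R -> R) (f : R -> V) :
  {within A, continuous a} -> {within A, continuous f} ->
  {within A, continuous (fun x => a x *: f x)}.
Proof. by move=> ca cf x; apply: cvgZ; [exact: ca|exact: cf]. Qed.

Lemma withinM (A : set R) (f g : R -> R) :
  {within A, continuous f} -> {within A, continuous g} ->
  {within A, continuous (fun x => f x * g x)}.
Proof. by move=> cf cg x; apply: cvgM; [exact: cf|exact: cg]. Qed.

Lemma within_cst (V : topologicalType) (A : set R) (v : V) :
  {within A, continuous (fun=> v)}.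
Proof. by move=> x; exact: cvg_cst. Qed.

Lemma within_norm (V : normedModType R) (A : set R) (f : R -> V) :
  {within A, continuous f} -> {within A, continuous (fun x => `|f x|)}.
Proof. by move=> cf x; apply: cvg_norm; exact: cf. Qed.

Lemma within_sqr_norm (V : normedModType R) (A : set R) (f : R -> V) :
  {within A, continuous f} -> {within A, continuous (fun x => `|f x| ^+ 2)}.
Proof.
by move=> /within_norm cf; under eq_fun do rewrite expr2; exact: withinM.
Qed.

Lemma within_lipschitz (V V' : normedModType R) (A : set R) (M : R)
    (f : R -> V) (g : R -> V') :
  (forall s t, A s -> A t -> `|g s - g t| <= M * `|f s - f t|) ->
  {within A, continuous f} -> {within A, continuous g}.
Proof.
move=> gf cf; apply/subspace_continuousP => t At; apply/cvgrPdist_le => eps eps0.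
have M0 : 0 < `|M| + 1 by rewrite ltr_wpDl.
move/subspace_continuousP : cf => /(_ t At)/cvgrPdist_le/(_ _ (divr_gt0 eps0 M0)).
rewrite !near_withinE; apply: filterS => s h As.
apply: le_trans (gf _ _ At As) _; have := h As; rewrite /= ler_pdivlMr//.
apply: le_trans; rewrite mulrC ler_wpM2l//.
by apply: le_trans (ler_norm _) _; rewrite lerDl.
Qed.

Lemma within_sqr (A : set R) (f : R -> R) :
  {within A, continuous f} -> {within A, continuous (fun x => f x ^+ 2)}.
Proof. by move=> cf; under eq_fun do rewrite expr2; exact: withinM. Qed.

Lemma within_sum (V : normedModType R) (A : set R) (n : nat) (f : nat -> R -> V) :
  (forall k, {within A, continuous (f k)}) ->
  {within A, continuous (fun x => \sum_(k < n) f k x)}.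
Proof.
move=> cf; elim: n => [|n IH].
  by under eq_fun do rewrite big_ord0; exact: within_cst.
by under eq_fun do rewrite big_ord_recr/=; exact: withinD.
Qed.

Lemma within_eq (V : topologicalType) (A : set R) (f g : R -> V) :
  (forall x, A x -> f x = g x) ->
  {within A, continuous f} -> {within A, continuous g}.
Proof.
move=> fg; apply: (subspace_eq_continuous (f := f)).
by move=> x; rewrite inE => /fg.
Qed.

(** The projection of the line onto [[0, T]]: composing with it turns continuity within the interval
    into continuity everywhere, which survives translations. *)
Definition clamp (T t : R) : R := Num.max 0 (Num.min t T).

Lemma clamp_in (T t : R) : 0 <= T -> 0 <= clamp T t <= T.
Proof. by move=> T0; rewrite /clamp le_max lexx ge_max T0 ge_min lexx orbT. Qed.

Lemma clampE (T t : R) : 0 <= t <= T -> clamp T t = t.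
Proof. by move=> /andP[t0 tT]; rewrite /clamp min_l// max_r. Qed.

Lemma clamp_continuous (T : R) : continuous (clamp T).
Proof.
move=> t; apply: (@continuous_max _ _ (fun=> 0) (fun t => Num.min t T)).
  exact: cvg_cst.
by apply: (@continuous_min _ _ id (fun=> T)); [exact: cvg_id|exact: cvg_cst].
Qed.

Lemma continuous_clamp (V : topologicalType) (T : R) (f : R -> V) : 0 <= T ->
  {within `[0, T], continuous f} -> continuous (f \o clamp T).
Proof.
move=> T0 /subspace_continuousP cf t B Bf.
have clT s : `[0, T]%classic (clamp T s) by rewrite /= in_itv/= clamp_in.
have := cf _ (clT t) _ Bf; rewrite /= nbhs_simpl /within/=.
move=> /(@clamp_continuous T t); rewrite /= !nbhs_simpl/=.
by apply: filterS => s /= /(_ (clT s)).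
Qed.

Lemma within_shift (V : topologicalType) (a T T' : R) (f : R -> V) :
  0 <= a -> 0 <= T -> a + T' <= T -> {within `[0, T], continuous f} ->
  {within `[0, T'], continuous (fun t => f (a + t))}.
Proof.
move=> a0 T0 aT cf; apply: (within_eq (f := fun t => (f \o clamp T) (a + t))).
  move=> x /=; rewrite in_itv/= => /andP[x0 xT].
  by rewrite clampE// addr_ge0//= (le_trans _ aT)// lerD2l.
apply: continuous_subspaceT => x.
apply: (@continuous_comp R R V (+%R a) (f \o clamp T)).
  by apply: cvgD; [exact: cvg_cst|exact: cvg_id].
exact: continuous_clamp.
Qed.

End WithinContinuity.

Section Primitive.
Context {R : realType}.
Implicit Types (f g : R -> R) (T t : R).

Lemma within_sub (V : topologicalType) (a T t : R) (f : R -> V) : t <= T ->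
  {within `[a, T], continuous f} -> {within `[a, t], continuous f}.
Proof.
by move=> tT; apply: continuous_subspaceW; apply: subset_itvl; rewrite bnd_simp.
Qed.

Lemma derive_le_itv T g dg : {within `[0, T], continuous g} ->
  (forall t, 0 < t < T -> is_derive t 1 g (dg t) /\ dg t <= 0) ->
  forall t, 0 <= t <= T -> g t <= g 0.
Proof.
move=> cg dgP t /andP[]; rewrite le_eqVlt => /orP[/eqP<-//|t0 tT].
have [||c] := @MVT _ g dg _ _ t0.
- move=> x /[!in_itv]/= /andP[x0 xt]; apply: (proj1 (dgP x _)).
  by rewrite x0 (lt_le_trans xt).
- exact: within_sub cg.
move=> /[!in_itv]/= /andP[c0 ct] e; rewrite -subr_le0 e subr0.
rewrite mulr_le0_ge0 ?(ltW t0)//; apply: (proj2 (dgP c _)).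
by rewrite c0 (lt_le_trans ct).
Qed.

Lemma derive0_itv T g : {within `[0, T], continuous g} ->
  (forall t, 0 < t < T -> is_derive t 1 g 0) ->
  forall t, 0 <= t <= T -> g t = g 0.
Proof.
move=> cg dg t tT; apply/eqP; rewrite eq_le; apply/andP; split.
  by apply: (derive_le_itv (dg := fun=> 0) cg _ tT) => s sT; split => //; exact: dg.
rewrite -lerN2.
apply: (derive_le_itv (dg := fun=> 0) (withinN cg) _ tT) => s sT; split => //.
by have := dg _ sT => ?; apply: is_derive_eq; rewrite oppr0.
Qed.

Lemma integrable_itv a b f : {within `[a, b], continuous f} ->
  (@lebesgue_measure R).-integrable `[a, b] (EFin \o f).
Proof. by move=> cf; apply: continuous_compact_integrable => //; exact: segment_compact. Qed.

Definition prim f t : R := \int[lebesgue_measure]_(s in `[0, t]) f s.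

Lemma prim0 f : prim f 0 = 0.
Proof. by rewrite /prim set_itv1 Rintegral_set1. Qed.

Lemma prim_continuous T f : 0 <= T -> {within `[0, T], continuous f} ->
  {within `[0, T], continuous (prim f)}.
Proof.
by move=> T0 cf; apply: parameterized_integral_continuous => //; exact: integrable_itv.
Qed.

Lemma within_itv_for (V : topologicalType) T t (f : R -> V) : 0 < t < T ->
  {within `[0, T], continuous f} -> {for t, continuous f}.
Proof.
move=> tT cf.
have cf' : {within `]0, T[, continuous f}.
  by apply: continuous_subspaceW cf; exact: subset_itv_oo_cc.
move: cf'; rewrite continuous_open_subspace; last exact: itv_open.
by apply; rewrite inE/= in_itv.
Qed.

Lemma prim_derive T t f : {within `[0, T], continuous f} -> 0 < t < T ->
  is_derive t 1 (prim f) (f t).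
Proof.
move=> cf tT; have /andP[t0 tT'] := tT.
have [dF F'] := continuous_FTC1_closed tT' (integrable_itv cf) t0 (within_itv_for tT cf).
by apply: DeriveDef; [exact: dF|rewrite -derive1E; exact: F'].
Qed.

Lemma prim_FTC T f F : 0 <= T -> {within `[0, T], continuous f} ->
  {within `[0, T], continuous F} ->
  (forall t, 0 < t < T -> is_derive t 1 F (f t)) ->
  forall t, 0 <= t <= T -> prim f t = F t - F 0.
Proof.
move=> T0 cf cF dF t tT.
have /(_ t tT) : forall t, 0 <= t <= T -> prim f t - F t = prim f 0 - F 0.
  apply: (@derive0_itv T (fun t => prim f t - F t)).
    by apply: withinB => //; exact: prim_continuous.
  move=> s sT; have := dF _ sT => ?; have := prim_derive cf sT => ?.
  by apply: is_derive_eq; rewrite subrr.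
by rewrite prim0 sub0r => /eqP; rewrite subr_eq addrC => /eqP.
Qed.

Lemma integral0T_prim T f : {within `[0, T], continuous f} ->
  integral0T T f = (prim f T)%:E.
Proof.
move=> /integrable_itv intf; rewrite /integral0T /prim /Rintegral fineK//.
exact: integrable_fin_num.
Qed.

Lemma le_prim T f g : {within `[0, T], continuous f} ->
  {within `[0, T], continuous g} -> (forall t, 0 <= t <= T -> f t <= g t) ->
  prim f T <= prim g T.
Proof.
by move=> cf cg fg; apply: le_Rintegral => //; exact: integrable_itv.
Qed.

Lemma prim_ge0 T f : (forall t, 0 <= t <= T -> 0 <= f t) -> 0 <= prim f T.
Proof. by move=> f0; apply: Rintegral_ge0 => t /=; rewrite in_itv/=; exact: f0. Qed.

Lemma primD T f g : {within `[0, T], continuous f} ->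
  {within `[0, T], continuous g} -> prim (fun t => f t + g t) T = prim f T + prim g T.
Proof. by move=> cf cg; rewrite /prim RintegralD//; exact: integrable_itv. Qed.

Lemma primZ T (a : R) f : {within `[0, T], continuous f} ->
  prim (fun t => a * f t) T = a * prim f T.
Proof. by move=> cf; rewrite /prim RintegralZl//; exact: integrable_itv. Qed.

End Primitive.

Section InnerContinuity.
Context {R : realType} {H : hilbertType R}.

Lemma inner_polar (x y : H) :
  inner x y = 4^-1 * (`|x + y| ^+ 2 - `|x - y| ^+ 2) :> R.
Proof. by rewrite normB2 normD2; field. Qed.

Lemma cvg_inner2 (T : Type) (F : set_system T) {FF : Filter F} (f g : T -> H) x y :
  f @ F --> x -> g @ F --> y -> inner (f t) (g t) @[t --> F] --> (inner x y : R).
Proof.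
move=> fx gy; have sqr (u : T -> H) w : u @ F --> w ->
    `|u t| ^+ 2 @[t --> F] --> (`|w| ^+ 2 : R).
  move=> uw; rewrite expr2; under eq_fun do rewrite expr2.
  by apply: cvgM; exact: cvg_norm.
under eq_fun do rewrite inner_polar; rewrite inner_polar.
apply: cvgM; first exact: cvg_cst.
by apply: cvgB; apply: sqr; [exact: cvgD|exact: cvgB].
Qed.

Lemma within_inner (A : set R) (f g : R -> H) :
  {within A, continuous f} -> {within A, continuous g} ->
  {within A, continuous (fun t => inner (f t) (g t) : R)}.
Proof. by move=> cf cg x; apply: cvg_inner2; [exact: cf|exact: cg]. Qed.

Lemma is_derive_cvg (V : normedModType R) (f : R -> V) (t : R) (df : V) :
  is_derive t 1 f df <-> h^-1 *: (f (h + t) - f t) @[h --> 0^'] --> df.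
Proof.
have E : (fun h : R => h^-1 *: (f (h + t) - f t)) =
    (fun h => h^-1 *: ((f \o shift t) (h *: 1) - f t)).
  by apply/funext => h; rewrite /= /GRing.scale/= mulr1.
split=> [[d e]|]; first by rewrite E -e; exact: d.
rewrite E => c; apply: DeriveDef; first by apply/cvg_ex; exists df.
exact: cvg_lim c.
Qed.

Lemma is_derive_inner (X : R -> H) (t : R) (Y v : H) :
  is_derive t 1 X Y -> is_derive t 1 (fun s => inner (X s) v : R) (inner Y v).
Proof.
move=> /is_derive_cvg XY; apply/is_derive_cvg.
under eq_fun do rewrite -innerBl /GRing.scale/= -innerZl.
by apply: cvg_inner2 => //; exact: cvg_cst.
Qed.

Lemma is_derive_sumE (V : normedModType R) (n : nat) (f : nat -> R -> V) (t : R) (df : nat -> V) :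
  (forall k, is_derive t 1 (f k) (df k)) ->
  is_derive t 1 (fun s => \sum_(k < n) f k s) (\sum_(k < n) df k).
Proof.
move=> fP; elim: n => [|n IH].
  under eq_fun do rewrite big_ord0; rewrite big_ord0; exact: is_derive_cst.
under eq_fun do rewrite big_ord_recr/=; rewrite big_ord_recr/=.
exact: is_deriveD.
Qed.

Lemma is_derive_near (V : normedModType R) (f g : R -> V) (t : R) (df : V) :
  (\forall s \near t, f s = g s) -> is_derive t 1 f df -> is_derive t 1 g df.
Proof.
move=> fg /is_derive_cvg fd; apply/is_derive_cvg; apply: cvg_trans fd.
apply: near_eq_cvg; have gt := nbhs_singleton fg.
have : \forall h \near (0 : R), f (h + t) = g (h + t).
  have c : h + t @[h --> (0 : R)] --> t.
    by rewrite -[X in _ --> X]add0r; apply: cvgD; [exact: cvg_id|exact: cvg_cst].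
  exact: c fg.
rewrite -nbhs_nearE => fg0; rewrite near_withinE; apply: filterS fg0 => h fgh _.
by rewrite fgh gt.
Qed.

Lemma near_itv (T t : R) (P : R -> Prop) : 0 < t < T ->
  (forall s, 0 <= s <= T -> P s) -> \forall s \near t, P s.
Proof.
move=> tT PT; have : t \in `]0, T[ by rewrite in_itv.
move/near_in_itvoo; apply: filterS => s; rewrite in_itv/= => /andP[s0 sT].
by apply: PT; rewrite !ltW.
Qed.

End InnerContinuity.

(** * Derivatives and continuity of vector functions from coordinates *)

Section VectorCalculus.
Context {R : realType} {H : hilbertType R}.
Variables (e : nat -> H).
Hypothesis eO : ortho_family e.
Hypothesis eC : complete_family e.

(** The increment [z] is tested against its own truncation [p]. The scalar mean value theorem then
    gives [|p|^2 <= eps (b - a) |p|], a bound on [|p|] that does not depend on the number of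
    coordinates. *)
Lemma increment_le (X : R -> H) (Y : R -> H) (y : H) (a b eps : R) : a < b ->
  (forall k, {within `[a, b], continuous (fun s => inner (X s) (e k) : R)}) ->
  (forall k s, a < s < b ->
    is_derive s 1 (fun s => inner (X s) (e k) : R) (inner (Y s) (e k))) ->
  (forall s, a < s < b -> `|Y s - y| <= eps) ->
  `|X b - X a - (b - a) *: y| <= eps * (b - a).
Proof.
move=> ab cX dX Yy; set z := X b - X a - _.
have eps0 : 0 <= eps.
  apply: le_trans (normr_ge0 _) (Yy ((a + b) / 2) _).
  by apply/andP; split; lra.
have ba0 : 0 <= b - a by rewrite subr_ge0 ltW.
rewrite -(@ler_pXn2r _ 2)// ?nnegrE ?mulr_ge0//.
apply: (norm2_le_coord eO eC) => n.
pose p := coord_trunc e n z.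
have pE : \sum_(k < n) inner z (e k) ^+ 2 = `|p| ^+ 2.
  rewrite -inner_norm {2}/p inner_psum; apply: eq_bigr => k _.
  by rewrite coord_truncE// ltn_ord mul1r expr2.
pose phi s := \sum_(k < n) inner z (e k) * (inner (X s) (e k) - s * inner y (e k)).
pose dphi s := \sum_(k < n) inner z (e k) * (inner (Y s) (e k) - inner y (e k)).
have phiE : phi b - phi a = `|p| ^+ 2.
  rewrite -pE -sumrB; apply: eq_bigr => k _.
  by rewrite /z !innerBl innerZl; ring.
have dphiE s : dphi s = inner (Y s - y) p.
  by rewrite inner_psum; apply: eq_bigr => k _; rewrite innerBl.
have [||c] := @MVT _ phi dphi _ _ ab.
- move=> s; rewrite in_itv/= => sab.
  apply: (@is_derive_sumE _ _ n
    (fun k s => inner z (e k) * (inner (X s) (e k) - s * inner y (e k))) _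
    (fun k => inner z (e k) * (inner (Y s) (e k) - inner y (e k)))) => k.
  have := dX k s sab => ?.
  by apply: is_derive_eq; rewrite /GRing.scale/= !(mul0r, mulr0, add0r, addr0, mulr1, scaler0); ring.
- apply: (within_sum (f := fun k s => inner z (e k) * (inner (X s) (e k) - s * inner y (e k)))) => k.
  apply: withinM; first exact: within_cst.
  apply: withinB => //; apply: withinM; last exact: within_cst.
  by apply: continuous_subspaceT => x; exact: cvg_id.
rewrite in_itv/= => cab; rewrite phiE dphiE => pc.
have pl : `|p| ^+ 2 <= eps * (b - a) * `|p|.
  rewrite pc mulrAC ler_wpM2r//; apply: le_trans (inner_ler _ _) _.
  by rewrite ler_wpM2r// Yy.
rewrite pE ler_pXn2r ?nnegrE ?mulr_ge0//.
have [->|pn] := eqVneq p 0; first by rewrite normr0 mulr_ge0.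
by move: pl; rewrite expr2 ler_pM2r// normr_gt0.
Qed.

(* The mean value theorem, applied to the finite coordinate sums, is uniform
   in their number. *)
Lemma is_derive_coord (T : R) (X Y : R -> H) (t : R) : 0 < t < T ->
  (forall k s, 0 < s < T ->
    is_derive s 1 (fun s => inner (X s) (e k) : R) (inner (Y s) (e k))) ->
  {for t, continuous Y} -> is_derive t 1 X (Y t).
Proof.
move=> tT dX cY; apply/is_derive_cvg; apply/cvgrPdist_le => eps eps0.
have nearT : \forall s \near t, 0 < s < T.
  have : t \in `]0, T[ by rewrite in_itv.
  by move/near_in_itvoo; apply: filterS => s; rewrite in_itv.
have nearY : \forall s \near t, `|Y t - Y s| <= eps.
  by move/cvgrPdist_le : cY => /(_ _ eps0).
have [d /= d0 dP] := proj1 (nbhs_ballP (t : R) _) (filterI nearT nearY).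
have dd a b : a < b -> ball t d a -> ball t d b ->
    `|X b - X a - (b - a) *: Y t| <= eps * (b - a).
  move=> ab ta tb; have mid s : a <= s <= b -> ball t d s.
    move: ta tb; rewrite /ball/= !ltr_distlC => /andP[a1 a2] /andP[b1 b2] /andP[s1 s2].
    by rewrite (lt_le_trans a1)//= (le_lt_trans s2).
  have dX' k s : a <= s <= b ->
      is_derive s 1 (fun s => inner (X s) (e k) : R) (inner (Y s) (e k)).
    by move=> /mid/dP[/= sT _]; exact: dX.
  apply: (increment_le (Y := Y) ab) => [k|k s /andP[sa sb]|s /andP[sa sb]].
  - apply: continuous_in_subspaceT => s; rewrite inE/= in_itv/= => /dX'-/(_ k)[ds _].
    by apply/differentiable_continuous/derivable1_diffP.
  - by apply: dX'; rewrite !ltW.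
  - by have [|_ /=] := dP s (mid s _); rewrite ?(ltW sa) ?(ltW sb)// distrC.
rewrite near_withinE; apply/(proj2 (nbhs_ballP (0 : R) _)); exists d => //= h h0 hn.
have hb : ball t d (h + t).
  by move: h0; rewrite /ball/= sub0r normrN opprD addrCA subrr addr0 normrN.
have tb : ball t d t by exact: ballxx.
have hn0 : 0 < `|h| by rewrite normr_gt0.
have -> : Y t - h^-1 *: (X (h + t) - X t) =
   - (h^-1 *: (X (h + t) - X t - h *: Y t)).
  by rewrite [in RHS]scalerBr scalerA mulVf// scale1r opprB.
rewrite normrN normrZ normfV ler_pdivrMl// mulrC.
have [hp|hm|he] := ltgtP 0 h; last by rewrite -he eqxx in hn.
  have := dd t (h + t) _ tb hb; rewrite addrK gtr0_norm//.
  by apply; rewrite ltrDr.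
have lt : h + t < t by rewrite gtrDr.
have := dd _ _ lt hb tb; rewrite (_ : t - (h + t) = - h); last by ring.
rewrite (_ : X t - _ - _ = - (X (h + t) - X t - h *: Y t)) ?normrN ?ltr0_norm//.
by rewrite scaleNr opprK [RHS]opprB opprB addrC.
Qed.

(** Since the multipliers are bounded by [M] at all times, the finite sums [Xn] approximate
    uniformly in time, with error at most [M] times the tail of [x]. *)
Lemma diag_mul_within (T M : R) (c : nat -> R -> R) (x : H) :
  (forall k, {within `[0, T], continuous (c k)}) ->
  (forall k (t : R), 0 <= t <= T -> `|c k t| <= M) ->
  {within `[0, T], continuous (fun t => diag_mul e (fun k => c k t) x)}.
Proof.
move=> cc cM; apply/subspace_continuousP => t tT; apply/cvgrPdist_le => eps eps0.
have tT' : 0 <= t <= T by move: tT; rewrite /= in_itv.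
have M0 : 0 <= M by apply: le_trans (cM 0%N _ tT').
pose Xn n t := \sum_(k < n) c k t *: (inner x (e k) *: e k).
have XnE n s : 0 <= s <= T -> `|diag_mul e (fun k => c k s) x - Xn n s| <=
    M * `|x - coord_trunc e n x|.
  move=> sT; apply: (norm_le_coord eO eC) => // k.
  rewrite !innerBl coord_truncE// (coord_diag_mul eO _ _ (fun k => cM k s sT)).
  have -> : inner (Xn n s) (e k) = (k < n)%:R * (c k s * inner x (e k)).
    rewrite /Xn; under eq_bigr do rewrite scalerA.
    by rewrite -/(psum e (fun k => c k s * inner x (e k)) n) coord_psum_mul// mulrA.
  have -> : c k s * inner x (e k) - (k < n)%:R * (c k s * inner x (e k)) =
      c k s * (inner x (e k) - (k < n)%:R * inner x (e k)) by ring.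
  rewrite exprMn ler_wpM2r ?sqr_ge0// -real_normK ?num_real//.
  by rewrite ler_pXn2r ?nnegrE// cM.
have e0 : 0 < eps / (4 * (M + 1)) by rewrite divr_gt0// mulr_gt0// ltr_wpDl.
move/cvgrPdist_le : (cvg_coord_trunc eO eC (x := x)) => /(_ _ e0)[n _ /(_ n (leqnn n)) /= xn].
have small : M * `|x - coord_trunc e n x| <= eps / 4.
  apply: le_trans (_ : (M + 1) * (eps / (4 * (M + 1))) <= _).
    by apply: ler_pM => //; rewrite lerDl.
  rewrite le_eqVlt; apply/orP; left; apply/eqP; field.
  by rewrite gt_eqF// ltr_wpDl.
have cXn : {within `[0, T], continuous (Xn n)}.
  apply: (@within_sum _ _ _ n (fun k t => c k t *: (inner x (e k) *: e k))) => k.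
  by apply: withinZ => //; exact: within_cst.
have e2 : 0 < eps / 2 by rewrite divr_gt0.
move/subspace_continuousP : cXn => /(_ _ tT)/cvgrPdist_le/(_ _ e2).
rewrite !near_withinE; apply: filterS => s h sT; have {}h := h sT.
have sT' : 0 <= s <= T by move: sT; rewrite /= in_itv.
rewrite -/(diag_mul e (fun k => c k t) x).
set X1 := diag_mul e (fun k => c k t) x; set X2 := diag_mul e (fun k => c k s) x.
have := XnE n _ tT'; have := XnE n _ sT'; rewrite -/X1 -/X2 => h1 h2.
have -> : X1 - X2 = (X1 - Xn n t) + (Xn n t - Xn n s) - (X2 - Xn n s).
  by rewrite subrKA opprB addrA subrK.
apply: le_trans (ler_normB _ _) _.
have := ler_normD (X1 - Xn n t) (Xn n t - Xn n s) => h3.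
by lra.
Qed.

End VectorCalculus.

(** * Wave equations in coordinates *)

Section CoordinateSolutions.
Context {R : realType} {H : hilbertType R}.
Variables (A : operator H) (e : nat -> H) (mu : nat -> R) (m0 : R).
Hypothesis eb : eigenbasis A e mu m0.
Implicit Types (x y v : H) (f : R -> H) (W V : R -> H * H).

Let eO := eigen_ortho eb.
Let eC := eigen_complete eb.

(** The common form to which weak and regular solutions are reduced: each coordinate of a weak
    solution is differentiable in time although [w'] need not be differentiable in [H]. *)
Definition coord_solution (T : R) f W := forall k,
  [/\ {within `[0, T], continuous (fun t => inner (W t).1 (e k) : R)},
      {within `[0, T], continuous (fun t => inner (W t).2 (e k) : R)},
      forall t : R, 0 < t < T ->
        is_derive t 1 (fun t => inner (W t).1 (e k) : R) (inner (W t).2 (e k)) &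
      forall t : R, 0 < t < T ->
        is_derive t 1 (fun t => inner (W t).2 (e k) : R)
          (inner (f t) (e k) - mu k ^+ 2 * inner (W t).1 (e k))].

Lemma coord_solutionB T f g W V : coord_solution T f W -> coord_solution T g V ->
  coord_solution T (fun t => f t - g t) (fun t => W t - V t).
Proof.
move=> cW cV k; have [a1 a2 a3 a4] := cW k; have [b1 b2 b3 b4] := cV k.
have E1 t : inner (W t - V t).1 (e k) = inner (W t).1 (e k) - inner (V t).1 (e k) :> R.
  exact: innerBl.
have E2 t : inner (W t - V t).2 (e k) = inner (W t).2 (e k) - inner (V t).2 (e k) :> R.
  exact: innerBl.
split=> [||t tT|t tT].
- by apply: within_eq (withinB a1 b1) => t _; rewrite E1.
- by apply: within_eq (withinB a2 b2) => t _; rewrite E2.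
- apply: (@is_derive_near _ _ (fun t => inner (W t).1 (e k) - inner (V t).1 (e k))).
    by apply: (near_itv tT) => s _; rewrite E1.
  have := a3 t tT => ?; have := b3 t tT => ?.
  by apply: is_derive_eq; rewrite E2.
- apply: (@is_derive_near _ _ (fun t => inner (W t).2 (e k) - inner (V t).2 (e k))).
    by apply: (near_itv tT) => s _; rewrite E2.
  have := a4 t tT => ?; have := b4 t tT => ?.
  by apply: is_derive_eq; rewrite E1 innerBl; ring.
Qed.

Lemma half1_eigenvector k : Hspace A 1 (e k) /\ half_power A 1 (e k) = mu k *: e k.
Proof.
have h : coord_scaled e mu (e k) (mu k *: e k).
  move=> j; rewrite innerZl; have [->//|kj] := eqVneq k j.
  by rewrite (proj1 eO)// !mulr0.
by split; [apply/(Hspace1P eb); exists (mu k *: e k)|exact: half1E eb _ _ h].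
Qed.

Lemma within_coord (T : R) (X : R -> H) v :
  {within `[0, T], continuous X} ->
  {within `[0, T], continuous (fun t => inner (X t) v : R)}.
Proof. by move=> cX; apply: within_inner => //; exact: within_cst. Qed.

(** Eigenvectors lie in [H_1] and may serve as test functions; the integrated equation then exhibits
    the coordinate of [w'] as a primitive of a continuous function. *)
Lemma wave_coord (T : R) f w0 w1 W : 0 <= T ->
  {within `[0, T], continuous f} -> wave_solution A T f w0 w1 W ->
  coord_solution T f W.
Proof.
move=> T0 cf [[W1H cW1] [[_ cw] [_ cw'] dw] _ tst] k.
have [e1 ek] := half1_eigenvector k.
have SSE t : 0 <= t <= T -> inner (half_power A 1 (W t).1) (half_power A 1 (e k)) =
    mu k ^+ 2 * inner (W t).1 (e k) :> R.
  move=> tT; rewrite ek innerZr (coord_half1 eb) ?mulrA ?expr2//.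
  by apply: W1H; rewrite in_itv.
set g := fun s => inner (f s) (e k) - inner (half_power A 1 (W s).1) (half_power A 1 (e k)).
have cg : {within `[0, T], continuous g}.
  by apply: withinB; exact: within_coord.
have E t : 0 <= t <= T -> inner w1 (e k) + prim g t = inner (W t).2 (e k).
  by move=> tT; rewrite (tst _ e1)// in_itv.
split=> [||t tT|t tT].
- exact: within_coord cw.
- exact: within_coord cw'.
- exact: is_derive_inner (dw _ tT).
- apply: (is_derive_near (near_itv tT E)).
  have := prim_derive cg tT => ?; apply: is_derive_eq; rewrite add0r /g SSE ?mul1r//.
  by case/andP: tT => ? ?; rewrite !ltW.
Qed.

Lemma regular_coord (T : R) f W : regular_solution A T f W -> coord_solution T f W.
Proof.
move=> [[W2 cW2] [[_ cw1] [W21 cw2] dw] [ddw [[[_ cw] [_ cdw] ddwE] eqn]]] k.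
have [e1 ek] := half1_eigenvector k.
have c1 t : 0 <= t <= T -> inner (half_power A 1 (W t).1) (e k) = mu k * inner (W t).1 (e k) :> R.
  by move=> tT; apply: (coord_half1 eb); apply: Hspace21; apply: W2; rewrite in_itv.
have c2 t : 0 <= t <= T -> inner (half_power A 1 (W t).2) (e k) = mu k * inner (W t).2 (e k) :> R.
  by move=> tT; apply: (coord_half1 eb); apply: W21; rewrite in_itv.
have muE (x : R) : (mu k)^-1 * (mu k * x) = x.
  by rewrite mulKf// gt_eqF// (mu_gt0 eb).
have tTw t : 0 < t < T -> 0 <= t <= T by move=> /andP[? ?]; rewrite !ltW.
split=> [||t tT|t tT].
- apply: (within_eq (f := fun t => (mu k)^-1 * inner (half_power A 1 (W t).1) (e k))).
    by move=> t; rewrite /= in_itv/= => tT; rewrite c1.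
  by apply: withinM; [exact: within_cst|exact: within_coord cw1].
- exact: within_coord cw.
- have E s : 0 <= s <= T -> (mu k)^-1 * inner (half_power A 1 (W s).1) (e k) =
    inner (W s).1 (e k) by move=> sT; rewrite c1.
  apply: (is_derive_near (near_itv tT E)).
  have := is_derive_inner (e k) (dw _ tT) => ?.
  apply: is_derive_eq; rewrite c2 ?tTw//.
  by rewrite /GRing.scale/= muE mulr0 add0r || rewrite /GRing.scale/= muE.
- have := is_derive_inner (e k) (ddwE _ tT) => h; apply: is_derive_eq.
  rewrite -eqn ?in_itv/= ?tTw// innerDl.
  have W2t : Hspace A 2 (W t).1 by apply: W2; rewrite in_itv tTw.
  by rewrite -(half2_operator eb W2t) (coord_half2 eb W2t) addrK.
Qed.

Lemma regular_source_continuous (T : R) f W :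
  regular_solution A T f W -> {within `[0, T], continuous f}.
Proof.
move=> [[W2 cW2] _ [ddw [[_ [_ cdw] _] eqn]]].
apply: (within_eq (f := fun t => ddw t + half_power A 2 (W t).1)).
  move=> t tT; have {}tT : 0 <= t <= T by move: tT; rewrite /= in_itv.
  rewrite -eqn ?in_itv//.
  by rewrite (half2_operator eb)//; apply: W2; rewrite in_itv.
by apply: withinD.
Qed.

Lemma half_power1_ge x : Hspace A 1 x -> `|x| <= m0^-1 * `|half_power A 1 x|.
Proof.
move=> x1; have mp := eigen_gt0 eb.
apply: (norm_le_coord eO eC) => [|k]; first by rewrite invr_ge0 ltW.
rewrite (coord_half1 eb x1) exprMn mulrA ler_peMl ?sqr_ge0// -exprMn.
have : 1 <= m0^-1 * mu k by rewrite ler_pdivlMl// mulr1 (eigen_ge eb).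
by move=> h; rewrite exprn_ege1.
Qed.

Lemma half_power2_ge x : Hspace A 2 x ->
  `|half_power A 1 x| <= m0^-1 * `|half_power A 2 x|.
Proof. by move=> /Hspace2_dom[_ x2]; exact: half_power1_ge. Qed.

Lemma C0_Hspace_down (n : nat) (T : R) (X : R -> H) : (n <= 1)%N ->
  C0_Hspace A n.+1 T X -> C0_Hspace A n T X.
Proof.
move=> n1 [X1 cX]; have m00 := eigen_gt0 eb.
have down x : Hspace A n.+1 x -> Hspace A n x.
  by case: n n1 {X1 cX} => [//|[|//]] _; exact: Hspace21.
have le x : Hspace A n.+1 x -> `|half_power A n x| <= m0^-1 * `|half_power A n.+1 x|.
  by case: n n1 {X1 cX down} => [|[|//]] _; [exact: half_power1_ge|exact: half_power2_ge].
split=> [t tT|]; first exact/down/X1.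
apply: (within_lipschitz (M := m0^-1) (f := half_power A n.+1 \o X)) => // u v uT vT.
have [D DE] := Hspace_B eb (n := n.+1) n1 (X1 _ uT) (X1 _ vT).
have [_ DE'] := Hspace_B eb (n := n) (leqW n1) (down _ (X1 _ uT)) (down _ (X1 _ vT)).
by move: (le _ D); rewrite DE DE'.
Qed.

Lemma within_half_powerN1 (T : R) f : {within `[0, T], continuous f} ->
  {within `[0, T], continuous (fun t => half_power A (- 1) (f t))}.
Proof.
apply: (within_lipschitz (M := m0^-1)) => s t _ _.
apply: (norm_le_coord eO eC) => [|k]; first by rewrite invr_ge0 ltW ?(eigen_gt0 eb).
rewrite !innerBl !(coord_inv_sqrt eb) -mulrBr exprMn ler_wpM2r ?sqr_ge0//.
have m1 := eigen_gt0 eb; have muk := mu_gt0 eb k.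
rewrite ler_pXn2r ?nnegrE ?invr_ge0 ?(ltW m1) ?(ltW muk)// lef_pV2 ?posrE//.
exact: eigen_ge eb k.
Qed.

(* [w'] is not differentiable in [H], but [A^(-1/2) w'] is, and testing against
   [v] in [H_1] amounts to pairing it with [A^(1/2) v]. *)
Lemma coord_wave (T : R) f W : 0 <= T -> {within `[0, T], continuous f} ->
  coord_solution T f W -> C0_Hspace A 1 T (fun t => (W t).1) ->
  {within `[0, T], continuous (fun t => (W t).2)} ->
  wave_solution A T f (W 0).1 (W 0).2 W.
Proof.
move=> T0 cf cW C1 c2; have C01 := C0_Hspace_down (isT : (0 <= 1)%N) C1.
have Nv x v : Hspace A 1 v ->
    inner (half_power A (- 1) x) (half_power A 1 v) = inner x v :> R.
  move=> v1; apply: (inner_coord eO eC) => k.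
  rewrite (coord_inv_sqrt eb) (coord_half1 eb v1).
  by rewrite mulrACA mulVf ?mul1r// gt_eqF// (mu_gt0 eb).
split => //; last 1 first.
- move=> v v1 t; rewrite in_itv/= => tT.
  pose g s := inner (f s) v - inner (half_power A 1 (W s).1) (half_power A 1 v).
  rewrite -/(prim g t).
  have cg : {within `[0, T], continuous g}.
    by apply: withinB; apply: within_coord => //; case: C1.
  have cF : {within `[0, T], continuous (fun t => inner (W t).2 v : R)}.
    exact: within_coord.
  have dF s : 0 < s < T -> is_derive s 1 (fun t => inner (W t).2 v : R) (g s).
    move=> sT.
    pose X s := half_power A (- 1) (W s).2.
    pose Y s := half_power A (- 1) (f s) - half_power A 1 (W s).1.
    have dX : is_derive s 1 X (Y s).
      apply: (is_derive_coord eO eC sT) => [k u uT|].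
        have [_ _ _ d2] := cW k; have := d2 _ uT => ?.
        under eq_fun do rewrite (coord_inv_sqrt eb).
        apply: is_derive_eq; rewrite innerBl (coord_inv_sqrt eb) (coord_half1 eb).
          by rewrite /GRing.scale/= ?mulr0 ?addr0 ?add0r mulrBr expr2 -mulrA mulKf// gt_eqF// (mu_gt0 eb).
        by apply: (proj1 C1); rewrite in_itv/=; case/andP: uT => ? ?; rewrite !ltW.
      apply: (within_itv_for sT); apply: withinB; first exact: within_half_powerN1.
      by case: C1.
    have := is_derive_inner (half_power A 1 v) dX; rewrite innerBl Nv//.
    by under eq_fun do rewrite Nv//.
  by rewrite (prim_FTC T0 cg cF dF tT) addrC subrK.
- split => // t tT.
  have cW2 : {for t, continuous (fun t => (W t).2)} by exact: (within_itv_for tT).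
  apply: (is_derive_coord eO eC (Y := fun t => (W t).2) tT) => // k s sT.
  by have [_ _ + _] := cW k; exact.
- by case: (W 0).
Qed.

Lemma regular_wave (T : R) f W : 0 <= T -> regular_solution A T f W ->
  wave_solution A T f (W 0).1 (W 0).2 W.
Proof.
move=> T0 rW; have cf := regular_source_continuous rW.
have [C2 _ [ddw [[[_ cw] _ _] _]]] := rW.
apply: coord_wave => //; first exact: regular_coord.
exact: C0_Hspace_down C2.
Qed.

Lemma C0_HspaceP (n : nat) (T : R) (X Z : R -> H) : (n <= 2)%N ->
  (forall t, 0 <= t <= T -> coord_scaled e (fun k => mu k ^+ n) (X t) (Z t)) ->
  {within `[0, T], continuous Z} -> C0_Hspace A n T X.
Proof.
move=> n2 XZ cZ; have XZ' t : 0 <= t <= T -> Hspace A n (X t) /\ half_power A n (X t) = Z t.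
  move=> /XZ; case: n n2 {XZ} => [|[|[|//]]] _ h.
  - by split => //; apply: (coord_inj eC) => k; rewrite h expr0 mul1r.
  - by split; [apply/(Hspace1P eb); exists (Z t)|exact: (half1E eb)].
  - by split; [apply/(Hspace2P eb); exists (Z t)|exact: (half2E eb)].
split=> [t|]; first by rewrite in_itv/= => /XZ'[].
by apply: within_eq cZ => t tT; rewrite /comp; case: (XZ' t) => //; move: tT; rewrite /= in_itv.
Qed.

(** Continuity in [H_2] makes [f - A w] a continuous candidate for the second derivative;
    [is_derive_coord] confirms it. *)
Lemma coord_regular (T : R) f W : {within `[0, T], continuous f} ->
  coord_solution T f W -> C0_Hspace A 2 T (fun t => (W t).1) ->
  C0_Hspace A 1 T (fun t => (W t).2) -> regular_solution A T f W.
Proof.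
move=> cf cW C2 C1'.
have C1 := C0_Hspace_down (isT : (1 <= 1)%N) C2.
have C0' := C0_Hspace_down (isT : (0 <= 1)%N) C1'.
have tTw t : 0 < t < T -> t \in `[0, T].
  by move=> /andP[? ?]; rewrite in_itv/= !ltW.
have tTw' t : 0 <= t <= T -> t \in `[0, T] by rewrite in_itv.
split => //.
  split => // t tT.
  apply: (is_derive_coord eO eC tT (Y := fun t => half_power A 1 (W t).2)) => [k s sT|].
    have [_ _ d1 _] := cW k; have := d1 _ sT => ?.
    have E u : 0 <= u <= T -> mu k * inner (W u).1 (e k) =
        inner ((half_power A 1 \o (fun t => (W t).1)) u) (e k).
      by move=> /tTw'/(proj1 C1)/(coord_half1 eb) ->.
    apply: (is_derive_near (near_itv sT E)).
    apply: is_derive_eq; rewrite (coord_half1 eb (proj1 C1' _ (tTw _ sT))).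
    by rewrite /GRing.scale/= ?mulr0 ?addr0 ?add0r.
  by apply: (within_itv_for tT); case: C1'.
exists (fun t => f t - half_power A 2 (W t).1).
have cdd : {within `[0, T], continuous (fun t => f t - half_power A 2 (W t).1)}.
  by apply: withinB => //; case: C2.
split; last first.
  by move=> t tT; rewrite -(half2_operator eb (proj1 C2 t tT)) subrK.
split => //.
move=> t tT; apply: (is_derive_coord eO eC tT
  (Y := fun t => f t - half_power A 2 (W t).1)) => [k s sT|].
  have [_ _ _ d2] := cW k; rewrite innerBl (coord_half2 eb); first exact: d2.
  exact: (proj1 C2 _ (tTw _ sT)).
exact: (within_itv_for tT).
Qed.

Lemma coord_solution_intro (T : R) f W (p q : nat -> R -> R) :
  (forall k t, 0 <= t <= T -> inner (W t).1 (e k) = p k t /\ inner (W t).2 (e k) = q k t) ->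
  (forall k, {within `[0, T], continuous (p k)} /\ {within `[0, T], continuous (q k)}) ->
  (forall k (t : R), 0 < t < T -> is_derive t 1 (p k) (q k t) /\
    is_derive t 1 (q k) (inner (f t) (e k) - mu k ^+ 2 * p k t)) ->
  coord_solution T f W.
Proof.
move=> Wpq cpq dpq k; have [cp cq] := cpq k.
have tTw t : 0 < t < T -> 0 <= t <= T by move=> /andP[? ?]; rewrite !ltW.
split=> [||t tT|t tT].
- by apply: within_eq cp => t; rewrite /= in_itv/= => /(Wpq k)[].
- by apply: within_eq cq => t; rewrite /= in_itv/= => /(Wpq k)[].
- have [dp _] := dpq k t tT; have [_ ->] := Wpq k t (tTw _ tT).
  by apply: is_derive_near dp; apply: (near_itv tT) => s /(Wpq k)[].
- have [_ dq] := dpq k t tT; have [-> _] := Wpq k t (tTw _ tT).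
  by apply: is_derive_near dq; apply: (near_itv tT) => s /(Wpq k)[].
Qed.

(** Gronwall's argument, run on the truncated energies [E n] because the full energy is not known to
    be differentiable. The frequency terms cancel in the derivative of [E n], which is at most [E n]
    plus half of [|f|^2]; the bound is uniform in [n]. *)
Lemma energy_estimate (T : R) f W : 0 <= T -> {within `[0, T], continuous f} ->
  coord_solution T f W -> (forall t, 0 <= t <= T -> Hspace A 1 (W t).1) ->
  forall t, 0 <= t <= T -> energy A 1 W t <=
    expR t * (energy A 1 W 0 + 2^-1 * prim (fun s => `|f s| ^+ 2) t).
Proof.
move=> T0 cf cW W1 t tT.
pose E n t := 2^-1 * \sum_(k < n) ((mu k * inner (W t).1 (e k)) ^+ 2
   + inner (W t).2 (e k) ^+ 2).
have EE n s : 0 <= s <= T -> E n s <= energy A 1 W s.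
  move=> sT; rewrite energy1E ler_pM2l// big_split/= lerD//; last exact: bessel.
  under eq_bigr do rewrite -(coord_half1 eb (W1 _ sT)).
  exact: bessel.
have cf2 := within_sqr_norm cf.
have cE n : {within `[0, T], continuous (E n)}.
  apply: withinM; first exact: within_cst.
  apply: (@within_sum _ _ _ n (fun k t => (mu k * inner (W t).1 (e k)) ^+ 2
   + inner (W t).2 (e k) ^+ 2)) => k.
  have [a1 a2 _ _] := cW k; apply: withinD; apply: within_sqr => //.
  by apply: withinM => //; exact: within_cst.
have dE n s : 0 < s < T ->
    is_derive s 1 (E n) (\sum_(k < n) inner (f s) (e k) * inner (W s).2 (e k)).
  move=> sT.
  have : is_derive s 1 (fun t => \sum_(k < n) ((mu k * inner (W t).1 (e k)) ^+ 2
   + inner (W t).2 (e k) ^+ 2)) (\sum_(k < n) (2 * (inner (f s) (e k) * inner (W s).2 (e k)))).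
    apply: (@is_derive_sumE _ _ n (fun k t => (mu k * inner (W t).1 (e k)) ^+ 2
   + inner (W t).2 (e k) ^+ 2) s (fun k => 2 * (inner (f s) (e k) * inner (W s).2 (e k)))) => k.
    have [_ _ a3 a4] := cW k; have := a3 _ sT => ?; have := a4 _ sT => ?.
    by under eq_fun do rewrite !expr2; apply: is_derive_eq; rewrite /GRing.scale/=; ring.
  move=> ?; apply: is_derive_eq; rewrite -mulr_sumr /GRing.scale/=.
  by rewrite ?(mulr0, add0r) mulKf.
have main n : E n t <= expR t * (energy A 1 W 0 + 2^-1 * prim (fun s => `|f s| ^+ 2) t).
  pose g s := expR (- s) * E n s - 2^-1 * prim (fun s => `|f s| ^+ 2) s.
  have cg : {within `[0, T], continuous g}.
    apply: withinB.
      apply: withinM => //; apply: continuous_subspaceT => s.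
      by apply: continuous_comp; [exact: opp_continuous|exact: continuous_expR].
    by apply: withinM; [exact: within_cst|exact: prim_continuous].
  have dgP s : 0 < s < T -> is_derive s 1 g (expR (- s) *
      (\sum_(k < n) inner (f s) (e k) * inner (W s).2 (e k) - E n s) - 2^-1 * `|f s| ^+ 2).
    move=> sT; have := dE n s sT => ?; have := prim_derive cf2 sT => ?.
    by apply: is_derive_eq; rewrite /GRing.scale/=; ring.
  have := derive_le_itv cg (dg := fun s => expR (- s) *
      (\sum_(k < n) inner (f s) (e k) * inner (W s).2 (e k) - E n s) - 2^-1 * `|f s| ^+ 2).
  move=> /(_ _ t tT) h; have {h} : g t <= g 0.
    apply: h => s sT; split; first exact: dgP.
    rewrite subr_le0; set D := (_ - E n s).
    have DF : D <= 2^-1 * `|f s| ^+ 2.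
      apply: le_trans (_ : 2^-1 * \sum_(k < n) inner (f s) (e k) ^+ 2 <= _); last first.
        by rewrite ler_pM2l// bessel.
      rewrite /D /E !mulr_sumr -sumrB; apply: ler_sum => k _.
      have := sqr_ge0 (inner (f s) (e k) - inner (W s).2 (e k) : R).
      have := sqr_ge0 (mu k * inner (W s).1 (e k)).
      by set x := _ ^+ 2; rewrite sqrrB !expr2; lra.
    (* The integrating factor is at most one, which enlarges [D] when it is negative; that case is
       trivial anyway. *)
    have [D0|D0] := leP D 0.
      apply: le_trans (_ : 0 <= _); last by rewrite mulr_ge0 ?sqr_ge0.
      by rewrite mulr_ge0_le0// expR_ge0.
    apply: le_trans DF; rewrite ler_piMl ?(ltW D0)// expR_le1 oppr_le0.
    by case/andP: sT => /ltW.
  rewrite /g prim0 oppr0 expR0 mul1r mulr0 subr0 lerBlDr => h.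
  rewrite -ler_pdivrMl ?expR_gt0// -expRN; apply: le_trans h _.
  by rewrite lerD2r EE// lexx.
have eR n : \sum_(k < n) ((mu k * inner (W t).1 (e k)) ^+ 2
   + inner (W t).2 (e k) ^+ 2) <= 2 * (expR t * (energy A 1 W 0 +
     2^-1 * prim (fun s => `|f s| ^+ 2) t)).
  by have := main n; rewrite /E ler_pdivrMl.
rewrite energy1E ler_pdivrMl//.
apply: (norm2D_le_coord eO eC) => n; apply: le_trans (eR n).
by apply: ler_sum => k _; rewrite (coord_half1 eb (W1 _ tT)).
Qed.

End CoordinateSolutions.

Section Trigonometry.
Context {R : realType}.
Implicit Types m t : R.

Lemma is_derive_cos_scale m t :
  is_derive t 1 (fun s => cos (m * s)) (- (m * sin (m * t))).
Proof.
have h : is_derive t 1 (fun s : R => m * s) m.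
  by apply: is_derive_eq; rewrite /GRing.scale/= ?(mulr0, addr0, add0r, mulr1).
have := is_derive1_comp (is_derive_cos (m * t)) h.
by rewrite /comp => d; apply: is_derive_eq; ring.
Qed.

Lemma is_derive_sin_scale m t :
  is_derive t 1 (fun s => sin (m * s)) (m * cos (m * t)).
Proof.
have h : is_derive t 1 (fun s : R => m * s) m.
  by apply: is_derive_eq; rewrite /GRing.scale/= ?(mulr0, addr0, add0r, mulr1).
have := is_derive1_comp (is_derive_sin (m * t)) h.
by rewrite /comp => d; apply: is_derive_eq; ring.
Qed.

Lemma continuous_cos_scale m (D : set R) :
  {within D, continuous (fun s => cos (m * s))}.
Proof.
apply: continuous_subspaceT => s; apply/differentiable_continuous/derivable1_diffP.
by have [] := is_derive_cos_scale m s.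
Qed.

Lemma continuous_sin_scale m (D : set R) :
  {within D, continuous (fun s => sin (m * s))}.
Proof.
apply: continuous_subspaceT => s; apply/differentiable_continuous/derivable1_diffP.
by have [] := is_derive_sin_scale m s.
Qed.

Lemma normr_cos_le1 m : `|cos m| <= 1.
Proof. by rewrite ler_norml cos_geN1 cos_le1. Qed.

Lemma normr_sin_le1 m : `|sin m| <= 1.
Proof. by rewrite ler_norml sin_geN1 sin_le1. Qed.

End Trigonometry.

(** * Free waves *)

Section FreeWave.
Context {R : realType} {H : hilbertType R}.
Variables (A : operator H) (e : nat -> H) (mu : nat -> R) (m0 : R).
Hypothesis eb : eigenbasis A e mu m0.
Implicit Types (x y v w : H) (W : R -> H * H) (t T : R).

Let eO := eigen_ortho eb.
Let eC := eigen_complete eb.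

Definition cos_op t x := diag_mul e (fun k => cos (mu k * t)) x.
Definition sin_op t x := diag_mul e (fun k => sin (mu k * t)) x.

Lemma coord_cos_op t x k :
  inner (cos_op t x) (e k) = cos (mu k * t) * inner x (e k).
Proof. by rewrite (coord_diag_mul eO _ _ (M := 1))// => j; exact: normr_cos_le1. Qed.

Lemma coord_sin_op t x k :
  inner (sin_op t x) (e k) = sin (mu k * t) * inner x (e k).
Proof. by rewrite (coord_diag_mul eO _ _ (M := 1))// => j; exact: normr_sin_le1. Qed.

Lemma within_cos_op T x : {within `[0, T], continuous (fun t => cos_op t x)}.
Proof.
apply: (diag_mul_within eO eC (c := fun k t => cos (mu k * t)) (M := 1)) => k.
  exact: continuous_cos_scale.
by move=> t _; exact: normr_cos_le1.
Qed.

Lemma within_sin_op T x : {within `[0, T], continuous (fun t => sin_op t x)}.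
Proof.
apply: (diag_mul_within eO eC (c := fun k t => sin (mu k * t)) (M := 1)) => k.
  exact: continuous_sin_scale.
by move=> t _; exact: normr_sin_le1.
Qed.

(** The functional calculus formula [cos(t A^(1/2)) w0 + sin(t A^(1/2)) A^(-1/2) w1], paired with
    its time derivative. *)
Definition free_wave w0 w1 t : H * H :=
  (cos_op t w0 + sin_op t (half_power A (- 1) w1),
   - sin_op t (half_power A 1 w0) + cos_op t w1).

Lemma coord_free1 w0 w1 t k : inner (free_wave w0 w1 t).1 (e k) =
  cos (mu k * t) * inner w0 (e k) + sin (mu k * t) * ((mu k)^-1 * inner w1 (e k)).
Proof. by rewrite innerDl coord_cos_op coord_sin_op (coord_inv_sqrt eb). Qed.

Lemma coord_free2 w0 w1 t k : Hspace A 1 w0 -> inner (free_wave w0 w1 t).2 (e k) =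
  - (sin (mu k * t) * (mu k * inner w0 (e k))) + cos (mu k * t) * inner w1 (e k).
Proof.
by move=> w01; rewrite innerDl innerNl coord_cos_op coord_sin_op (coord_half1 eb w01).
Qed.

Lemma free_wave0 w0 w1 : Hspace A 1 w0 -> free_wave w0 w1 0 = (w0, w1).
Proof.
move=> w01; rewrite [LHS]surjective_pairing; congr pair; apply: (coord_inj eC) => k.
  by rewrite coord_free1 mulr0 cos0 sin0 mul1r mul0r addr0.
by rewrite coord_free2// mulr0 cos0 sin0 mul1r mul0r oppr0 add0r.
Qed.

Lemma free_coord T w0 w1 : Hspace A 1 w0 ->
  coord_solution e mu T (fun=> 0) (free_wave w0 w1).
Proof.
move=> w01; apply: (coord_solution_intro
 (p := fun k t => cos (mu k * t) * inner w0 (e k) + sin (mu k * t) * ((mu k)^-1 * inner w1 (e k)))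
 (q := fun k t => - (sin (mu k * t) * (mu k * inner w0 (e k))) + cos (mu k * t) * inner w1 (e k))).
- by move=> k t _; rewrite coord_free1 coord_free2.
- move=> k; have ccos := @continuous_cos_scale R (mu k) `[0, T].
  have csin := @continuous_sin_scale R (mu k) `[0, T].
  split; first by apply: withinD; apply: withinM => //; exact: within_cst.
  apply: withinD; first by apply: withinN; apply: withinM => //; exact: within_cst.
  by apply: withinM => //; exact: within_cst.
- move=> k t _; have muk := mu_gt0 eb k.
  have := is_derive_cos_scale (mu k) t => ?; have := is_derive_sin_scale (mu k) t => ?.
  split; apply: is_derive_eq; rewrite ?inner0l /GRing.scale/=; field;
  by rewrite gt_eqF.
Qed.

Lemma coord_half1_free w0 w1 t : Hspace A 1 w0 ->
  coord_scaled e (fun k => mu k ^+ 1) (free_wave w0 w1 t).1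
    (cos_op t (half_power A 1 w0) + sin_op t w1).
Proof.
move=> w01 k; rewrite coord_free1 innerDl coord_cos_op coord_sin_op.
rewrite (coord_half1 eb w01); have muk := mu_gt0 eb k.
by field; rewrite gt_eqF.
Qed.

Lemma free_C1 T w0 w1 : Hspace A 1 w0 ->
  C0_Hspace A 1 T (fun t => (free_wave w0 w1 t).1).
Proof.
move=> w01; apply: (C0_HspaceP eb (n := 1) isT (fun t _ => coord_half1_free w1 t w01)).
by apply: withinD; [exact: within_cos_op|exact: within_sin_op].
Qed.

Lemma free_wave_solution T w0 w1 : 0 <= T -> Hspace A 1 w0 ->
  wave_solution A T (fun=> 0) w0 w1 (free_wave w0 w1).
Proof.
move=> T0 w01; have := coord_wave eb T0 (@within_cst R H _ 0) (free_coord T w1 w01)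
  (free_C1 T w1 w01); rewrite free_wave0//; apply.
by apply: withinD; [apply: withinN; exact: within_sin_op|exact: within_cos_op].
Qed.

Lemma free_regular T w0 w1 : Hspace A 2 w0 -> Hspace A 1 w1 ->
  regular_solution A T (fun=> 0) (free_wave w0 w1).
Proof.
move=> w02 w11; have w01 := Hspace21 w02.
apply: (coord_regular eb (@within_cst R H _ 0) (free_coord T w1 w01)).
  apply: (C0_HspaceP eb (n := 2) isT
    (Z := fun t => cos_op t (half_power A 2 w0) + sin_op t (half_power A 1 w1))).
    move=> t _ k; rewrite coord_free1 innerDl coord_cos_op coord_sin_op.
    rewrite (coord_half2 eb w02) (coord_half1 eb w11); have muk := mu_gt0 eb k.
    by field; rewrite gt_eqF.
  by apply: withinD; [exact: within_cos_op|exact: within_sin_op].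
apply: (C0_HspaceP eb (n := 1) isT
    (Z := fun t => - sin_op t (half_power A 2 w0) + cos_op t (half_power A 1 w1))).
  move=> t _ k; rewrite coord_free2// innerDl innerNl coord_cos_op coord_sin_op.
  by rewrite (coord_half2 eb w02) (coord_half1 eb w11); ring.
by apply: withinD; [apply: withinN; exact: within_sin_op|exact: within_cos_op].
Qed.

Lemma coord_solution_energy0 T (W : R -> H * H) : 0 <= T ->
  coord_solution e mu T (fun=> 0) W -> (forall t, 0 <= t <= T -> Hspace A 1 (W t).1) ->
  energy A 1 W 0 = 0 -> forall t, 0 <= t <= T -> W t = 0.
Proof.
move=> T0 cW W1 W0 t tT.
have := energy_estimate eb T0 (@within_cst R H _ 0) cW W1 tT.
have p0 : prim (fun s => `|((fun=> 0) : R -> H) s| ^+ 2) t = 0 :> R.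
  by rewrite /prim normr0 expr0n Rintegral_cst//= mul0r.
rewrite W0 add0r p0.
rewrite !mulr0 => Et.
have : `|half_power A 1 (W t).1| ^+ 2 + `|(W t).2| ^+ 2 <= 0 :> R.
  by move: Et; rewrite energy1E pmulr_rle0.
have := sqr_ge0 (`|half_power A 1 (W t).1| : R); have := sqr_ge0 (`|(W t).2| : R) => h1 h2 h3.
have e1 : `|half_power A 1 (W t).1| ^+ 2 = 0 :> R by lra.
have e2 : `|(W t).2| ^+ 2 = 0 :> R by lra.
rewrite [W t]surjective_pairing; congr pair; last first.
  by apply/eqP; rewrite -normr_eq0 -sqrf_eq0 e2.
apply: (half_power1_inj eb (W1 _ tT)).
by apply/eqP; rewrite -normr_eq0 -sqrf_eq0 e1.
Qed.

(** The difference has zero source and zero initial energy, so the energy estimate annihilates it. A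
    free solution given by a hypothesis can thus be replaced by the explicit formula. *)
Lemma wave_unique T w0 w1 W : 0 <= T -> Hspace A 1 w0 ->
  wave_solution A T (fun=> 0) w0 w1 W ->
  forall t, 0 <= t <= T -> W t = free_wave w0 w1 t.
Proof.
move=> T0 w01 sW t tT; apply/subr0_eq.
have cB := coord_solutionB (wave_coord eb T0 (@within_cst R H _ 0) sW) (free_coord T w1 w01).
have [[W1 _] _ W0 _] := sW; have [F1 _] := free_C1 T w1 w01.
apply: (coord_solution_energy0 T0 (W := fun t => W t - free_wave w0 w1 t)) => //.
- by move=> k; have := cB k; rewrite subrr.
- move=> s sT; apply: (proj1 (Hspace_B eb (n := 1) isT _ _)).
    by apply: W1; rewrite in_itv.
  by apply: F1; rewrite in_itv.
- rewrite energy1E W0 free_wave0// subrr (proj2 (Hspace_0 eb (n := 1) isT)).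
  by rewrite normr0 expr0n addr0 mulr0.
Qed.

End FreeWave.

(** * Construction of regular solutions *)

Section RegularSolutions.
Context {R : realType} {H : hilbertType R}.
Variables (A : operator H) (e : nat -> H) (mu : nat -> R) (m0 : R).
Hypothesis eb : eigenbasis A e mu m0.
Implicit Types (x y v w : H) (f : R -> H) (W V : R -> H * H) (t T : R).

Let eO := eigen_ortho eb.
Let eC := eigen_complete eb.

Lemma C0_Hspace_lin (n : nat) T (a : R) (X Y : R -> H) : (n <= 2)%N ->
  C0_Hspace A n T X -> C0_Hspace A n T Y ->
  C0_Hspace A n T (fun t => a *: X t + Y t).
Proof.
move=> n2 [X1 cX] [Y1 cY]; have XY t : t \in `[0, T] -> _ :=
  fun tT => Hspace_lin eb a n2 (X1 t tT) (Y1 t tT).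
split=> [t /XY[]//|].
apply: (within_eq (f := fun t => a *: half_power A n (X t) + half_power A n (Y t))).
  by move=> t /XY[_] /= ->.
by apply: withinD => //; apply: withinZ => //; exact: within_cst.
Qed.

Lemma C1_Hspace_lin (n : nat) T (a : R) (X dX Y dY : R -> H) : (n <= 2)%N ->
  C1_Hspace A n T X dX -> C1_Hspace A n T Y dY ->
  C1_Hspace A n T (fun t => a *: X t + Y t) (fun t => a *: dX t + dY t).
Proof.
move=> n2 [cX cdX XP] [cY cdY YP].
split; [exact: C0_Hspace_lin|exact: C0_Hspace_lin|move=> t tT].
have tT' : t \in `[0, T] by case/andP: tT => ? ?; rewrite in_itv/= !ltW.
have [_ ->] := Hspace_lin eb a n2 (proj1 cdX _ tT') (proj1 cdY _ tT').
have E s : 0 <= s <= T -> a *: half_power A n (X s) + half_power A n (Y s) =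
   (half_power A n \o (fun t => a *: X t + Y t)) s.
  move=> sT; have sT' : s \in `[0, T] by rewrite in_itv.
  by have [_ /= ->] := Hspace_lin eb a n2 (proj1 cX _ sT') (proj1 cY _ sT').
apply: (is_derive_near (near_itv tT E)).
have d1 := XP _ tT; have d2 := YP _ tT.
exact: (is_deriveD (is_deriveZ a d1) d2).
Qed.

Lemma regular_lin T (a : R) f g W V :
  regular_solution A T f W -> regular_solution A T g V ->
  regular_solution A T (fun t => a *: f t + g t) (fun t => a *: W t + V t).
Proof.
move=> [W2 W1 [ddw [W0 Weq]]] [V2 V1 [ddv [V0 Veq]]].
split; [exact: (C0_Hspace_lin (n := 2) a isT W2 V2)|
  exact: (C1_Hspace_lin (n := 1) a isT W1 V1)|].
exists (fun t => a *: ddw t + ddv t); split; first exact: (C1_Hspace_lin (n := 0) a isT W0 V0).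
move=> t tT; rewrite -Weq// -Veq//.
have Wt := proj1 W2 _ tT; have Vt := proj1 V2 _ tT.
have [D DE] := Hspace_lin eb a (n := 2) isT Wt Vt.
rewrite -(half2_operator eb D) DE (half2_operator eb Wt) (half2_operator eb Vt).
by rewrite scalerDr addrACA.
Qed.

Lemma regularB T f g W V :
  regular_solution A T f W -> regular_solution A T g V ->
  regular_solution A T (fun t => f t - g t) (fun t => W t - V t).
Proof.
move=> rW rV; have := regular_lin (-1) rV rW.
congr regular_solution; apply/funext => t; first by rewrite scaleN1r addrC.
by rewrite addrC; congr (_ + _); rewrite scaleN1r.
Qed.

Lemma regular0 T : regular_solution A T (fun=> 0) (fun=> 0).
Proof.
have [h0 h1 h2] : [/\ half_power A 0 0 = 0 :> H, half_power A 1 0 = 0 :> H & half_power A 2 0 = 0 :> H].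
  by split=> //; [exact: (proj2 (Hspace_0 eb (n := 1) isT))|
    exact: (proj2 (Hspace_0 eb (n := 2) isT))].
have c (n : nat) : (n <= 2)%N -> C0_Hspace A n T (fun=> 0).
  by move=> n2; split=> [t _|]; [exact: (proj1 (Hspace_0 eb n2))|exact: within_cst].
split; [exact: c| |exists (fun=> 0)].
  split; [exact: c|exact: c|move=> t _].
  by rewrite h1; exact: is_derive_cst.
split; last first.
  by move=> t _; rewrite -(half2_operator eb) ?h2 ?addr0//; exact: (proj1 (Hspace_0 eb (n := 2) isT)).
split; [exact: c|exact: c|move=> t _].
exact: is_derive_cst.
Qed.

Lemma regular_sum T (n : nat) (f : nat -> R -> H) (W : nat -> R -> H * H) :
  (forall k, regular_solution A T (f k) (W k)) ->
  regular_solution A T (fun t => \sum_(k < n) f k t) (fun t => \sum_(k < n) W k t).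
Proof.
move=> fW; elim: n => [|n IH].
  under eq_fun do rewrite big_ord0.
  by under [X in regular_solution _ _ _ X]eq_fun do rewrite big_ord0; exact: regular0.
under eq_fun do rewrite big_ord_recr/=.
under [X in regular_solution _ _ _ X]eq_fun do rewrite big_ord_recr/=.
have := regular_lin 1 IH (fW n).
under eq_fun do rewrite scale1r.
by under [X in regular_solution _ _ _ X]eq_fun do rewrite scale1r.
Qed.

Lemma C0_Hspace_shift (n : nat) (a T T' : R) (X : R -> H) :
  0 <= a -> 0 <= T' -> a + T' <= T ->
  C0_Hspace A n T X -> C0_Hspace A n T' (fun t => X (a + t)).
Proof.
move=> a0 T'0 aT [X1 cX]; split=> [t|].
  rewrite in_itv/= => /andP[t0 tT]; apply: X1; rewrite in_itv/= addr_ge0//=.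
  by rewrite (le_trans _ aT)// lerD2l.
by apply: (within_shift (f := half_power A n \o X) a0 _ aT cX); rewrite (le_trans _ aT)// addr_ge0.
Qed.

Lemma is_derive_shift (U : normedModType R) (F : R -> U) (a t : R) (dF : U) :
  is_derive (a + t) 1 F dF -> is_derive t 1 (fun s => F (a + s)) dF.
Proof.
move=> /is_derive_cvg h; apply/is_derive_cvg.
by under eq_fun do rewrite addrCA.
Qed.

Lemma C1_Hspace_shift (n : nat) (a T T' : R) (X dX : R -> H) :
  0 <= a -> 0 <= T' -> a + T' <= T ->
  C1_Hspace A n T X dX ->
  C1_Hspace A n T' (fun t => X (a + t)) (fun t => dX (a + t)).
Proof.
move=> a0 T'0 aT [cX cdX XP]; split; try exact: C0_Hspace_shift aT _.
move=> t /andP[t0 tT]; apply: (is_derive_shift (F := half_power A n \o X)).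
by apply: XP; rewrite ltr_wpDl//= (lt_le_trans _ aT)// ltrD2l.
Qed.

Lemma regular_shift (a T T' : R) f W :
  0 <= a -> 0 <= T' -> a + T' <= T -> regular_solution A T f W ->
  regular_solution A T' (fun t => f (a + t)) (fun t => W (a + t)).
Proof.
move=> a0 T'0 aT [W2 W1 [ddw [W0 Weq]]].
split; [exact: C0_Hspace_shift aT W2|exact: C1_Hspace_shift aT W1|].
exists (fun t => ddw (a + t)); split; first exact: C1_Hspace_shift aT W0.
move=> t; rewrite in_itv/= => /andP[t0 tT]; apply: Weq.
by rewrite in_itv/= addr_ge0//= (le_trans _ aT)// lerD2l.
Qed.

Lemma norm_prim_le (T M : R) (g : R -> R) : 0 <= T -> {within `[0, T], continuous g} ->
  (forall t, 0 <= t <= T -> `|g t| <= M) ->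
  forall t, 0 <= t <= T -> `|prim g t| <= M * T.
Proof.
move=> T0 cg gM t /andP[t0 tT].
have M0 : 0 <= M by apply: le_trans (gM 0 _); rewrite ?lexx.
have gt s : 0 <= s <= t -> - M <= g s <= M.
  by move=> /andP[s0 st]; rewrite -ler_norml gM// s0 (le_trans st).
have cg' := within_sub tT cg.
have pc (m : R) : prim (fun=> m) t = m * t.
  have d u : 0 < u < T -> is_derive u 1 (fun v : R => m * v) m.
    by move=> _; apply: is_derive_eq; rewrite /GRing.scale/= ?(mulr0, addr0, add0r, mulr1).
  rewrite (prim_FTC T0 _ _ d) ?t0// ?mulr0 ?subr0//; first exact: within_cst.
  apply: withinM; first exact: within_cst.
  by apply: continuous_subspaceT => u; exact: cvg_id.
rewrite ler_norml; apply/andP; split; last first.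
  apply: le_trans (_ : prim (fun=> M) t <= _); last by rewrite pc ler_wpM2l.
  by apply: le_prim => //; [exact: within_cst|move=> s /gt/andP[]].
apply: le_trans (_ : prim (fun=> - M) t <= _); first by rewrite pc mulNr lerN2 ler_wpM2l.
by apply: le_prim => //; [exact: within_cst|move=> s /gt/andP[]].
Qed.

(* Duhamel's formula in each coordinate, integrated by parts so that the second
   power of [mu] can be paid for by the derivative of the source. *)
Lemma duhamel_regular T (M : R) (phi dphi : R -> R) (g : H) : 0 <= T ->
  (forall t, is_derive t 1 phi (dphi t)) -> continuous dphi ->
  (forall t, `|phi t| <= M) -> (forall t, `|dphi t| <= M) ->
  exists2 U, regular_solution A T (fun t => phi t *: g) U & U 0 = 0.
Proof.
move=> T0 dphiP cdphi phiM dphiM.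
have M0 : 0 <= M by apply: le_trans (phiM 0).
have cphi : continuous phi.
  by move=> t; apply/differentiable_continuous/derivable1_diffP; have [] := dphiP t.
pose pc k s := cos (mu k * s) * dphi s.
pose ps k s := sin (mu k * s) * dphi s.
have cpc k : {within `[0, T], continuous (pc k)}.
  by apply: withinM; [exact: continuous_cos_scale|exact: continuous_subspaceT].
have cps k : {within `[0, T], continuous (ps k)}.
  by apply: withinM; [exact: continuous_sin_scale|exact: continuous_subspaceT].
(* By the addition formulas [c k] and [s k] are the convolutions of [dphi] with cosine and sine at
   frequency [mu k]. After the integration by parts, [z2 k] and [z1 k] are the factors of the
   coordinate of [g] in [A w] and in [A^(1/2) w']. *)
pose c k t := cos (mu k * t) * prim (pc k) t + sin (mu k * t) * prim (ps k) t.
pose s k t := sin (mu k * t) * prim (pc k) t - cos (mu k * t) * prim (ps k) t.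
pose z2 k t := phi t - cos (mu k * t) * phi 0 - c k t.
pose z1 k t := sin (mu k * t) * phi 0 + s k t.
have bpc k t : 0 <= t <= T -> `|prim (pc k) t| <= M * T.
  apply: norm_prim_le => // u _; rewrite normrM -[leRHS]mul1r.
  by rewrite ler_pM ?normr_cos_le1.
have bps k t : 0 <= t <= T -> `|prim (ps k) t| <= M * T.
  apply: norm_prim_le => // u _; rewrite normrM -[leRHS]mul1r.
  by rewrite ler_pM ?normr_sin_le1.
have tr (a b K : R) : `|a| <= 1 -> `|b| <= K -> `|a * b| <= K.
  by move=> a1 bK; rewrite normrM -[leRHS]mul1r ler_pM.
have ccos k := @continuous_cos_scale R (mu k) `[0, T].
have csin k := @continuous_sin_scale R (mu k) `[0, T].
have cprim k : {within `[0, T], continuous (prim (pc k))} /\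
    {within `[0, T], continuous (prim (ps k))}.
  by split; apply: prim_continuous.
have cc k : {within `[0, T], continuous (c k)}.
  by apply: withinD; apply: withinM => //; case: (cprim k).
have cs k : {within `[0, T], continuous (s k)}.
  by apply: withinB; apply: withinM => //; case: (cprim k).
have cphiT : {within `[0, T], continuous phi} by exact: continuous_subspaceT.
have cz2 k : {within `[0, T], continuous (z2 k)}.
  by apply: withinB => //; apply: withinB => //; apply: withinM => //; exact: within_cst.
have cz1 k : {within `[0, T], continuous (z1 k)}.
  by apply: withinD => //; apply: withinM => //; exact: within_cst.
(* One summand for each of the four terms of [z2]. The bound does not depend on [k], so [z1] and
   [z2] define bounded diagonal multipliers at each time. *)
pose K := M + M + (M * T + M * T).
have K0 : 0 <= M * T by rewrite mulr_ge0.
have bz2 k t : 0 <= t <= T -> `|z2 k t| <= K.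
  move=> tT; apply: le_trans (ler_normB _ _) _; rewrite lerD//.
    by apply: le_trans (ler_normB _ _) _; rewrite lerD// tr ?normr_cos_le1.
  apply: le_trans (ler_normD _ _) _; rewrite lerD// tr ?normr_cos_le1 ?normr_sin_le1 ?bpc ?bps//.
have bz1 k t : 0 <= t <= T -> `|z1 k t| <= K.
  move=> tT; apply: le_trans (_ : M + (M * T + M * T) <= _); last first.
    by rewrite /K -addrA lerDr.
  apply: le_trans (ler_normD _ _) _; rewrite lerD// ?tr ?normr_sin_le1//.
  apply: le_trans (ler_normB _ _) _; rewrite lerD// tr ?normr_cos_le1 ?normr_sin_le1 ?bpc ?bps//.
pose Z2 t := diag_mul e (fun k => z2 k t) g.
pose Z1 t := diag_mul e (fun k => z1 k t) g.
have Z2E k t : 0 <= t <= T -> inner (Z2 t) (e k) = z2 k t * inner g (e k).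
  by move=> tT; rewrite (coord_diag_mul eO _ _ (M := K))// => j; exact: bz2.
have Z1E k t : 0 <= t <= T -> inner (Z1 t) (e k) = z1 k t * inner g (e k).
  by move=> tT; rewrite (coord_diag_mul eO _ _ (M := K))// => j; exact: bz1.
have cZ2 : {within `[0, T], continuous Z2} by exact: (diag_mul_within eO eC cz2 bz2).
have cZ1 : {within `[0, T], continuous Z1} by exact: (diag_mul_within eO eC cz1 bz1).
pose U t : H * H := (half_power A (- 1) (half_power A (- 1) (Z2 t)), half_power A (- 1) (Z1 t)).
have mun k : mu k != 0 by rewrite gt_eqF// (mu_gt0 eb).
have cf : {within `[0, T], continuous (fun t => phi t *: g)}.
  by apply: withinZ => //; exact: within_cst.
exists U; last first.
  have T00 : 0 <= (0 : R) <= T by rewrite lexx T0.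
  have z20 k : z2 k 0 = 0.
    by rewrite /z2 /c !prim0 !mulr0 cos0 mul1r subrr addr0 subr0.
  have z10 k : z1 k 0 = 0.
    by rewrite /z1 /s !prim0 !mulr0 sin0 mul0r subr0 addr0.
  rewrite [LHS]surjective_pairing; congr pair; apply: (coord_inj eC) => k.
    by rewrite (coord_inv_sqrt eb) (coord_inv_sqrt eb) inner0l Z2E// z20 mul0r !mulr0.
  by rewrite (coord_inv_sqrt eb) inner0l Z1E// z10 mul0r mulr0.
apply: (coord_regular eb cf).
- apply: (coord_solution_intro
    (p := fun k t => (mu k)^-1 * ((mu k)^-1 * (z2 k t * inner g (e k))))
    (q := fun k t => (mu k)^-1 * (z1 k t * inner g (e k)))).
  + by move=> k t tT; rewrite !(coord_inv_sqrt eb) Z2E// Z1E.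
  + move=> k; split.
      apply: withinM; first exact: within_cst.
      apply: withinM; first exact: within_cst.
      by apply: withinM; [exact: cz2|exact: within_cst].
    apply: withinM; first exact: within_cst.
    by apply: withinM; [exact: cz1|exact: within_cst].
  + move=> k t tT.
    have := is_derive_cos_scale (mu k) t => ?; have := is_derive_sin_scale (mu k) t => ?.
    have := prim_derive (cpc k) tT => ?; have := prim_derive (cps k) tT => ?.
    have pcE : pc k t = cos (mu k * t) * dphi t by [].
    have psE : ps k t = sin (mu k * t) * dphi t by [].
    (* The two integrands contribute the squares of cosine and sine; writing [dphi] with their sum
       lets [ring] conclude. *)
    have dphiE : dphi t = (cos (mu k * t) ^+ 2 + sin (mu k * t) ^+ 2) * dphi t.
      by rewrite cos2Dsin2 mul1r.
    have dc : is_derive t 1 (c k) (dphi t - mu k * s k t).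
      apply: is_derive_eq; rewrite /GRing.scale/= pcE psE [in RHS]dphiE /s.
      by ring.
    have ds : is_derive t 1 (s k) (mu k * c k t).
      by apply: is_derive_eq; rewrite /GRing.scale/= pcE psE /c; ring.
    have dz2 : is_derive t 1 (z2 k) (mu k * z1 k t).
      have := dphiP t => ?.
      by apply: is_derive_eq; rewrite /GRing.scale/= /z1; ring.
    have dz1 : is_derive t 1 (z1 k) (mu k * (phi t - z2 k t)).
      by apply: is_derive_eq; rewrite /GRing.scale/= /z2; ring.
    split; apply: is_derive_eq; rewrite /GRing.scale/= ?innerZl; field; exact: mun.
- apply: (C0_HspaceP eb (n := 2) isT (Z := Z2)) => // t tT k.
  by rewrite !(coord_inv_sqrt eb); field; exact: mun.
- apply: (C0_HspaceP eb (n := 1) isT (Z := Z1)) => // t tT k.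
  by rewrite !(coord_inv_sqrt eb); field; exact: mun.
Qed.

End RegularSolutions.

(** * Integrals of square norms *)

Section StronglyMeasurable.
Context {R : realType}.
Implicit Types (V : normedModType R) (T : R).

Definition grid (T : R) (n i : nat) : R := T * i%:R / n.+1%:R.

(** Clamping keeps the index between [0] and [n + 1] for all real [t], so the step functions have
    finite range on the whole line. *)
Definition grid_index (T : R) (n : nat) (t : R) : nat :=
  Num.truncn (clamp T t * n.+1%:R / T).

Lemma grid_index_itv T n t : 0 < T -> 0 <= t <= T ->
  grid T n (grid_index T n t) <= t < grid T n (grid_index T n t) + T / n.+1%:R.
Proof.
move=> T0 tT; set i := grid_index T n t; rewrite /grid.
have n0 : 0 < n.+1%:R :> R by rewrite ltr0n.
have := @truncn_itv R (clamp T t * n.+1%:R / T).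
rewrite -/(grid_index T n t) -/i clampE// => /(_ _)/wrap[].
  by case/andP: tT => t0 _; rewrite !mulr_ge0 ?invr_ge0 ?(ltW T0).
rewrite ler_pdivlMr// ltr_pdivrMr// => /andP[i1 i2].
rewrite ler_pdivrMr// mulrC i1/= -mulrDl ltr_pdivlMr//.
by move: i2; rewrite -[i.+1%:R]natr1 mulrDl mul1r [_%:R * T]mulrC.
Qed.

Lemma grid_index_le T n t : 0 < T -> (grid_index T n t <= n.+1)%N.
Proof.
move=> T0; have /andP[c0 cT] := clamp_in t (ltW T0).
rewrite /grid_index -[leqRHS](@natrK R); apply: le_truncn.
by rewrite ler_pdivrMr// mulrC ler_wpM2l.
Qed.

Lemma strongly_measurable_continuous V T (f : R -> V) : 0 < T ->
  {within `[0, T], continuous f} -> strongly_measurable T f.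
Proof.
move=> T0 cf; exists (fun n t => f (grid T n (grid_index T n t))); split.
  move=> n; split.
    apply: (sub_finite_set (B := (fun i => f (grid T n i)) @` `I_n.+2)).
      by move=> _ [t _ <-]; exists (grid_index T n t) => //=; rewrite ltnS grid_index_le.
    exact/finite_image/finite_II.
  move=> v.
  have mi : measurable_fun [set: R] (fun t => clamp T t * n.+1%:R / T).
    apply: continuous_measurable_fun => t; apply: cvgM; last exact: cvg_cst.
    by apply: cvgM; [exact: clamp_continuous|exact: cvg_cst].
  rewrite (_ : _ @^-1` _ = \bigcup_(i in [set i | f (grid T n i) = v])
      ((fun t => clamp T t * n.+1%:R / T) @^-1` `[i%:R, i.+1%:R[)).
    apply: bigcup_measurable => i _; rewrite -[X in measurable X]setTI.
    by apply: mi => //; exact: measurable_itv.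
  have pos t : 0 <= clamp T t * n.+1%:R / T.
    by have /andP[c0 _] := clamp_in t (ltW T0); rewrite !mulr_ge0 ?invr_ge0 ?(ltW T0).
  apply/seteqP; split=> [t /= <-|t /= [i <-]].
    by exists (grid_index T n t) => //=; rewrite ?in_itv/= truncn_itv.
  by move=> ti; congr (f (grid _ _ _)); exact: truncn_def.
move=> t; rewrite in_itv/= => tT.
have fE : f t = (f \o clamp T) t by rewrite /= clampE.
have gT n : 0 <= grid T n (grid_index T n t) <= T.
  have /andP[g1 _] := grid_index_itv n T0 tT; have /andP[_ tT'] := tT.
  by rewrite (le_trans g1)// !mulr_ge0 ?invr_ge0 ?(ltW T0).
have -> : (fun n => f (grid T n (grid_index T n t))) =
    (f \o clamp T) \o (fun n => grid T n (grid_index T n t)).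
  by apply/funext => n; rewrite /= clampE.
rewrite fE; apply: continuous_cvg; first exact: (continuous_clamp (ltW T0) cf).
apply/cvgrPdist_le => eps eps0.
have [N NT] : exists N : nat, T / eps < N%:R.
  by exists (Num.truncn (T / eps)).+1; exact: truncnS_gt.
exists N => // n /= Nn; have /andP[g1 g2] := grid_index_itv n T0 tT.
rewrite ger0_norm ?subr_ge0//; apply: le_trans (_ : T / n.+1%:R <= _).
  by rewrite lerBlDl ltW.
rewrite ler_pdivrMr ?ltr0n// mulrC -ler_pdivrMr//; apply: le_trans (ltW NT) _.
by rewrite ler_nat leqW.
Qed.

(** Two simple functions take finitely many pairs of values, so preimages under the distance are
    finite unions; no Borel structure on [V] enters. *)
Lemma strongly_measurable_dist V T (f g : R -> V) :
  strongly_measurable T f -> strongly_measurable T g ->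
  measurable_fun `[0, T] (fun t => `|f t - g t| ^+ 2).
Proof.
move=> [r [rP rf]] [s [sP sg]].
apply: (@measurable_fun_cvg _ _ _ _ (fun n t => `|r n t - s n t| ^+ 2)) => [n|t /=].
  apply: (measurable_funS measurableT) => // _ Y mY; rewrite setTI.
  have [[rfin rm] [sfin sm]] := (rP n, sP n).
  rewrite (_ : _ @^-1` _ = \bigcup_(p in (range (r n) `*` range (s n)) `&`
     [set p | Y (`|p.1 - p.2| ^+ 2)]) (r n @^-1` [set p.1] `&` s n @^-1` [set p.2])).
    apply: fin_bigcup_measurable.
      by apply: finite_setI; left; exact: finite_setX.
    by move=> p _; exact: measurableI.
  apply/seteqP; split=> [t /= Yt|t /= [[u v] /= [_ Yuv] [-> ->]]//].
  by exists (r n t, s n t) => //=; split => //; split; exists t.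
move=> tT; have tT' : t \in `[0, T] by [].
rewrite expr2; under eq_fun do rewrite expr2.
by apply: cvgM; apply: cvg_norm; apply: cvgB; [exact: rf|exact: sg|exact: rf|exact: sg].
Qed.

Lemma strongly_measurable_sqr_norm V T (f : R -> V) : 0 < T ->
  strongly_measurable T f -> measurable_fun `[0, T] (fun t => `|f t| ^+ 2).
Proof.
move=> T0 mf; have m0 : strongly_measurable T (fun=> 0 : V).
  by apply: strongly_measurable_continuous => //; exact: within_cst.
by apply: eq_measurable_fun (strongly_measurable_dist mf m0) => t _; rewrite subr0.
Qed.

Lemma normD2_le_normed V (x y : V) : `|x| ^+ 2 <= 2 * `|y| ^+ 2 + 2 * `|x - y| ^+ 2.
Proof.
apply: (@le_trans _ _ ((`|y| + `|x - y|) ^+ 2)).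
  rewrite ler_pXn2r ?nnegrE ?addr_ge0//.
  by apply: le_trans (ler_normD _ _); rewrite addrC subrK.
have := sqr_ge0 (`|y| - `|x - y|); rewrite sqrrB sqrrD; lra.
Qed.

Lemma integral_normD2_le V T (f g : R -> V) : 0 < T ->
  strongly_measurable T f -> strongly_measurable T g ->
  (integral0T T (fun t => (`|f t| ^+ 2)%R) <=
   2%:E * integral0T T (fun t => (`|g t| ^+ 2)%R) +
   2%:E * integral0T T (fun t => (`|f t - g t| ^+ 2)%R))%E.
Proof.
move=> T0 mf mg; rewrite /integral0T.
have m1 := strongly_measurable_sqr_norm T0 mf.
have m2 := strongly_measurable_sqr_norm T0 mg.
have m3 := strongly_measurable_dist mf mg.
have mE (h : R -> R) : measurable_fun `[0, T] h -> measurable_fun `[0, T] (EFin \o h).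
  by move=> ?; apply/measurable_EFinP.
have Z (h : R -> R) : measurable_fun `[0, T] h -> (forall t, 0 <= h t) ->
    (2%:E * \int[lebesgue_measure]_(t in `[0%R, T]) (h t)%:E =
     \int[lebesgue_measure]_(t in `[0%R, T]) (2%:E * (h t)%:E))%E.
  move=> mh h0; rewrite ge0_integralZl//; first exact: mE.
  by move=> t _; rewrite lee_fin.
rewrite !Z//.
have mZ (h : R -> R) : measurable_fun `[0, T] h ->
    measurable_fun `[0, T] (fun t => 2%:E * (h t)%:E)%E.
  by move=> mh; apply: measurable_funeM; exact: mE.
rewrite -ge0_integralD//; try exact: mZ; try by move=> x _; rewrite mule_ge0// lee_fin sqr_ge0.
apply: ge0_le_integral => //.
- exact: mE.
- by apply: emeasurable_funD; exact: mZ.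
- by move=> t _; rewrite -!EFinM -EFinD lee_fin normD2_le_normed.
Qed.

Lemma L2_continuous V T (f : R -> V) : 0 < T ->
  {within `[0, T], continuous f} -> L2 T f.
Proof.
move=> T0 cf; split; first exact: strongly_measurable_continuous.
by rewrite integral0T_prim ?ltry//; exact: within_sqr_norm.
Qed.

Lemma prim_shift (a T T' : R) (g : R -> R) : 0 <= a -> 0 <= T' -> a + T' <= T ->
  {within `[0, T], continuous g} ->
  prim (fun t => g (a + t)) T' = prim g (a + T') - prim g a.
Proof.
move=> a0 T'0 aT cg; have T0 : 0 <= T by rewrite (le_trans _ aT)// addr_ge0.
have cg' := within_shift a0 T0 aT cg.
have cp := prim_continuous T0 cg.
have d t : 0 < t < T' -> is_derive t 1 (fun s => prim g (a + s)) (g (a + t)).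
  move=> /andP[t0 tT]; apply: (is_derive_shift (F := prim g)).
  by apply: (prim_derive cg); rewrite ltr_wpDl//= (lt_le_trans _ aT)// ltrD2l.
rewrite (prim_FTC T'0 cg' (within_shift a0 T0 aT cp) d) ?addr0//.
by rewrite lexx andbT.
Qed.

Lemma prim_nondecreasing (T : R) (g : R -> R) : {within `[0, T], continuous g} ->
  (forall t, 0 <= t <= T -> 0 <= g t) ->
  forall s t, 0 <= s -> s <= t -> t <= T -> prim g s <= prim g t.
Proof.
move=> cg g0 s t s0 st tT.
have := @prim_shift s t (t - s) g s0 _ _ (within_sub tT cg).
rewrite subr_ge0 (addrC s) subrK lexx => /(_ st isT) E.
rewrite -subr_ge0 -E; apply: prim_ge0 => u /andP[u0 uts]; apply: g0.
rewrite addr_ge0//=; apply: le_trans tT.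
by rewrite addrC -lerBrDr.
Qed.

End StronglyMeasurable.

(** * Admissibility and observability of regular solutions *)

Section Observation.
Context {R : realType} {H G : hilbertType R}.
Variables (A : operator H) (e : nat -> H) (mu : nat -> R) (m0 : R).
Hypothesis eb : eigenbasis A e mu m0.
Variable B : H * H -> G.
Hypothesis Bop : observation_op A B.
Implicit Types (x y v w : H) (f : R -> H) (W V : R -> H * H) (t T : R).

Lemma observation_opB (p q : H * H) : Hspace A 2 p.1 -> Hspace A 2 q.1 ->
  B (p - q) = B p - B q.
Proof.
move=> p2 q2; have := (proj1 Bop) (-1) q p q2 p2.
by rewrite !scaleN1r !(addrC (- _)).
Qed.

Lemma observation_op_le : exists2 M : R, 0 <= M & forall p q : H * H,
  Hspace A 2 p.1 -> Hspace A 2 q.1 ->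
  `|B p - B q| <= M * (`|half_power A 2 p.1 - half_power A 2 q.1| + `|p.2 - q.2|).
Proof.
have [_ [M BM]] := Bop; exists `|M| => // p q p2 q2.
have [D DE] := Hspace_B eb (n := 2) isT p2 q2.
rewrite -observation_opB//; apply: le_trans (BM (p - q) D) _.
have -> : half_power A 2 (p - q).1 = half_power A 2 p.1 - half_power A 2 q.1 by [].
by rewrite ler_wpM2r ?ler_norm// addr_ge0.
Qed.

(** [B (w, w')] is split as [B (w, 0) + B (0, w')]: each summand has increments bounded by those of
    one continuous function, [A w] or [w']. *)
Lemma within_observation T f W : regular_solution A T f W ->
  {within `[0, T], continuous (B \o W)}.
Proof.
move=> [[W2 cW2] [_ cW1' _] _]; have [_ cW1] := C0_Hspace_down eb (n := 0) isT cW1'.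
have [M M0 BM] := observation_op_le.
have e1 : {within `[0, T], continuous (fun t => B ((W t).1, 0))}.
  apply: (within_lipschitz (M := M) (f := fun t => half_power A 2 (W t).1)) => // s t sT tT.
  by have := BM ((W s).1, 0) ((W t).1, 0) (W2 _ sT) (W2 _ tT); rewrite subrr normr0 addr0.
have e2 : {within `[0, T], continuous (fun t => B (0, (W t).2))}.
  apply: (within_lipschitz (M := M) (f := fun t => (W t).2)) => // s t sT tT.
  have h0 : Hspace A 2 (0 : H) := proj1 (Hspace_0 eb (n := 2) isT).
  by have := BM (0, (W s).2) (0, (W t).2) h0 h0; rewrite subrr normr0 add0r.
apply: within_eq (withinD e1 e2) => t tT.
have h0 : Hspace A 2 (0 : H) := proj1 (Hspace_0 eb (n := 2) isT).
have := (proj1 Bop) 1 ((W t).1, 0) (0, (W t).2) (W2 _ tT) h0.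
rewrite !scale1r => <-; congr (B _); rewrite [RHS]surjective_pairing.
by congr pair; rewrite ?addr0 ?add0r.
Qed.

Lemma energyB0 W t : energy A 1 (fun t => W t - W t) t = 0.
Proof.
rewrite energy1E subrr.
by rewrite (proj2 (Hspace_0 eb (n := 1) isT)) normr0 expr0n addr0 mulr0.
Qed.

Lemma integral0T0 (V : normedModType R) T (f : R -> V) :
  integral0T T (fun t => `|f t - f t| ^+ 2) = 0%E.
Proof.
by rewrite /integral0T integral0_eq// => t _; rewrite subrr normr0 expr0n.
Qed.

Lemma regular_observation T f W : 0 < T -> regular_solution A T f W ->
  is_observation A B T f W (B \o W).
Proof.
move=> T0 rW; split; first exact/L2_continuous/(within_observation rW).
exists (fun=> f), (fun=> W); split=> //.
- by rewrite energyB0; exact: cvg_cst.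
- by rewrite integral0T0; exact: cvg_cst.
- by rewrite (integral0T0 T (B \o W)); exact: cvg_cst.
Qed.

Lemma within_energy T f W : regular_solution A T f W ->
  {within `[0, T], continuous (energy A 1 W)}.
Proof.
move=> [W2 [_ cW1' _] _]; have [_ cW1] := C0_Hspace_down eb (n := 0) isT cW1'.
have [_ c1] := C0_Hspace_down eb (n := 1) isT W2.
by apply: withinM; [exact: within_cst|apply: withinD; exact: within_sqr_norm].
Qed.

Lemma regular_energy_estimate T f W : 0 <= T -> regular_solution A T f W ->
  forall t, 0 <= t <= T -> energy A 1 W t <=
    expR T * (energy A 1 W 0 + 2^-1 * prim (fun s => `|f s| ^+ 2) T).
Proof.
move=> T0 rW t /andP[t0 tT]; have cf := regular_source_continuous eb rW.
have cf2 := within_sqr_norm cf.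
have W1 s : 0 <= s <= T -> Hspace A 1 (W s).1.
  by move=> sT; apply: Hspace21; case: rW => [[W2 _] _ _]; apply: W2; rewrite in_itv.
apply: le_trans (energy_estimate eb T0 cf (regular_coord eb rW) W1 _) _; first by rewrite t0.
have p0 : 0 <= prim (fun s => `|f s| ^+ 2) t by apply: prim_ge0 => s _; exact: sqr_ge0.
apply: ler_pM; rewrite ?expR_ge0 ?ler_expR// ?addr_ge0 ?energy1_ge0 ?mulr_ge0//.
rewrite lerD2l ler_pM2l//; exact: (prim_nondecreasing cf2).
Qed.

(** The energy estimate removes the energies at later times from the admissibility inequality. For
    zero data the observation is then controlled by the source alone, the form needed in both
    implications. *)
Lemma admissible_regular T : 0 < T -> admissible A B ->
  exists2 C, 0 < C & forall f W, regular_solution A T f W ->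
    prim (fun t => `|B (W t)| ^+ 2) T <=
    C * (energy A 1 W 0 + prim (fun t => `|f t| ^+ 2) T).
Proof.
move=> T0 /(_ T T0)[C C0 adm].
(* The four summands bound, in order, the energy at [0], the energy at [T], its integral and the
   source term. *)
exists (C * (1 + expR T + expR T * T + 1)).
  by rewrite mulr_gt0// !addr_gt0 ?mulr_gt0 ?expR_gt0.
move=> f W rW; have T0' := ltW T0; have cf := regular_source_continuous eb rW.
have W0 : Hspace A 1 (W 0).1.
  by apply: Hspace21; case: rW => [[W2 _] _ _]; apply: W2; rewrite in_itv/= lexx.
have := adm _ _ _ _ _ W0 (L2_continuous T0 cf) (regular_wave eb T0' rW)
  (regular_observation T0 rW).
rewrite !integral0T_prim; [|exact: within_sqr_norm|exact: within_energy rW|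
  exact/within_sqr_norm/(within_observation rW)].
rewrite -!EFinD -EFinM lee_fin => h; apply: le_trans h _.
have EE := regular_energy_estimate T0' rW.
set F := prim (fun t => `|f t| ^+ 2) T in EE *; set E0 := energy A 1 W 0 in EE *.
have F0 : 0 <= F by apply: prim_ge0 => s _; exact: sqr_ge0.
have E00 : 0 <= E0 by exact: energy1_ge0.
rewrite -mulrA ler_pM2l//.
have e0 := expR_gt0 T.
have ET := EE T; rewrite T0' lexx in ET; have {}ET := ET isT.
have EI : prim (energy A 1 W) T <= expR T * (E0 + 2^-1 * F) * T.
  apply: le_trans (ler_norm _) _.
  apply: (norm_prim_le T0' (within_energy rW)); last by rewrite T0' lexx.
  by move=> t tT; rewrite ger0_norm ?energy1_ge0// EE.
have hF : expR T * (E0 + 2^-1 * F) <= expR T * (E0 + F).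
  by rewrite ler_pM2l//; lra.
have hFT : expR T * (E0 + 2^-1 * F) * T <= expR T * (E0 + F) * T by rewrite ler_pM2r.
have -> : (1 + expR T + expR T * T + 1) * (E0 + F) =
  (E0 + F) + expR T * (E0 + F) + expR T * (E0 + F) * T + (E0 + F) by ring.
by lra.
Qed.

(** The data of a regular solution make the free wave with the same data regular too, so [B] can be
    subtracted pointwise in time. The difference has zero data and is bounded by admissibility. *)
Lemma observable_regular T (C1 : R) : 0 < T -> admissible A B ->
  (forall w0 w1 W (y : R -> G), Hspace A 1 w0 -> wave_solution A T (fun=> 0) w0 w1 W ->
     is_observation A B T (fun=> 0) W y ->
     ((C1 * energy A 1 W 0)%:E <= integral0T T (fun t => (`|y t| ^+ 2)%R))%E) ->
  exists2 C, 0 < C & forall f W, regular_solution A T f W ->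
    C1 * energy A 1 W 0 <= 2 * prim (fun t => `|B (W t)| ^+ 2) T +
      C * prim (fun t => `|f t| ^+ 2) T.
Proof.
move=> T0 adm obs; have [C C0 CP] := admissible_regular T0 adm.
have T0' := ltW T0.
exists (2 * C); first by rewrite mulr_gt0.
move=> f W rW; have z0 : 0 \in `[0, T] by rewrite in_itv/= lexx.
have W02 : Hspace A 2 (W 0).1 by case: rW => [[W2 _] _ _]; exact: W2.
have W01 : Hspace A 1 (W 0).2 by case: rW => [_ [_ [W2 _] _] _]; exact: W2.
have rF := free_regular eb T W02 W01.
set phi := free_wave A e mu (W 0).1 (W 0).2 in rF.
have phi0 : phi 0 = W 0 by rewrite /phi (free_wave0 eb _ (Hspace21 W02)); case: (W 0).
have rP := regularB eb rW rF.
have := CP _ _ rP; rewrite energy1E -/phi phi0 subrr.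
rewrite (proj2 (Hspace_0 eb (n := 1) isT)) normr0 expr0n addr0 mulr0 add0r => psi_le.
have wF := free_wave_solution eb (W 0).2 T0' (Hspace21 W02).
have := obs _ _ _ _ (Hspace21 W02) wF (regular_observation T0 rF).
have cphi := within_sqr_norm (within_observation rF).
have cW := within_sqr_norm (within_observation rW).
have cpsi := within_sqr_norm (within_observation rP).
rewrite integral0T_prim// lee_fin energy1E -/phi phi0 -energy1E => h.
apply: le_trans h _.
have f0 : (fun t => `|f t - 0| ^+ 2) = (fun t => `|f t| ^+ 2) :> (R -> R).
  by apply/funext => t; rewrite subr0.
rewrite f0 in psi_le.
have : prim (fun t => `|B (phi t)| ^+ 2) T <=
   2 * prim (fun t => `|B (W t)| ^+ 2) T + 2 * prim (fun t => `|B (W t - phi t)| ^+ 2) T.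
  rewrite -!primZ// -primD; last 2 first.
  - by apply: withinM => //; exact: within_cst.
  - by apply: withinM => //; exact: within_cst.
  apply: le_prim => //.
    by apply: withinD; apply: withinM => //; exact: within_cst.
  move=> t tT; have tT' : t \in `[0, T] by rewrite in_itv.
  rewrite observation_opB; first by rewrite [`|B (W t) - _|]distrC normD2_le_normed.
  - by case: rW => [[W2 _] _ _]; exact: W2.
  - by case: rF => [[W2 _] _ _]; exact: W2.
by move: psi_le; lra.
Qed.

(** The equation is autonomous, so the inequality is translated to start at [a]; its right side is
    then enlarged from the window to [[0, tau]], leaving the constants unchanged. *)
Lemma observable_window T (C1 C a tau : R) : 0 < T ->
  (forall f W, regular_solution A T f W ->
    C1 * energy A 1 W 0 <= 2 * prim (fun t => `|B (W t)| ^+ 2) T +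
      C * prim (fun t => `|f t| ^+ 2) T) -> 0 <= C ->
  0 <= a -> a + T <= tau ->
  forall f W, regular_solution A tau f W ->
    C1 * energy A 1 W a <= 2 * prim (fun t => `|B (W t)| ^+ 2) tau +
      C * prim (fun t => `|f t| ^+ 2) tau.
Proof.
move=> T0 obs C0 a0 atau f W rW; have T0' := ltW T0.
have rS := regular_shift a0 T0' atau rW.
have := obs _ _ rS; rewrite energy1E addr0 -energy1E => h; apply: le_trans h _.
have cW := within_sqr_norm (within_observation rW).
have cf := within_sqr_norm (regular_source_continuous eb rW).
have shift_le (g : R -> R) : {within `[0, tau], continuous g} -> (forall t, 0 <= g t) ->
    prim (fun t => g (a + t)) T <= prim g tau.
  move=> cg g0; rewrite (prim_shift a0 T0' atau cg).
  apply: le_trans (_ : prim g (a + T) <= _).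
    by rewrite gerBl; apply: prim_ge0.
  by apply: (prim_nondecreasing cg) => //; rewrite addr_ge0.
rewrite lerD//.
  rewrite ler_pM2l//; apply: (shift_le (fun t => `|B (W t)| ^+ 2)); first exact: cW.
  by move=> t; exact: sqr_ge0.
rewrite ler_wpM2l//; apply: (shift_le (fun t => `|f t| ^+ 2)); first exact: cf.
by move=> t; exact: sqr_ge0.
Qed.

Lemma regular_sub (T T' : R) f W : T' <= T -> regular_solution A T f W ->
  regular_solution A T' f W.
Proof.
move=> TT [W2 [C1 C2 dW] [ddw [[D1 D2 dD] eqn]]].
have sub t : t \in `[0, T'] -> t \in `[0, T].
  by rewrite !in_itv/= => /andP[-> t1]; exact: le_trans TT.
have csub (n : nat) (X : R -> H) : C0_Hspace A n T X -> C0_Hspace A n T' X.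
  by move=> [X1 cX]; split; [move=> t /sub/X1|exact: within_sub cX].
have ltsub t : 0 < t < T' -> 0 < t < T.
  by move=> /andP[-> t1]; exact: lt_le_trans TT.
split; [exact: csub|split; [exact: csub|exact: csub|by move=> t /ltsub/dW]|].
exists ddw; split; last by move=> t /sub/eqn.
by split; [exact: csub|exact: csub|move=> t /ltsub/dD].
Qed.

(* The approximating regular solutions in the definition of an observation stay
   close to the finite energy solution at every time. *)
Lemma observable_weak T (C1 C a tau Tf : R) : 0 < T -> 0 <= C1 -> 0 <= C ->
  (forall f W, regular_solution A T f W ->
    C1 * energy A 1 W 0 <= 2 * prim (fun t => `|B (W t)| ^+ 2) T +
      C * prim (fun t => `|f t| ^+ 2) T) ->
  0 <= a -> a + T <= tau -> tau <= Tf ->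
  forall f w0 w1 W (y : R -> G), {within `[0, Tf], continuous f} ->
    wave_solution A Tf f w0 w1 W -> is_observation A B Tf f W y ->
    C1 * energy A 1 W a <= 8 * fine (integral0T Tf (fun t => `|y t| ^+ 2)) +
      4 * C * prim (fun t => `|f t| ^+ 2) tau.
Proof.
move=> T0 C10 C0 obs a0 atau tauTf f w0 w1 W y cf sW [[my yfin] [f_ [W_ [rW_ h1 h2 h3]]]].
have aT : a <= tau by rewrite (le_trans _ atau)// lerDl ltW.
have Tf0 : 0 < Tf by rewrite (lt_le_trans _ tauTf)// (lt_le_trans _ atau)// ltr_wpDl.
have aTf : a <= Tf by rewrite (le_trans aT).
(* The approximation of [y], of [f] and of [W] each costs a factor two and an error. [K] sums the
   resulting coefficients of [eps]: 8 from [y], [4 * C] from the source, [3 * C1 * expR a] from the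
   energy at [a]. *)
have Tf0' := ltW Tf0; set K := 8 + 4 * C + 3 * C1 * expR a.
have K0 : 0 < K by rewrite /K -addrA ltr_pwDl// addr_ge0// !mulr_ge0// expR_ge0.
set D := prim _ tau; set Y := fine _.
apply/ler_addgt0Pr => eps' eps'0; pose eps := eps' / K.
have eps0 : 0 < eps by rewrite divr_gt0.
have YE : integral0T Tf (fun t => `|y t| ^+ 2) = Y%:E.
  rewrite /Y fineK// ge0_fin_numE//.
  by apply: integral_ge0 => t _; rewrite lee_fin sqr_ge0.
have cfn n := regular_source_continuous eb (rW_ n).
have cfd n : {within `[0, Tf], continuous (fun t => `|f_ n t - f t| ^+ 2)}.
  by apply: within_sqr_norm; apply: withinB => //; exact: cfn.
have n1 : \forall n \near \oo, energy A 1 (fun t => W_ n t - W t) 0 <= eps.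
  move/cvgrPdist_le : h1 => /(_ _ eps0); apply: filterS => n.
  by rewrite sub0r normrN; exact: le_trans (ler_norm _).
have n2 : \forall n \near \oo, prim (fun t => `|f_ n t - f t| ^+ 2) Tf <= eps.
  have /fine_cvgP[_ /cvgrPdist_le/(_ _ eps0)] := h2; apply: filterS => n.
  rewrite /= integral0T_prim//= sub0r normrN; exact: le_trans (ler_norm _).
have n3 : \forall n \near \oo, (integral0T Tf (fun t => (`|B (W_ n t) - y t| ^+ 2)%R) <= eps%:E)%E.
  have /fine_cvgP[fin_ /cvgrPdist_le/(_ _ eps0)] := h3; apply: filterS2 fin_ => n fin_n.
  rewrite /= sub0r normrN => le; rewrite -(fineK fin_n) lee_fin.
  exact: le_trans (ler_norm _) le.
have [n [[e1 e2] e3]] := filter_ex (filterI (filterI n1 n2) n3).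
have rW := rW_ n; have cBW := within_observation rW.
have cBW2 := within_sqr_norm cBW.
have s1 : prim (fun t => `|B (W_ n t)| ^+ 2) tau <= 2 * Y + 2 * eps.
  apply: (@le_trans _ _ (prim (fun t => `|B (W_ n t)| ^+ 2) Tf)).
    apply: (prim_nondecreasing cBW2) => //.
    by rewrite (le_trans a0).
  have := integral_normD2_le Tf0 (strongly_measurable_continuous Tf0 cBW) my.
  rewrite integral0T_prim// YE => h; rewrite -lee_fin; apply: le_trans h _.
  have -> : (2 * Y + 2 * eps)%:E = (2%:E * Y%:E + 2%:E * eps%:E)%E by [].
  by rewrite leeD2l// lee_pmul2l.
have cf2 := within_sub tauTf (within_sqr_norm cf).
have s2 : prim (fun t => `|f_ n t| ^+ 2) tau <= 2 * D + 2 * eps.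
  apply: (@le_trans _ _ (2 * D + 2 * prim (fun t => `|f_ n t - f t| ^+ 2) tau)); last first.
    rewrite lerD2l ler_pM2l//; apply: le_trans e2.
    by apply: (prim_nondecreasing (cfd n)) => //; rewrite (le_trans a0).
  have cfd' := within_sub tauTf (cfd n).
  rewrite /D -!primZ// -primD; last 2 first.
  - by apply: withinM => //; exact: within_cst.
  - by apply: withinM => //; exact: within_cst.
  apply: le_prim; first exact/(within_sub tauTf)/within_sqr_norm/cfn.
    by apply: withinD; apply: withinM => //; exact: within_cst.
  by move=> t _; exact: normD2_le_normed.
have s3 := observable_window T0 obs C0 a0 atau (regular_sub tauTf rW).
have cV := coord_solutionB (regular_coord eb rW) (wave_coord eb Tf0' cf sW).
have Wn1 t : 0 <= t <= Tf -> Hspace A 1 (W_ n t).1.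
  by move=> tT; apply: Hspace21; case: rW => [[W2 _] _ _]; apply: W2; rewrite in_itv.
have W1 t : 0 <= t <= Tf -> Hspace A 1 (W t).1.
  by move=> tT; case: sW => [[W2 _] _ _ _]; apply: W2; rewrite in_itv.
have aTf' : 0 <= a <= Tf by rewrite a0.
have s4 : energy A 1 (fun t => W_ n t - W t) a <= expR a * (eps + 2^-1 * eps).
  have V1 t : 0 <= t <= Tf -> Hspace A 1 (W_ n t - W t).1.
    by move=> tT; exact: (proj1 (Hspace_B eb (n := 1) isT (Wn1 t tT) (W1 t tT))).
  apply: le_trans (energy_estimate eb Tf0' _ cV V1 aTf') _.
    by apply: withinB => //; exact: cfn.
  rewrite ler_pM2l ?expR_gt0// lerD// ler_pM2l//; apply: le_trans e2.
  exact: (prim_nondecreasing (cfd n)).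
have s5 : energy A 1 W a <= 2 * energy A 1 (W_ n) a + 2 * energy A 1 (fun t => W_ n t - W t) a.
  rewrite !energy1E.
  have -> : half_power A 1 (W_ n a - W a).1 = half_power A 1 (W_ n a).1 - half_power A 1 (W a).1.
    exact: (proj2 (Hspace_B eb (n := 1) isT (Wn1 a aTf') (W1 a aTf'))).
  have := normD2_le_normed (half_power A 1 (W a).1) (half_power A 1 (W_ n a).1).
  have := normD2_le_normed (W a).2 (W_ n a).2.
  have -> : (W_ n a - W a).2 = (W_ n a).2 - (W a).2 by [].
  rewrite (distrC (W a).2) (distrC (half_power A 1 (W a).1)).
  by lra.
have -> : eps' = K * eps by rewrite /eps mulrC divfK// gt_eqF.
apply: le_trans (ler_wpM2l C10 s5) _.
have t1 : C1 * energy A 1 (fun t => W_ n t - W t) a <= C1 * (expR a * (eps + 2^-1 * eps)).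
  by rewrite ler_wpM2l.
have t2 : C * prim (fun t => `|f_ n t| ^+ 2) tau <= C * (2 * D + 2 * eps).
  by rewrite ler_wpM2l.
have -> : 8 * Y + 4 * C * D + K * eps = 2 * (2 * (2 * Y + 2 * eps) + C * (2 * D + 2 * eps)) +
   2 * (C1 * (expR a * (eps + 2^-1 * eps))) by rewrite /K; field.
rewrite mulrDr ![C1 * (2 * _)]mulrCA.
apply: lerD; last by rewrite ler_pM2l.
rewrite ler_pM2l//; apply: le_trans s3 _; apply: lerD => //.
by rewrite ler_pM2l.
Qed.

End Observation.

(** * The cascade system *)

Section Cascade.
Context {R : realType} {H : hilbertType R}.
Variables (A : operator H) (e : nat -> H) (mu : nat -> R) (m0 : R).
Hypothesis eb : eigenbasis A e mu m0.
Implicit Types (x y v w : H) (f : R -> H) (W V : R -> H * H) (s t T : R).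

Let eO := eigen_ortho eb.
Let eC := eigen_complete eb.

Local Notation free := (free_wave A e mu).

(** Conservation of the weak energy lets every observation window contribute the same multiple of
    the initial energy. *)
Lemma energy0_free u v t : Hspace A 1 u ->
  energy A 0 (free u v) t = energy A 0 (free u v) 0.
Proof.
move=> u1; rewrite !energy0E (free_wave0 eb)//=; congr (_ * _).
apply: (norm2D_coord eO eC) => k.
rewrite !(coord_inv_sqrt eb) (coord_free1 eb) (coord_free2 eb)//.
have := cos2Dsin2 (mu k * t); have muk : mu k != 0 by rewrite gt_eqF// (mu_gt0 eb).
set c := cos _; set s := sin _; set a := inner u _; set b := inner v _ => cs.
have -> : a ^+ 2 + ((mu k)^-1 * b) ^+ 2 =
  (c ^+ 2 + s ^+ 2) * (a ^+ 2 + ((mu k)^-1 * b) ^+ 2) by rewrite cs mul1r.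
by field.
Qed.

(* The solution [w = - A^(-1) u'] has velocity [w' = u]. *)
Lemma free_antiderivative u v s : Hspace A 1 u ->
  let w := - half_power A (- 1) (half_power A (- 1) (free u v s).2) in
  [/\ Hspace A 1 w,
      forall t, (free w (free u v s).1 t).2 = (free u v (s + t)).1 &
      energy A 1 (free w (free u v s).1) 0 = energy A 0 (free u v) s].
Proof.
move=> u1 w; have muk k : mu k != 0 by rewrite gt_eqF// (mu_gt0 eb).
have ww : coord_scaled e mu w (- half_power A (- 1) (free u v s).2).
  by move=> k; rewrite /w !innerNl !(coord_inv_sqrt eb); field.
have w1 : Hspace A 1 w by apply/(Hspace1P eb); eexists; exact: ww.
split => //.
  move=> t; apply: (coord_inj eC) => k.
  rewrite (coord_free2 eb)// !(coord_free1 eb) /w innerNl !(coord_inv_sqrt eb).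
  by rewrite (coord_free2 eb)// [mu k * (s + t)]mulrDr cosD sinD; field.
rewrite energy1E energy0E (free_wave0 eb)// (half1E eb ww) normrN.
by rewrite addrC.
Qed.

Lemma cos_op_le t x : `|cos_op e mu t x| <= `|x|.
Proof.
rewrite -[leRHS]mul1r; apply: (norm_diag_mul_le eO eC) => k.
exact: normr_cos_le1.
Qed.

Lemma sin_op_le t x : `|sin_op e mu t x| <= `|x|.
Proof.
rewrite -[leRHS]mul1r; apply: (norm_diag_mul_le eO eC) => k.
exact: normr_sin_le1.
Qed.

Lemma coord_truncB_cos t x n : cos_op e mu t x - coord_trunc e n (cos_op e mu t x) =
  cos_op e mu t (x - coord_trunc e n x).
Proof.
apply: (coord_inj eC) => k; rewrite innerBl coord_truncE// !(coord_cos_op eb).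
by rewrite innerBl coord_truncE//; ring.
Qed.

Lemma coord_truncB_sin t x n : sin_op e mu t x - coord_trunc e n (sin_op e mu t x) =
  sin_op e mu t (x - coord_trunc e n x).
Proof.
apply: (coord_inj eC) => k; rewrite innerBl coord_truncE// !(coord_sin_op eb).
by rewrite innerBl coord_truncE//; ring.
Qed.

Lemma coord_truncD x y n :
  coord_trunc e n (x + y) = coord_trunc e n x + coord_trunc e n y.
Proof.
apply: (coord_inj eC) => k; rewrite innerDl !coord_truncE// innerDl.
by rewrite mulrDr.
Qed.

(** The cosine and sine operators are contractions commuting with truncation, so the tails of the
    data bound the truncation error of a free wave at all times. *)
Definition trunc_error n x y : R :=
  `|x - coord_trunc e n x| + `|y - coord_trunc e n y|.

Lemma trunc_error_cvg x y : trunc_error n x y @[n --> \oo] --> 0.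
Proof.
have h z : `|z - coord_trunc e n z| @[n --> \oo] --> (0 : R).
  rewrite -(@normr0 _ H) -(subrr z); apply: cvg_norm.
  by apply: cvgB; [exact: cvg_cst|exact: (cvg_coord_trunc eO eC)].
by rewrite -[X in _ --> X]addr0; apply: cvgD; exact: h.
Qed.

Lemma free1_trunc u v n t :
  `|(free u v t).1 - coord_trunc e n (free u v t).1| <=
  trunc_error n u (half_power A (- 1) v).
Proof.
rewrite /= coord_truncD opprD addrACA coord_truncB_cos coord_truncB_sin.
apply: le_trans (ler_normD _ _) _; apply: lerD; first exact: cos_op_le.
exact: sin_op_le.
Qed.

Lemma free1_le u v t : `|(free u v t).1| <= `|u| + `|half_power A (- 1) v|.
Proof.
apply: le_trans (ler_normD _ _) _; apply: lerD; first exact: cos_op_le.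
exact: sin_op_le.
Qed.

Lemma within_free1 T u v : {within `[0, T], continuous (fun t => (free u v t).1)}.
Proof. by apply: withinD; [exact: within_cos_op eb _ _|exact: within_sin_op eb _ _]. Qed.

(** The symplectic form on phase space: being antisymmetric, it cancels the contributions of [A] to
    its derivative, and only the source remains. *)
Definition pairing (U1 U2 : R -> H * H) t : R :=
  inner (U1 t).2 (U2 t).1 - inner (U1 t).1 (U2 t).2.

(** Neither second derivative need exist in [H], so the identity is integrated for finite coordinate
    sums. Their derivatives converge uniformly in time by [free1_trunc] and the bound [F]. *)
Lemma pairing_derive T (F : R) f u v U2 : 0 <= T -> Hspace A 1 u ->
  {within `[0, T], continuous f} -> (forall t, 0 <= t <= T -> `|f t| <= F) ->
  coord_solution e mu T f U2 ->
  prim (fun t => - inner (f t) (free u v t).1) T =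
  pairing (free u v) U2 T - pairing (free u v) U2 0.
Proof.
move=> T0 u1 cf fF cU2; have F0 : 0 <= F.
  by apply: le_trans (fF 0 _); rewrite ?lexx.
have cU1 := free_coord eb T v u1.
set U1 := free u v in cU1 *.
pose Xn n t := \sum_(k < n) (inner (U1 t).2 (e k) * inner (U2 t).1 (e k)
   - inner (U1 t).1 (e k) * inner (U2 t).2 (e k)).
pose gn n t := - inner (f t) (coord_trunc e n (U1 t).1).
have gnE n t : gn n t = \sum_(k < n) - (inner (f t) (e k) * inner (U1 t).1 (e k)).
  by rewrite /gn inner_psum -sumrN; apply: eq_bigr => k _; rewrite mulrC.
have cXn n : {within `[0, T], continuous (Xn n)}.
  apply: (@within_sum _ _ _ n (fun k t => inner (U1 t).2 (e k) * inner (U2 t).1 (e k)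
   - inner (U1 t).1 (e k) * inner (U2 t).2 (e k))) => k.
  have [a1 a2 _ _] := cU1 k; have [b1 b2 _ _] := cU2 k.
  by apply: withinB; apply: withinM.
have cgn n : {within `[0, T], continuous (gn n)}.
  apply: (within_eq (f := fun t => \sum_(k < n) - (inner (f t) (e k) * inner (U1 t).1 (e k)))).
    by move=> t _; rewrite gnE.
  apply: (@within_sum _ _ _ n (fun k t => - (inner (f t) (e k) * inner (U1 t).1 (e k)))) => k.
  by apply: withinN; apply: withinM; [exact: within_coord|case: (cU1 k)].
have dXn n t : 0 < t < T -> is_derive t 1 (Xn n) (gn n t).
  move=> tT; rewrite gnE.
  apply: (@is_derive_sumE _ _ n (fun k t => inner (U1 t).2 (e k) * inner (U2 t).1 (e k)
   - inner (U1 t).1 (e k) * inner (U2 t).2 (e k)) _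
   (fun k => - (inner (f t) (e k) * inner (U1 t).1 (e k)))) => k.
  have [_ _ a3 a4] := cU1 k; have [_ _ b3 b4] := cU2 k.
  have := a3 _ tT => ?; have := a4 _ tT => ?; have := b3 _ tT => ?; have := b4 _ tT => ?.
  by apply: is_derive_eq; rewrite /GRing.scale/= inner0l; ring.
have E n : prim (gn n) T = Xn n T - Xn n 0.
  by rewrite (prim_FTC T0 (cgn n) (cXn n) (dXn n))// T0 lexx.
have cvX t : Xn n t @[n --> \oo] --> pairing U1 U2 t.
  rewrite /Xn; under eq_fun do rewrite sumrB.
  by apply: cvgB; exact: (cvg_coord_inner eO eC).
have cU : {within `[0, T], continuous (fun t => (U1 t).1)} by exact: within_free1.
have cg : {within `[0, T], continuous (fun t => - inner (f t) (U1 t).1 : R)}.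
  by apply: withinN; exact: within_inner.
have cvP : prim (gn n) T @[n --> \oo] --> prim (fun t => - inner (f t) (U1 t).1) T.
  apply/cvgrPdist_le => eps eps0.
  have d0 : 0 < eps / (F * T + 1) by rewrite divr_gt0// ltr_wpDl ?mulr_ge0.
  move/cvgrPdist_le : (@trunc_error_cvg u (half_power A (- 1) v)) => /(_ _ d0).
  apply: filterS => n; rewrite sub0r normrN ger0_norm ?addr_ge0// => le.
  have cB : {within `[0, T], continuous (fun t => - inner (f t) (U1 t).1 - gn n t)}.
    exact: withinB.
  have -> : prim (fun t => - inner (f t) (U1 t).1) T - prim (gn n) T =
     prim (fun t => - inner (f t) (U1 t).1 - gn n t) T.
    rewrite (primD cg (g := fun t => - gn n t)); last exact: withinN.
    have := primZ (-1) (cgn n); rewrite mulN1r => <-.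
    by congr (_ + prim _ _); apply/funext => t; rewrite mulN1r.
  have bnd t : 0 <= t <= T ->
      `|- inner (f t) (U1 t).1 - gn n t| <= F * (eps / (F * T + 1)).
    move=> tT; rewrite /gn opprK addrC -innerBr -[_ - _]opprB innerNr normrN.
    apply: le_trans (inner_le _ _) _; apply: ler_pM => //; first exact: fF.
    exact: le_trans (free1_trunc _ _ _ _) le.
  have TT : 0 <= T <= T by rewrite T0 lexx.
  apply: le_trans (norm_prim_le T0 cB bnd TT) _.
  rewrite mulrAC mulrA ler_pdivrMr ?ltr_wpDl ?mulr_ge0//.
  by rewrite mulrC ler_pM2l// lerDl.
have EE : (fun n => prim (gn n) T) = (fun n => Xn n T - Xn n 0) by apply/funext.
rewrite EE in cvP; rewrite -(cvg_lim _ cvP)//; apply: cvg_lim => //.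
exact: (cvgB (cvX T) (cvX 0)).
Qed.

(** Moving half a power of [A] across the product of [u1'] and [u2] pairs the weak energy of the
    first wave with the full energy of the second. *)
Lemma pairing_sqr_le u v U2 t : Hspace A 1 u -> Hspace A 1 (U2 t).1 ->
  pairing (free u v) U2 t ^+ 2 <=
  4 * energy A 0 (free u v) t * energy A 1 U2 t.
Proof.
move=> u1 U21; rewrite /pairing energy0E energy1E.
set p := (free u v t).1; set q := (free u v t).2.
have -> : inner q (U2 t).1 = inner (half_power A (- 1) q) (half_power A 1 (U2 t).1) :> R.
  apply: (inner_coord eO eC) => k; rewrite (coord_inv_sqrt eb) (coord_half1 eb U21).
  by rewrite mulrACA mulVf ?mul1r// gt_eqF// (mu_gt0 eb).
have h1 := inner_le (half_power A (- 1) q) (half_power A 1 (U2 t).1).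
have h2 := inner_le p (U2 t).2.
set x1 := inner _ _ in h1 *; set x2 := inner _ _ in h2 *.
set a := `|half_power A (- 1) q| in h1 *; set b := `|half_power A 1 _| in h1 *.
set c := `|p| in h2 *; set d := `|(U2 t).2| in h2 *.
have h : `|x1 - x2| <= a * b + c * d.
  by apply: le_trans (ler_normB _ _) _; exact: lerD.
rewrite -real_normK ?num_real//; apply: le_trans (_ : (a * b + c * d) ^+ 2 <= _).
  by rewrite ler_pXn2r ?nnegrE// addr_ge0 ?mulr_ge0 ?normr_ge0.
(* Lagrange's identity: the product of the two sums of squares exceeds the square by another
   square. *)
have -> : 4 * (2^-1 * (c ^+ 2 + a ^+ 2)) * (2^-1 * (b ^+ 2 + d ^+ 2)) =
  (a * b + c * d) ^+ 2 + (a * d - c * b) ^+ 2 by field.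
by rewrite lerDl sqr_ge0.
Qed.

End Cascade.

(** * From (II) to (I) *)

Section WaveToCascade.
Context {R : realType} {H G : hilbertType R}.
Variables (A : operator H) (e : nat -> H) (mu : nat -> R) (m0 : R).
Hypothesis eb : eigenbasis A e mu m0.
Variable B : H * H -> G.
Hypothesis Bop : observation_op A B.
Variable C21 : {linear H -> H}.
Hypothesis C21b : bounded_op C21.
Implicit Types (x y v w : H) (f : R -> H) (W V : R -> H * H) (s t T : R).

Let eO := eigen_ortho eb.
Let eC := eigen_complete eb.

Local Notation free := (free_wave A e mu).

Lemma bounded_op_le : exists2 M : R, 0 <= M & forall x, `|C21 x| <= M * `|x|.
Proof.
have [M CM] := C21b; exists `|M| => // x.
by apply: le_trans (CM x) _; rewrite ler_wpM2r// ler_norm.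
Qed.

Lemma within_bounded_op T (X : R -> H) : {within `[0, T], continuous X} ->
  {within `[0, T], continuous (fun t => C21 (X t))}.
Proof.
have [M M0 CM] := bounded_op_le.
by apply: (within_lipschitz (M := M)) => s t _ _; rewrite -linearB CM.
Qed.

Lemma velocity_observability_iter (c T : R) (N : nat) u v : 0 < T -> Hspace A 1 u ->
  (forall w0 w1 W, Hspace A 1 w0 -> wave_solution A T (fun=> 0) w0 w1 W ->
    ((c * energy A 1 W 0)%:E <= integral0T T (fun t => (`|C21 (W t).2| ^+ 2)%R))%E) ->
  N%:R * (c * energy A 0 (free u v) 0) <=
  prim (fun t => `|C21 (free u v t).1| ^+ 2) (N%:R * T).
Proof.
move=> T0 u1 obs; have T0' := ltW T0.
set g := fun t => _; have cg S : {within `[0, S], continuous g}.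
  exact/within_sqr_norm/within_bounded_op/(within_free1 eb).
elim: N => [|N IH]; first by rewrite !mul0r prim0.
set s := N%:R * T in IH; have s0 : 0 <= s by rewrite mulr_ge0.
have -> : N.+1%:R * T = s + T by rewrite -natr1 mulrDl mul1r.
rewrite -natr1 mulrDl mul1r.
have [w1 W2 We] := free_antiderivative eb v s u1.
have := obs _ _ _ w1 (free_wave_solution eb (free u v s).1 T0' w1).
rewrite We (energy0_free eb)//.
under [X in integral0T _ X]eq_fun do rewrite W2.
rewrite (integral0T_prim (f := fun t => g (s + t))); last first.
  exact: (within_shift s0 (addr_ge0 s0 T0') (lexx _) (cg (s + T))).
rewrite lee_fin (prim_shift s0 T0' (lexx _) (cg (s + T))) => h.
by move: IH h; lra.
Qed.

Lemma coord_solution_shift (a T T' : R) f W : 0 <= a -> 0 <= T' -> a + T' <= T ->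
  coord_solution e mu T f W ->
  coord_solution e mu T' (fun t => f (a + t)) (fun t => W (a + t)).
Proof.
move=> a0 T'0 aT cW k; have [a1 a2 a3 a4] := cW k.
have T0 : 0 <= T by rewrite (le_trans _ aT)// addr_ge0.
have tT t : 0 < t < T' -> 0 < a + t < T.
  by move=> /andP[t0 tT]; rewrite ltr_wpDl//= (lt_le_trans _ aT)// ltrD2l.
split=> [||t /tT ?|t /tT ?].
- exact: (within_shift a0 T0 aT a1).
- exact: (within_shift a0 T0 aT a2).
- by apply: (is_derive_shift (F := fun t => inner (W t).1 (e k))); exact: a3.
- by apply: (is_derive_shift (F := fun t => inner (W t).2 (e k))); exact: a4.
Qed.

(** Restarting at [a] makes the growth factor depend on the window length [T'] only; this keeps the
    constants of [absorption] independent of [N]. *)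
Lemma energy_estimate_window (a T T' : R) f W : 0 <= a -> 0 <= T' -> a + T' <= T ->
  {within `[0, T], continuous f} -> coord_solution e mu T f W ->
  (forall t, 0 <= t <= T -> Hspace A 1 (W t).1) ->
  energy A 1 W (a + T') <= expR T' *
    (energy A 1 W a + 2^-1 * prim (fun s => `|f s| ^+ 2) (a + T')).
Proof.
move=> a0 T'0 aT cf cW W1; have T0 : 0 <= T by rewrite (le_trans _ aT)// addr_ge0.
have cf2 := within_sqr_norm cf.
have TT : 0 <= T' <= T' by rewrite T'0 lexx.
have := energy_estimate eb T'0 (within_shift a0 T0 aT cf)
  (coord_solution_shift a0 T'0 aT cW) _ TT.
have W1' t : 0 <= t <= T' -> Hspace A 1 (W (a + t)).1.
  move=> /andP[t0 tT]; apply: W1; rewrite addr_ge0//=.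
  by rewrite (le_trans _ aT)// lerD2l.
move=> /(_ W1'); rewrite !energy1E addr0 => h; apply: le_trans h _.
rewrite ler_pM2l ?expR_gt0// lerD2l ler_pM2l//.
have := prim_shift a0 T'0 aT cf2 => /= ->.
by rewrite gerBl; apply: prim_ge0 => t _; exact: sqr_ge0.
Qed.

(** Here [Y] is the observation, [D] the integral of the squared source, [E0] the weak energy of
    [U1], [a0], [a1], [aN] the energies of [U2] at [0] and at the start and end of the last window,
    and [X0], [XN] the values of [pairing]. The window estimates give [S <= ca Y + cb D], and the
    pairing gives [D^2 <= 8 b^2 E0 S]. With [m E0 <= D] the latter becomes [m D <= 8 b^2 S], so for
    large [m = N c2] the term [cb D] is at most half of [S]. *)
Lemma absorption (c1 c2 C b E N Y D E0 a0 a1 aN X0 XN : R) :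
  0 < c1 -> 0 < c2 -> 0 <= C -> 0 <= E -> 0 < N -> 0 <= Y -> 0 <= D ->
  0 <= E0 -> 0 <= a0 -> 0 <= aN ->
  16 * b ^+ 2 * (4 * C / c1 * (1 + E) + E / 2) <= N * c2 ->
  c1 * a0 <= 8 * Y + 4 * C * D -> c1 * a1 <= 8 * Y + 4 * C * D ->
  aN <= E * (a1 + 2^-1 * D) -> N * (c2 * E0) <= D -> D <= b * (XN - X0) ->
  XN ^+ 2 <= 4 * E0 * aN -> X0 ^+ 2 <= 4 * E0 * a0 ->
  ((8 * b ^+ 2 / (N * c2) ^+ 2 + 1) * (2 * (8 / c1 * (1 + E))))^-1 * (E0 + a0) <= Y.
Proof.
move=> c10 c20 C0 E00' N0 Y0 D0 E00 a00 aN0 Nle h0 h1 hN hE hD hXN hX0.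
set ca := 8 / c1 * (1 + E); set cb := 4 * C / c1 * (1 + E) + E / 2.
set S := a0 + aN; set m := N * c2.
have m_gt0 : 0 < m by rewrite mulr_gt0.
have ca0 : 0 < ca by rewrite mulr_gt0 ?divr_gt0// ltr_pwDl.
have cb0 : 0 <= cb by rewrite addr_ge0 ?mulr_ge0 ?invr_ge0 ?addr_ge0 ?(ltW c10).
have a0_le : a0 <= (8 * Y + 4 * C * D) / c1 by rewrite ler_pdivlMr// mulrC.
have a1_le : a1 <= (8 * Y + 4 * C * D) / c1 by rewrite ler_pdivlMr// mulrC.
have S_le : S <= ca * Y + cb * D.
  have -> : ca * Y + cb * D = (8 * Y + 4 * C * D) / c1 +
    E * ((8 * Y + 4 * C * D) / c1 + 2^-1 * D) by rewrite /ca /cb; field; rewrite gt_eqF.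
  rewrite lerD//; apply: le_trans hN _; rewrite ler_wpM2l// lerD2r.
  exact: a1_le.
have S0 : 0 <= S by rewrite addr_ge0.
have D2 : D ^+ 2 <= 8 * b ^+ 2 * E0 * S.
  apply: (@le_trans _ _ ((b * (XN - X0)) ^+ 2)).
    by rewrite ler_pXn2r ?nnegrE// (le_trans D0).
  rewrite exprMn; have -> : 8 * b ^+ 2 * E0 * S = b ^+ 2 * (2 * (4 * E0 * aN) + 2 * (4 * E0 * a0)).
    by rewrite /S; ring.
  rewrite ler_wpM2l ?sqr_ge0//.
  have := sqr_ge0 (XN + X0); rewrite sqrrB sqrrD; lra.
have b20 : 0 <= 8 * b ^+ 2 by rewrite mulr_ge0// sqr_ge0.
(* Multiply the quadratic bound by [m], replace [m E0] by [D], and divide by [D]. *)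
have mD : m * D <= 8 * b ^+ 2 * S.
  have [->|Dn] := eqVneq D 0; first by rewrite mulr0 mulr_ge0.
  have Dp : 0 < D by rewrite lt_neqAle eq_sym Dn.
  rewrite -(ler_pM2r Dp) -[leLHS]mulrA -expr2.
  apply: le_trans (ler_wpM2l (ltW m_gt0) D2) _.
  have -> : m * (8 * b ^+ 2 * E0 * S) = 8 * b ^+ 2 * S * (N * (c2 * E0)) by rewrite /m; ring.
  by rewrite ler_wpM2l// mulr_ge0.
have cbD : cb * D <= 2^-1 * S.
  rewrite -(ler_pM2l m_gt0).
  apply: (@le_trans _ _ (cb * (8 * b ^+ 2 * S))).
    by rewrite mulrCA ler_wpM2l.
  have -> : cb * (8 * b ^+ 2 * S) = (16 * b ^+ 2 * cb) * (2^-1 * S) by field.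
  by rewrite ler_wpM2r// mulr_ge0.
have SY : S <= 2 * ca * Y.
  by rewrite -mulrA; move: S_le cbD; lra.
have E0_le : E0 <= 8 * b ^+ 2 / m ^+ 2 * S.
  rewrite mulrAC ler_pdivlMr ?exprn_gt0// expr2.
  apply: le_trans mD; have -> : E0 * (m * m) = m * (N * (c2 * E0)) by rewrite /m; ring.
  by rewrite ler_pM2l.
have K0 : 0 < 8 * b ^+ 2 / m ^+ 2 + 1.
  by rewrite ltr_wpDl// mulr_ge0// invr_ge0 sqr_ge0.
rewrite ler_pdivrMl; last by rewrite mulr_gt0// mulr_gt0.
apply: (@le_trans _ _ ((8 * b ^+ 2 / m ^+ 2 + 1) * S)).
  by rewrite mulrDl mul1r lerD// /S lerDl.
by rewrite -[leRHS]mulrA ler_pM2l.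
Qed.

Variable beta : R.
Hypothesis C21_beta : forall w, `|C21 w| ^+ 2 <= beta * inner (C21 w) w.

Lemma wave_to_cascade : admissible A B ->
  wave_observability A B C21 -> cascade_observability A B C21.
Proof.
move=> adm [T0 T00 obs]; pose Ts := T0 + 1.
have Ts0 : 0 < Ts by rewrite addr_gt0.
have [|c1 [c2 [c10 c20 {}obs]]] := obs Ts; first by rewrite ltrDl.
have obs2 w0 w1 W : Hspace A 1 w0 -> wave_solution A Ts (fun=> 0) w0 w1 W ->
    ((c2 * energy A 1 W 0)%:E <= integral0T Ts (fun t => (`|C21 (W t).2| ^+ 2)%R))%E.
  by move=> w01 sW; have [] := obs w0 w1 W w01 sW.
have obs1 w0 w1 W (y : R -> G) : Hspace A 1 w0 -> wave_solution A Ts (fun=> 0) w0 w1 W ->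
     is_observation A B Ts (fun=> 0) W y ->
     ((c1 * energy A 1 W 0)%:E <= integral0T Ts (fun t => (`|y t| ^+ 2)%R))%E.
  by move=> w01 sW; have [_] := obs w0 w1 W w01 sW; exact.
have [C C0 obsr] := observable_regular eb Bop Ts0 adm obs1.
pose E := expR Ts; pose cb := 4 * C / c1 * (1 + E) + E / 2.
(* [cb] does not involve [N], so this many windows can be chosen in advance to meet the threshold of
   [absorption]; [N * Ts] then serves as the time in (I). *)
pose N := (Num.truncn (16 * beta ^+ 2 * cb / c2)).+1.
have N0 : 0 < N%:R :> R by rewrite ltr0n.
have Nle : 16 * beta ^+ 2 * cb <= N%:R * c2.
  by rewrite -ler_pdivrMr//; apply/ltW/truncnS_gt.
exists (N%:R * Ts); first by rewrite mulr_gt0.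
move=> T TN; have T_gt0 : 0 < T by apply: lt_trans TN; rewrite mulr_gt0.
have T_ge0 := ltW T_gt0.
exists ((8 * beta ^+ 2 / (N%:R * c2) ^+ 2 + 1) * (2 * (8 / c1 * (1 + E))))^-1.
  rewrite invr_gt0 mulr_gt0//.
    by rewrite ltr_wpDl// mulr_ge0 ?invr_ge0 ?sqr_ge0// mulr_ge0// sqr_ge0.
  by rewrite !mulr_gt0 ?invr_gt0// ltr_wpDr ?expR_ge0.
move=> u10 u20 u11 u21 U1 U2 y u101 u201 [sU1 sU2] obsy.
have U1E := wave_unique eb T_ge0 u101 sU1.
have U10 : U1 0 = free u10 u11 0 by apply: U1E; rewrite lexx.
set f := fun t => - C21 (U1 t).1 in sU2 obsy.
have fE t : 0 <= t <= T -> f t = - C21 (free u10 u11 t).1 by move=> /U1E; rewrite /f => ->.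
have cu T' : {within `[0, T'], continuous (fun t => (free u10 u11 t).1)}.
  exact: (within_free1 eb).
have cf : {within `[0, T], continuous f}.
  apply: (within_eq (f := fun t => - C21 (free u10 u11 t).1)).
    by move=> t; rewrite /= in_itv/= => /fE.
  exact/withinN/within_bounded_op/cu.
pose tau := N%:R * Ts.
have tauT : tau <= T by exact: ltW.
have tau0 : 0 <= tau by rewrite mulr_ge0// ltW.
pose D := prim (fun t => `|f t| ^+ 2) tau.
have DE : D = prim (fun t => `|C21 (free u10 u11 t).1| ^+ 2) tau.
  apply: eq_Rintegral => t; rewrite inE/= in_itv/= => /andP[t0 tt].
  by rewrite fE ?normrN// t0 (le_trans tt).
have D0 : 0 <= D by apply: prim_ge0 => t _; exact: sqr_ge0.
have [[U21 _] _ U20 _] := sU2.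
have U21' t : 0 <= t <= T -> Hspace A 1 (U2 t).1 by move=> tT; apply: U21; rewrite in_itv.
have cU2 := wave_coord eb T_ge0 cf sU2.
have [[my yfin] _] := obsy.
set Y := fine (integral0T T (fun t => `|y t| ^+ 2)).
have YE : integral0T T (fun t => `|y t| ^+ 2) = Y%:E.
  rewrite /Y fineK// ge0_fin_numE//.
  by apply: integral_ge0 => t _; rewrite lee_fin sqr_ge0.
rewrite YE lee_fin.
have Y0 : 0 <= Y by rewrite fine_ge0//; apply: integral_ge0 => t _; rewrite lee_fin sqr_ge0.
have tauE : tau = N.-1%:R * Ts + Ts.
  have NE : N%:R = N.-1%:R + 1 :> R by rewrite natr1.
  by rewrite /tau NE mulrDl mul1r.
have last0 : 0 <= N.-1%:R * Ts by rewrite mulr_ge0// ltW.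
have Ts_tau : 0 + Ts <= tau by rewrite add0r tauE lerDr.
have E0E : energy A 0 U1 0 = energy A 0 (free u10 u11) 0 by rewrite !energy0E U10.
rewrite E0E.
have E0t t := energy0_free eb u11 t u101.
pose X := pairing (free u10 u11) U2.
have hX t : 0 <= t <= T -> X t ^+ 2 <= 4 * energy A 0 (free u10 u11) 0 * energy A 1 U2 t.
  by move=> tT; rewrite -(E0t t); apply: (pairing_sqr_le eb) => //; exact: U21'.
have hD : D <= beta * (X tau - X 0).
  have [M M0 CM] := bounded_op_le.
  have fF t : 0 <= t <= tau -> `|f t| <= M * (`|u10| + `|half_power A (- 1) u11|).
    move=> /andP[t0 tt]; rewrite fE ?t0 ?(le_trans tt)// normrN.
    by apply: le_trans (CM _) _; rewrite ler_wpM2l// (free1_le eb).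
  have cU2' : coord_solution e mu tau f U2.
    move=> k; have [a1 a2 a3 a4] := cU2 k.
    have sub t : 0 < t < tau -> 0 < t < T by move=> /andP[-> tt]; exact: lt_le_trans tauT.
    by split=> [||t /sub/a3|t /sub/a4]//; exact: within_sub tauT _.
  have cf' := within_sub tauT cf.
  rewrite -(pairing_derive eb u11 tau0 u101 cf' fF cU2') -primZ.
    apply: le_prim; first exact: within_sqr_norm.
      apply: withinM; first exact: within_cst.
      by apply: withinN; apply: within_inner.
    (* The minus sign of the source turns the pairing derivative into the product of [C21 u1] with
       [u1], to which the coercivity of [C21] applies pointwise. *)
    move=> t /andP[t0 tt]; rewrite fE ?t0 ?(le_trans tt)// normrN innerNl opprK.
    exact: C21_beta.
  by apply: withinN; apply: within_inner.
have zT : 0 <= (0 : R) <= T by rewrite lexx T_ge0.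
have tT : 0 <= tau <= T by rewrite tau0.
apply: (absorption (C := C) (D := D) (a1 := energy A 1 U2 (N.-1%:R * Ts))
  (aN := energy A 1 U2 tau) (X0 := X 0) (XN := X tau) (b := beta) (N := N%:R) c10 c20) => //.
- exact: ltW.
- exact: expR_ge0.
- by rewrite energy0E mulr_ge0 ?invr_ge0 ?addr_ge0 ?sqr_ge0.
- exact: energy1_ge0.
- exact: energy1_ge0.
- exact: (observable_weak eb Bop Ts0 (ltW c10) (ltW C0) obsr (lexx 0) Ts_tau tauT cf sU2 obsy).
- apply: (observable_weak eb Bop Ts0 (ltW c10) (ltW C0) obsr last0 _ tauT cf sU2 obsy).
  by rewrite tauE.
- rewrite {1}tauE /D tauE; apply: (energy_estimate_window last0 (ltW Ts0) _ cf cU2 U21').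
  by rewrite -tauE.
- rewrite DE; exact: (velocity_observability_iter N u11 Ts0 u101 obs2).
- exact: hX.
- exact: hX.
Qed.

End WaveToCascade.

(** * From (I) to (II) *)

Section CascadeToWave.
Context {R : realType} {H G : hilbertType R}.
Variables (A : operator H) (e : nat -> H) (mu : nat -> R) (m0 : R).
Hypothesis eb : eigenbasis A e mu m0.
Variable B : H * H -> G.
Hypothesis Bop : observation_op A B.
Variable C21 : {linear H -> H}.
Hypothesis C21b : bounded_op C21.
Implicit Types (x y v w : H) (f : R -> H) (W V : R -> H * H) (s t T : R).

Let eO := eigen_ortho eb.
Let eC := eigen_complete eb.

Local Notation free := (free_wave A e mu).
Local Notation trunc := (coord_trunc e).

Lemma Hspace2_trunc n x : Hspace A 2 (trunc n x).
Proof. by apply/(Hspace2P eb); eexists; exact: coord_scaled_trunc. Qed.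

Lemma half1_trunc n x : Hspace A 1 x ->
  half_power A 1 (trunc n x) = trunc n (half_power A 1 x).
Proof.
move=> x1; apply: (half1E eb) => k.
by rewrite !coord_truncE// (coord_half1 eb x1) mulrCA.
Qed.

(** The velocity of a free wave is a free wave with data [(v, - A u)], the inverse of the shift in
    [free_antiderivative]. It needs smoother data, which truncation provides. *)
Lemma free_velocity u v t : Hspace A 2 u -> Hspace A 1 v ->
  (free v (- half_power A 2 u) t).1 = (free u v t).2.
Proof.
move=> u2 v1; apply: (coord_inj eC) => k.
have u1 := Hspace21 u2; rewrite (coord_free1 eb) (coord_free2 eb)// innerNl (coord_half2 eb u2).
by field; rewrite gt_eqF// (mu_gt0 eb).
Qed.

Lemma energy_velocity u v : Hspace A 2 u -> Hspace A 1 v ->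
  energy A 0 (free v (- half_power A 2 u)) 0 = energy A 1 (free u v) 0.
Proof.
move=> u2 v1.
have inv : half_power A (- 1) (- half_power A 2 u) = - half_power A 1 u.
  apply: (inv_sqrtE eb) => k.
  rewrite !innerNl (coord_half1 eb (Hspace21 u2)) (coord_half2 eb u2).
  by field; rewrite gt_eqF// (mu_gt0 eb).
have u1 := Hspace21 u2; rewrite energy0E energy1E !(free_wave0 eb)// inv normrN.
by rewrite addrC.
Qed.

(** The source is a finite sum of scalar trigonometric functions times the fixed vectors
    [C21 (e k)], so [duhamel_regular] applies term by term with no more than membership of these
    vectors in [H]. *)
Lemma trunc_source T n u v : 0 <= T -> Hspace A 1 u ->
  exists2 U, regular_solution A T (fun t => - C21 (free (trunc n u) (trunc n v) t).2) U
    & U 0 = 0.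
Proof.
move=> T0 u1.
pose a k t := - (sin (mu k * t) * (mu k * inner u (e k))) + cos (mu k * t) * inner v (e k).
pose da k t := - (mu k * cos (mu k * t) * (mu k * inner u (e k)))
   - mu k * sin (mu k * t) * inner v (e k).
have freeE t : (free (trunc n u) (trunc n v) t).2 = psum e (fun k => a k t) n.
  apply: (coord_inj eC) => k; rewrite (coord_free2 eb); last exact/Hspace21/Hspace2_trunc.
  rewrite !coord_truncE// coord_psum//.
  have hu := coord_idem eO u k; have hv := coord_idem eO v k.
  (* The squared norm is distributed onto the coordinates, where [coord_idem] absorbs it, zero
     vectors included. *)
  have -> : a k t * `|e k| ^+ 2 = - (sin (mu k * t) * (mu k * (inner u (e k) * `|e k| ^+ 2))) +
     cos (mu k * t) * (inner v (e k) * `|e k| ^+ 2) by rewrite /a; ring.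
  by rewrite hu hv; ring.
have ex k : exists U : R -> H * H,
    regular_solution A T (fun t => a k t *: - C21 (e k)) U /\ U 0 = 0.
  have muk := mu_gt0 eb k.
  pose m := mu k * `|inner u (e k)| + `|inner v (e k)|.
  have m_ge0 : 0 <= m by rewrite addr_ge0// mulr_ge0// ltW.
  have bnd (c s : R) : `|c| <= 1 -> `|s| <= 1 ->
      `|c * (mu k * inner u (e k)) + s * inner v (e k)| <= m.
    move=> c1 s1; apply: le_trans (ler_normD _ _) _; apply: lerD.
      rewrite 2!normrM (gtr0_norm muk) -[leRHS]mul1r.
      by apply: ler_pM => //; rewrite mulr_ge0// ltW.
    by rewrite normrM -[leRHS]mul1r; exact: ler_pM.
  (* [m] bounds the coefficient and [mu k * m] its derivative; their sum serves as the single bound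
     required. *)
  have [||||U rU U0] := @duhamel_regular R H A e mu m0 eb T (m + mu k * m) (a k) (da k)
    (- C21 (e k)) T0; last by exists U.
  - move=> t; have := is_derive_cos_scale (mu k) t => ?.
    have := is_derive_sin_scale (mu k) t => ?.
    by apply: is_derive_eq; rewrite /GRing.scale/= /da; ring.
  - have cc : continuous (fun s => cos (mu k * s)).
      move=> s; apply/differentiable_continuous/derivable1_diffP.
      by have [] := is_derive_cos_scale (mu k) s.
    have cs : continuous (fun s => sin (mu k * s)).
      move=> s; apply/differentiable_continuous/derivable1_diffP.
      by have [] := is_derive_sin_scale (mu k) s.
    move=> t; apply: cvgB.
      apply: cvgN; apply: cvgM; last exact: cvg_cst.
      by apply: cvgM; [exact: cvg_cst|exact: cc].
    apply: cvgM; last exact: cvg_cst.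
    by apply: cvgM; [exact: cvg_cst|exact: cs].
  - move=> t; apply: le_trans (_ : m <= _); last by rewrite lerDl mulr_ge0// ltW.
    by rewrite /a -mulNr bnd ?normrN ?normr_cos_le1 ?normr_sin_le1.
  - move=> t; apply: le_trans (_ : mu k * m <= _); last by rewrite lerDr.
    have -> : da k t = mu k * (- cos (mu k * t) * (mu k * inner u (e k))
        + - sin (mu k * t) * inner v (e k)) by rewrite /da; ring.
    rewrite normrM gtr0_norm// ler_pM2l//.
    by rewrite bnd ?normrN ?normr_cos_le1 ?normr_sin_le1.
have [U UP] := choice ex.
have := regular_sum eb n (fun k => proj1 (UP k)) => rU.
exists (fun t => \sum_(k < n) U k t).
  suff <- : (fun t => \sum_(k < n) a k t *: - C21 (e k)) =
      (fun t => - C21 (free (trunc n u) (trunc n v) t).2) by [].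
  apply/funext => t; rewrite freeE /psum linear_sum -sumrN; apply: eq_bigr => k _.
  by rewrite linearZ/= scalerN.
by apply: big1 => k _; exact: (proj2 (UP k)).
Qed.

Lemma free2_trunc u v n t : Hspace A 1 u ->
  `|(free (trunc n u) (trunc n v) t).2 - (free u v t).2| <=
  trunc_error e n (half_power A 1 u) v.
Proof.
move=> u1; rewrite -normrN opprB.
have -> : (free u v t).2 - (free (trunc n u) (trunc n v) t).2 =
   - sin_op e mu t (half_power A 1 u - trunc n (half_power A 1 u)) +
     cos_op e mu t (v - trunc n v).
  apply: (coord_inj eC) => k.
  have tu1 : Hspace A 1 (trunc n u) := Hspace21 (Hspace2_trunc n u).
  rewrite innerBl (coord_free2 eb v t k u1) (coord_free2 eb (trunc n v) t k tu1).
  rewrite innerDl innerNl (coord_sin_op eb) (coord_cos_op eb) !innerBl.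
  by rewrite !coord_truncE// (coord_half1 eb u1); ring.
apply: le_trans (ler_normD _ _) _; rewrite normrN.
by apply: lerD; [exact: (sin_op_le eb)|exact: (cos_op_le eb)].
Qed.

Lemma within_free2 T u v : {within `[0, T], continuous (fun t => (free u v t).2)}.
Proof.
apply: withinD; last exact: (within_cos_op eb).
by apply: withinN; exact: (within_sin_op eb).
Qed.

Lemma cascade_to_wave : admissible A B ->
  cascade_observability A B C21 -> wave_observability A B C21.
Proof.
move=> adm [T3 T30 obs]; exists T3 => // T T3T.
have T_gt0 : 0 < T by exact: lt_trans T3T.
have T_ge0 := ltW T_gt0; have [C C0 {}obs] := obs T T3T.
have [Ca Ca0 admr] := admissible_regular eb Bop T_gt0 adm.
have [M M0 CM] := bounded_op_le C21b.
have h20 : Hspace A 2 (0 : H) := proj1 (Hspace_0 eb (n := 2) isT).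
have h10 : Hspace A 1 (0 : H) := Hspace21 h20.
(* [C] comes from (I) and [Ca] from admissibility. The factor four collects two applications of the
   squared triangle inequality, one when truncating the energy and one when truncating the
   velocity. *)
exists C, (C / (4 * Ca)); split => //; first by rewrite divr_gt0// mulr_gt0.
move=> w0 w1 W w01 sW; have WE := wave_unique eb T_ge0 w01 sW.
have W0E : W 0 = free w0 w1 0 by apply: WE; rewrite lexx.
split; last first.
  (* With [Z] as first component the coupling vanishes and (I) speaks of a free second component. *)
  move=> y obsy; pose Z := fun _ : R => (0 : H * H).
  have Zf : (fun t => - C21 (Z t).1) = fun=> 0 by apply/funext => t; rewrite linear0 oppr0.
  have sZ : wave_solution A T (fun=> 0) 0 0 Z.
    exact: (regular_wave eb T_ge0 (regular0 eb T)).
  have := obs 0 w0 0 w1 Z W y h10 w01.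
  rewrite /cascade_solution Zf => /(_ (conj sZ sW) obsy).
  suff -> : energy A 0 Z 0 = 0 by rewrite add0r.
  rewrite energy0E (inv_sqrtE eb (z := 0)).
    by rewrite !normr0 !expr0n addr0 mulr0.
  by move=> k; rewrite inner0l mulr0.
pose g t := `|C21 (free w0 w1 t).2| ^+ 2.
have cg : {within `[0, T], continuous g}.
  exact/within_sqr_norm/(within_bounded_op C21b)/within_free2.
have -> : integral0T T (fun t => `|C21 (W t).2| ^+ 2) = (prim g T)%:E.
  rewrite -integral0T_prim//; apply: eq_integral => t; rewrite inE/= in_itv/= => tT.
  by rewrite WE.
have -> : energy A 1 W 0 = energy A 1 (free w0 w1) 0 by rewrite !energy1E W0E.
rewrite lee_fin mulrAC ler_pdivrMr ?mulr_gt0//.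
set E := energy A 1 _ 0; set P := prim g T.
pose d n := trunc_error e n (half_power A 1 w0) w1.
pose En n := energy A 1 (free (trunc n w0) (trunc n w1)) 0.
(* (I) is applied with [u1] equal to the velocity of the truncated free wave and zero data for [u2].
   The weak energy of [u1] is the energy [En n], and the observation of [u2] is bounded by its
   source. *)
have obsn n : C * En n <= Ca * prim (fun t => `|C21 (free (trunc n w0) (trunc n w1) t).2| ^+ 2) T.
  have [U rU U0] := trunc_source n w1 T_ge0 w01.
  pose a := trunc n w0; pose b := trunc n w1.
  have a2 : Hspace A 2 a := Hspace2_trunc n w0.
  have b1 : Hspace A 1 b := Hspace21 (Hspace2_trunc n w1).
  have sU1 := free_wave_solution eb (- half_power A 2 a) T_ge0 b1.
  have fE : (fun t => - C21 (free b (- half_power A 2 a) t).1) =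
      (fun t => - C21 (free a b t).2).
    by apply/funext => t; rewrite free_velocity.
  have sU2 := regular_wave eb T_ge0 rU; rewrite U0 in sU2.
  have := obs b 0 (- half_power A 2 a) 0 _ U (B \o U) b1 h10.
  move=> /(_ (free b (- half_power A 2 a))).
  rewrite /cascade_solution fE => /(_ (conj sU1 sU2) (regular_observation eb Bop T_gt0 rU)).
  have eU : energy A 1 U 0 = 0.
    rewrite energy1E U0 (proj2 (Hspace_0 eb (n := 1) isT)).
    by rewrite normr0 expr0n addr0 mulr0.
  rewrite energy_velocity// eU addr0.
  rewrite integral0T_prim; last exact/within_sqr_norm/(within_observation eb Bop rU).
  rewrite lee_fin => h; apply: le_trans h _; apply: le_trans (admr _ _ rU) _.
  rewrite eU add0r ler_pM2l// /prim le_eqVlt; apply/orP; left; apply/eqP.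
  by apply: eq_Rintegral => t _; rewrite normrN.
have En_le n : E <= 2 * En n + d n ^+ 2.
  rewrite /E /En !energy1E !(free_wave0 eb)//; last exact/Hspace21/Hspace2_trunc.
  rewrite half1_trunc//.
  set x := half_power A 1 w0; rewrite /d /trunc_error -/x.
  have := normD2_le_normed x (trunc n x); have := normD2_le_normed w1 (trunc n w1).
  set p := `|x - _|; set q := `|w1 - _|.
  have : 0 <= p * q by rewrite /p /q mulr_ge0.
  rewrite [(w0, w1).2]/= [(trunc n w0, trunc n w1).2]/= sqrrD; lra.
have prim_le n : prim (fun t => `|C21 (free (trunc n w0) (trunc n w1) t).2| ^+ 2) T <=
    2 * P + 2 * (M * d n) ^+ 2 * T.
  have cc : {within `[0, T], continuous (fun=> 2 * (M * d n) ^+ 2)} by exact: within_cst.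
  have cn : {within `[0, T], continuous
      (fun t => `|C21 (free (trunc n w0) (trunc n w1) t).2| ^+ 2)}.
    exact/within_sqr_norm/(within_bounded_op C21b)/within_free2.
  have c2g : {within `[0, T], continuous (fun t => 2 * g t)}.
    by apply: withinM => //; exact: within_cst.
  apply: (@le_trans _ _ (prim (fun t => 2 * g t + 2 * (M * d n) ^+ 2) T)).
    apply: le_prim => //; first exact: withinD.
    move=> t _; apply: le_trans (normD2_le_normed _ (C21 (free w0 w1 t).2)) _.
    rewrite lerD2l ler_pM2l// ler_pXn2r ?nnegrE ?mulr_ge0 ?addr_ge0//.
    rewrite -linearB; apply: le_trans (CM _) _; rewrite ler_wpM2l//.
    exact: free2_trunc.
  rewrite (primD c2g cc) (primZ _ cg) lerD2l.
  apply: le_trans (ler_norm _) _.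
  have TT : 0 <= T <= T by rewrite T_ge0 lexx.
  apply: (norm_prim_le T_ge0 cc _ TT) => t _.
  by rewrite ger0_norm// mulr_ge0// sqr_ge0.
(* The total coefficient of the truncation error [d n ^+ 2], which tends to zero. *)
pose K := 4 * Ca * M ^+ 2 * T + C.
have K0 : 0 < K by rewrite ltr_wpDl// !mulr_ge0// ltW.
have main n : C * E <= P * (4 * Ca) + K * d n ^+ 2.
  apply: le_trans (ler_wpM2l (ltW C0) (En_le n)) _.
  have h1 := obsn n.
  have h2 := ler_wpM2l (ltW Ca0) (prim_le n).
  have h3 := le_trans h1 h2.
  have -> : C * (2 * En n + d n ^+ 2) = 2 * (C * En n) + C * d n ^+ 2 by ring.
  have -> : P * (4 * Ca) + K * d n ^+ 2 =
     2 * (Ca * (2 * P + 2 * (M * d n) ^+ 2 * T)) + C * d n ^+ 2 by rewrite /K; ring.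
  by rewrite lerD2r ler_pM2l.
apply/ler_addgt0Pr => eps eps0.
have d0 : d n ^+ 2 @[n --> \oo] --> (0 : R).
  rewrite -(mulr0 0); under eq_fun do rewrite expr2.
  by apply: cvgM; exact: (trunc_error_cvg eb).
move/cvgrPdist_le : d0 => /(_ _ (divr_gt0 eps0 K0))[n _ /(_ n (leqnn n)) /=].
rewrite sub0r normrN ger0_norm ?sqr_ge0// => dn.
apply: le_trans (main n) _; rewrite lerD2l.
by rewrite mulrC -ler_pdivlMr.
Qed.

End CascadeToWave.

Theorem corollary2p9 (R : realType) (H G : hilbertType R)
    (A : operator H) (omega : R) (B : H * H -> G)
    (C21 : {linear H -> H}) (beta : R) :
  self_adjoint A -> positive_operator A -> compact_resolvent A ->
  0 < omega -> (forall u, dom A u -> omega * `|u| <= `|A u|) ->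
  observation_op A B -> admissible A B ->
  bounded_op C21 -> opnorm C21 = beta ->
  (forall k : nat, (k <= 1)%N -> bounded_on_Hspace A k (adjoint C21)) ->
  (forall w, `|C21 w| ^+ 2 <= beta * inner (C21 w) w) ->
  cascade_observability A B C21 <-> wave_observability A B C21.
Proof.
move=> aA pA cA om0 Aom Bop adm C21b _ _ C21_beta.
have [e [mu [m0 eb]]] := exists_eigenbasis_operator aA pA cA om0 Aom.
split; first exact: (cascade_to_wave eb Bop C21b adm).
exact: (wave_to_cascade eb Bop C21b C21_beta adm).
Qed.
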